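(* Let $p$ be an odd prime and let $a\in\mathbb Z$ with $p\nmid a$. For $$N:=\left|\left\{(j,k):\ 1\le j<k\le\frac{p-1}2\ \text{and}\ \{aj^2\}_p+\{ak^2\}_p>p\right\}\right|,$$ we have $$(-1)^N=\begin{cases}1&\text{if } p\equiv1\pmod4,\\(-1)^{(p-3)/8}&\text{if } p\equiv3\pmod8,\\(-1)^{(p+1)/8+(h(-p)+1)/2}\left(\frac ap\right)&\text{if } p\equiv7\pmod8.\end{cases}$$
   Context: $\{n\}_p$ denotes the least nonnegative residue of the integer $n$ modulo $p$; $(\frac{\cdot}{p})$ is the Legendre symbol; for $p\equiv3\pmod4$, $h(-p)$ is the class number of the imaginary quadratic field $\mathbb Q(\sqrt{-p})$ (it is odd). *)

(* Defs.v *)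
From HB Require Import structures.
From mathcomp Require Import all_boot all_order all_algebra all_field.
From mathcomp Require Import finmap boolp classical_sets functions cardinality.

Set Implicit Arguments.
Unset Strict Implicit.
Unset Printing Implicit Defensive.

Import GRing.Theory Num.Theory.
Local Open Scope classical_set_scope.
Local Open Scope ring_scope.

Definition legendre (a : int) (p : nat) : int :=
  if (p %| a)%Z then 0
  else if [exists x : 'I_p, ((x : nat)%:Z ^+ 2 == a %[mod p])%Z] then 1
  else -1.

Definition quadratic_field (d : int) : set algC :=
  [set z | exists x y : rat, z = ratr x + ratr y * sqrtC d%:~R].

Section IdealClasses.
(* K is meant to be a subfield of algC. *)
Variable K : set algC.

Definition ring_of_integers : set algC := [set z | K z /\ z \in Aint].

Definition is_nonzero_ideal (I : set algC) : Prop :=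
  [/\ I `<=` ring_of_integers,
      forall x y, I x -> I y -> I (x + y),
      forall r x, ring_of_integers r -> I x -> I (r * x)
    & exists2 x, I x & x != 0].

Definition ideal_equiv (I J : set algC) : Prop :=
  exists a b : algC, [/\ ring_of_integers a, ring_of_integers b,
    a != 0, b != 0 & [set a * x | x in I] = [set b * y | y in J]].

Definition ideal_class (I : set algC) : set (set algC) :=
  [set J | is_nonzero_ideal J /\ ideal_equiv I J].

Definition ideal_classes : set (set (set algC)) :=
  [set ideal_class I | I in is_nonzero_ideal].

(* fset_set sends an infinite set to the empty one; for a number field K there
   are finitely many classes, so this is their actual number. *)
Definition class_number : nat := #|` fset_set ideal_classes|.
End IdealClasses.

Definition hneg (p : nat) : nat := class_number (quadratic_field (- p%:Z)).

(* {n}_p is (n %% p)%Z, which intdiv takes nonnegative. *)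
Definition pair_set (p : nat) (a : int) : {set 'I_p * 'I_p} :=
  [set u : 'I_p * 'I_p |
    [&& (1 <= u.1)%N, (u.1 < u.2)%N, (u.2 <= (p - 1) %/ 2)%N
      & p%:Z < (a * (u.1 : nat)%:Z ^+ 2 %% p)%Z
               + (a * (u.2 : nat)%:Z ^+ 2 %% p)%Z]].

(* Main.v *)
Require Import Defs.
From HB Require Import structures.
From mathcomp Require Import all_boot all_order all_algebra all_field.
From mathcomp Require Import all_fingroup all_solvable.
From mathcomp Require Import finmap boolp classical_sets functions cardinality.
From mathcomp Require Import zify ring lra.
Import Order.TTheory GRing.Theory Num.Theory.
Local Open Scope ring_scope.

(** Let e = (a/p) and m = (p-1)/2. As j runs over 1, .., m, the residues of a j^2
    run over the m residues r with (r/p) = e, so 2 N is the number of ordered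
    pairs of such residues with sum above p, minus the number of those residues
    above p/2. If p = 1 mod 4, the reflection r -> p - r preserves this set of
    residues, and 4 N = m (m - 2) follows. If p = 3 mod 4, the reflection maps it
    onto its complement, and N becomes a combination of the sum A of r (r/p) over
    r < p and the sum T of (k/p) over k <= m. Sorting the r by halves and by
    parity gives ((2/p) - 2) A = p T, and (2/p) is known from quadratic
    reciprocity. For p = 3 mod 8 the unknown T cancels modulo 2; for p = 7 mod 8
    one has A = - p T, and the theorem comes down to T = h(-p), that is, to
    Dirichlet's formula p h(-p) = - A.

    The class number formula is proved without L(1), pi or Gauss sums over the
    complex numbers, by regularizing the zeta function of Q(sqrt(-p)) at 0. Put
    phi(n) = max(0, X - n)^3. The key remark is that a function that oscillates
    on a lattice has a small sum against phi: for a positive form Q of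
    discriminant -p, the sum over v in Z^2 of (4 [v in 2 Z^2] - 1) phi(Q v) is
    o(X^3), because the bracket is the sum of the three nontrivial characters of
    (Z/2)^2 and third differences gain a factor X^(3/2) in every row
    ([lattice_bound]). Choose one form in each ideal class. Every ideal of norm n
    is obtained from exactly two vectors of value n, v and -v
    ([sum_representations]); so the total is 3 h X^3, from the origin of each of
    the h lattices, plus 2 S, where S is the sum over n of
    r(n) (4 phi(4 n) - phi(n)) and r(n) is the number of ideals of norm n. On the
    other hand r(n) is the sum of (d/p) over the divisors d of n
    ([ideal_countE]), whence S is the double sum over d, k >= 1 of
    (d/p) w(k) phi(d k) with w(k) = 3 or -1. Both factors have mean zero, and
    the hyperbola method yields S = - (3/2) H X^3 + o(X^3) with
    H = - A / p ([hyperbola_sum]). Comparing both values of the total gives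
    h = H.

    The formula for r(n) needs the number of roots of
    X^2 - X + (p+1)/4 modulo prime powers. Modulo a prime q this is quadratic
    reciprocity: the roots are the negatives of the two Gauss periods of order p
    in characteristic q, and they are rational over F_q exactly when
    (q/p) = 1 ([root_count_prime]); this covers q = 2 as well. Hensel lifting and
    the Chinese remainder theorem do the rest. *)

Set Implicit Arguments.
Unset Strict Implicit.
Unset Printing Implicit Defensive.

(** * The Legendre symbol *)

Lemma intr_pchar_eq0 (R : nzRingType) (p : nat) (a : int) :
  p \in [pchar R] -> ((a%:~R : R) == 0) = (p %| a)%Z.
Proof.
move=> charp; rewrite dvdzE /=; case: a => n.
  by rewrite -pmulrn -(dvdn_pcharf charp).
by rewrite NegzE mulrNz oppr_eq0 -pmulrn -(dvdn_pcharf charp).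
Qed.

Section Legendre.
Variable p : nat.
Hypotheses (p_prime : prime p) (p_odd : odd p).
Local Notation m := (p.-1)./2.

Let charFp : p \in [pchar 'F_p]. Proof. exact: pchar_Fp. Qed.

Lemma prime_odd_half : p = (m.*2).+1.
Proof.
have p_gt0 := prime_gt0 p_prime; move: p_odd.
by rewrite -{1 2}(prednK p_gt0) /= => /even_halfK->.
Qed.

Lemma prime_odd_pred : p.-1 = m.*2.
Proof. by rewrite [in LHS]prime_odd_half. Qed.

Lemma half_gt0 : (0 < m)%N.
Proof. by have := prime_gt1 p_prime; have := prime_odd_half; lia. Qed.

Lemma Fp_fermat (x : 'F_p) : x != 0 -> x ^+ p.-1 = 1.
Proof.
move=> x0; apply: (mulfI x0); rewrite -exprS prednK ?prime_gt0 // mulr1.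
by rewrite -{2}(expf_card x) card_Fp.
Qed.

Lemma Fp_half_power (x : 'F_p) : x != 0 -> x ^+ m = 1 \/ x ^+ m = -1.
Proof.
move=> /Fp_fermat; rewrite {1}prime_odd_pred -muln2 exprM => /eqP; rewrite sqrf_eq1.
by case/orP=> /eqP; [left | right].
Qed.

(** The squares of 1, .., (p-1)/2 already exhaust the (p-1)/2 roots that
    X^((p-1)/2) - 1 can have. *)
Lemma Fp_square (x : 'F_p) : x ^+ m = 1 -> exists y : 'F_p, y ^+ 2 = x.
Proof.
move=> xm; have [|xNsq] := boolP [exists y : 'F_p, y ^+ 2 == x].
  by case/existsP=> y /eqP; exists y.
have m_gt0 := half_gt0.
pose s := [seq (i%:R : 'F_p) ^+ 2 | i <- iota 1 m].
have lt_p i : i \in iota 1 m -> (0 < i <= m)%N.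
  by rewrite mem_iota add1n ltnS.
have nz i : i \in iota 1 m -> (i%:R : 'F_p) != 0.
  move=> /lt_p /andP[i0 im]; rewrite -(dvdn_pcharf charFp) gtnNdvd //.
  by have := prime_odd_half; lia.
have := @max_poly_roots _ ('X^m - 1) (x :: s) _ _ _.
rewrite size_XnsubC // /= size_map size_iota ltnn => h.
suff: false by []; apply: h.
- by rewrite -size_poly_eq0 size_XnsubC.
- rewrite /root !hornerE xm subrr eqxx /=.
  apply/allP=> _ /mapP[i iI ->]; rewrite /root !hornerE -exprM mul2n.
  by rewrite subr_eq0; apply/eqP; have := Fp_fermat (nz i iI); rewrite {1}prime_odd_pred.
apply/andP; split.
  apply: contra xNsq => /mapP[i _ ->]; apply/existsP; exists i%:R; exact: eqxx.
rewrite map_inj_in_uniq ?iota_uniq // => i j iI jI /eqP.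
have /andP[i0 im] := lt_p i iI; have /andP[j0 jm] := lt_p j jI.
have bd : (i + j < p)%N by have := prime_odd_half; lia.
rewrite eqf_sqr => /orP[].
  wlog lij : i j iI jI i0 im j0 jm bd / (i <= j)%N => [H|].
    case: (leqP i j) => [/H|/ltnW ji] //; first exact.
    by rewrite eq_sym => /(H j i jI iI j0 jm i0 im _ ji)->; rewrite // addnC.
  rewrite eq_sym -subr_eq0 -natrB // -(dvdn_pcharf charFp) => /dvdn_leq h2.
  apply/eqP; rewrite eqn_leq lij /= -subn_eq0 -leqn0 leqNgt.
  by apply/negP=> /h2; rewrite leqNgt => /negP[]; lia.
rewrite -addr_eq0 -natrD -(dvdn_pcharf charFp) => /dvdn_leq.
by rewrite addn_gt0 i0 => /(_ isT); lia.
Qed.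

Lemma legendre_euler (a : int) : (legendre a p)%:~R = a%:~R ^+ m :> 'F_p.
Proof.
have m_gt0 := half_gt0.
rewrite /legendre -(intr_pchar_eq0 a charFp).
have [->|a0] := eqVneq; first by rewrite expr0n gtn_eqF.
case: existsP => [[x]|Nsq].
  rewrite eqz_mod_dvd -(intr_pchar_eq0 _ charFp) rmorphB rmorphXn /= subr_eq0.
  move=> /eqP xa; rewrite -xa -exprM mul2n.
  by rewrite -prime_odd_pred Fp_fermat // -sqrf_eq0 xa.
have [/Fp_square[y ya]|->] := Fp_half_power a0; last by rewrite rmorphN.
have ylt : (y < p)%N by rewrite -{2}(Fp_cast p_prime) ltn_ord.
case: Nsq; exists (Ordinal ylt) => /=.
rewrite eqz_mod_dvd -(intr_pchar_eq0 _ charFp) rmorphB rmorphXn /= subr_eq0.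
by rewrite -ya -pmulrn natr_Zp.
Qed.

Lemma legendre0 (a : int) : (p %| a)%Z -> legendre a p = 0.
Proof. by rewrite /legendre => ->. Qed.

Lemma legendre_pm1 (a : int) : ~~ (p %| a)%Z -> legendre a p = 1 \/ legendre a p = -1.
Proof. by rewrite /legendre => /negbTE->; case: ifP; [left|right]. Qed.

Lemma legendre_le1 (a : int) : `|legendre a p| <= 1.
Proof. by rewrite /legendre; do 2?case: ifP. Qed.

(** Equalities between products of symbols can be checked modulo p, through
    Euler's criterion. *)
Lemma small_Fp_inj (c d : int) : `|c| <= 1 -> `|d| <= 1 ->
  c%:~R = d%:~R :> 'F_p -> c = d.
Proof.
move=> c1 d1 /eqP; rewrite -subr_eq0 -rmorphB (intr_pchar_eq0 _ charFp).
have p3 : (2 < p)%N by have := half_gt0; have := prime_odd_half; lia.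
move=> /dvdzP[k ek]; have k0 : k = 0 by nia.
by move: ek; rewrite k0; lia.
Qed.

Lemma legendreM (a b : int) : legendre (a * b) p = legendre a p * legendre b p.
Proof.
apply: small_Fp_inj; first exact: legendre_le1.
  by rewrite normrM mulr_ile1 ?legendre_le1.
by rewrite intrM !legendre_euler intrM exprMn.
Qed.

Lemma legendre1 : legendre 1 p = 1.
Proof.
apply: small_Fp_inj => //; first exact: legendre_le1.
by rewrite legendre_euler expr1n.
Qed.

Lemma legendreN1 : legendre (-1) p = (-1) ^+ m.
Proof.
apply: small_Fp_inj; first exact: legendre_le1.
  by rewrite normrX normrN1 expr1n.
by rewrite legendre_euler rmorphXn /= !rmorphN.
Qed.

Lemma legendre_mod (a b : int) : (a == b %[mod p])%Z -> legendre a p = legendre b p.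
Proof.
rewrite eqz_mod_dvd -(intr_pchar_eq0 _ charFp) rmorphB subr_eq0 => /eqP ab.
apply: small_Fp_inj; try exact: legendre_le1.
by rewrite !legendre_euler ab.
Qed.

Lemma legendre_reflect (r : nat) :
  (r <= p)%N -> legendre (p - r)%N p = (-1) ^+ m * legendre r p.
Proof.
move=> rp; rewrite -subzn // (@legendre_mod _ (-1 * r%:Z)); last first.
  by rewrite eqz_mod_dvd mulN1r opprK subrK.
by rewrite legendreM // legendreN1.
Qed.

Lemma legendre_sq (a : int) : ~~ (p %| a)%Z -> legendre (a ^+ 2) p = 1.
Proof.
by move=> pa; rewrite expr2 legendreM; case: (legendre_pm1 pa) => ->.
Qed.

End Legendre.

(** * Counting the pairs through residues *)

(** The odd numbers below 2 m + 1 are the reflections of the even ones. *)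
Lemma sum_even_odd (F : nat -> int) m :
  \sum_(1 <= r < (m.*2).+1) F r = \sum_(1 <= k < m.+1) (F k.*2 + F ((m.*2).+1 - k.*2)%N).
Proof.
rewrite big_split /= [X in _ + X]big_nat_rev /=.
have -> : \sum_(1 <= k < m.+1) F ((m.*2).+1 - (1 + m.+1 - k.+1).*2)%N =
    \sum_(1 <= k < m.+1) F (k.*2.-1)%N.
  rewrite big_nat [RHS]big_nat; apply: eq_bigr => k /andP[k0 km]; congr F; lia.
elim: m => [|m IH]; first by rewrite !big_geq.
have -> : \sum_(1 <= r < (m.+1.*2).+1) F r =
    \sum_(1 <= r < (m.*2).+1) F r + F (m.*2).+1 + F (m.*2).+2.
  by rewrite doubleS big_nat_recr //= big_nat_recr.
rewrite IH [\sum_(1 <= k < m.+2) F k.*2]big_nat_recr //.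
by rewrite [\sum_(1 <= k < m.+2) F k.*2.-1]big_nat_recr //= doubleS; ring.
Qed.

Lemma sum_halves (F : nat -> int) m :
  \sum_(1 <= r < (m.*2).+1) F r = \sum_(1 <= k < m.+1) (F k + F ((m.*2).+1 - k)%N).
Proof.
rewrite big_split /= (@big_cat_nat _ _ _ m.+1) //=; last by lia.
congr (_ + _); rewrite [RHS]big_nat_rev /= -{1}[m.+1]add1n big_addn.
have -> : ((m.*2).+1 - m = m.+1)%N by lia.
rewrite big_nat [RHS]big_nat; apply: eq_bigr => k /andP[k0 km]; congr F; lia.
Qed.

Section PairCount.
Variables (p : nat) (a : int).
Hypotheses (p_prime : prime p) (p_odd : odd p) (pNa : ~~ (p %| a)%Z).
Local Notation m := (p.-1)./2.
Local Notation eta := (legendre a p).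
Local Notation leg r := (legendre r%:Z p).

Let pE : p = (m.*2).+1 := prime_odd_half p_prime p_odd.
Let p_gt0 : (0 < p)%N := prime_gt0 p_prime.

Lemma dvdz_prime_mul (x y : int) : (p %| x * y)%Z = (p %| x)%Z || (p %| y)%Z.
Proof. by rewrite !dvdzE abszM Euclid_dvdM. Qed.

Lemma sqres_lt (j : 'I_p) : (`|(a * (j : nat)%:Z ^+ 2 %% p)%Z| < p)%N.
Proof.
have p0 : p%:Z != 0 by rewrite eqz_nat -lt0n.
by rewrite -ltz_nat gez0_abs ?modz_ge0 // ltz_pmod.
Qed.

Definition sqres (j : 'I_p) : 'I_p := Ordinal (sqres_lt j).

Lemma sqresE j : (sqres j : nat)%:Z = (a * (j : nat)%:Z ^+ 2 %% p)%Z.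
Proof.
have p0 : p%:Z != 0 by rewrite eqz_nat -lt0n.
by rewrite /= gez0_abs ?modz_ge0.
Qed.

Definition half_range : {set 'I_p} := [set j : 'I_p | (0 < j <= m)%N].

Lemma half_range_ndvd (j : 'I_p) : j \in half_range -> ~~ (p %| (j : nat)%:Z)%Z.
Proof. by rewrite inE dvdzE /= => /andP[j0 jm]; rewrite gtnNdvd // ltn_ord. Qed.

Lemma sqres_inj : {in half_range &, injective sqres}.
Proof.
move=> i j iH jH /(congr1 (fun r : 'I_p => (r : nat)%:Z)); rewrite !sqresE => /eqP.
rewrite eqz_mod_dvd -mulrBr dvdz_prime_mul // (negPf pNa) /= subr_sqr dvdz_prime_mul //.
move: iH jH; rewrite !inE => /andP[i0 im] /andP[j0 jm] h; apply: val_inj => /=.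
have ij0 : (0 < i + j)%N by rewrite addn_gt0 i0.
have ijp : (i + j < p)%N by move: pE; lia.
case/orP: h; last by rewrite -PoszD dvdzE /= => /dvdn_leq; rewrite ij0 => /(_ isT); lia.
move=> /dvdzP[k ek]; have k0 : k = 0 by nia.
by move: ek; rewrite k0; lia.
Qed.

(** If (r/p) = (a/p) then r / a is a square modulo p, and one of its two roots
    lies in the first half of the range. *)
Lemma sqres_image : sqres @: half_range = [set r : 'I_p | leg r == eta].
Proof.
apply/setP=> r; rewrite !inE; apply/imsetP/eqP => [[j jH ->]|lr].
  rewrite sqresE (@legendre_mod p p_prime p_odd _ (a * (j : nat)%:Z ^+ 2)); last by rewrite modz_mod.
  by rewrite legendreM // legendre_sq ?mulr1 // half_range_ndvd.
have charFp : p \in [pchar 'F_p] := pchar_Fp p_prime.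
have a0 : a%:~R != 0 :> 'F_p by rewrite (intr_pchar_eq0 _ charFp).
have r0 : (r : nat)%:R != 0 :> 'F_p.
  rewrite -(dvdn_pcharf charFp); apply/negP=> pr; move: lr; rewrite legendre0 //.
  by case: (legendre_pm1 pNa) => ->.
have := congr1 (fun z : int => z%:~R : 'F_p) lr; rewrite !legendre_euler // -pmulrn => ram.
have [y yE] : exists y : 'F_p, y ^+ 2 = (r : nat)%:R / a%:~R.
  by apply: Fp_square => //; rewrite exprMn exprVn ram mulfV // expf_neq0.
have y0 : y != 0 by rewrite -sqrf_eq0 yE mulf_neq0 // invr_eq0.
have [j [jH jE]] : exists j : 'I_p, j \in half_range /\ ((j : nat)%:R : 'F_p) ^+ 2 = y ^+ 2.
  have ylt : (y < p)%N by rewrite -[X in (_ < X)%N](Fp_cast p_prime) ltn_ord.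
  have ypos : (0 < y)%N by rewrite lt0n; apply: contra y0 => /eqP y0; apply/eqP/val_inj.
  have [ym|ym] := leqP y m.
    exists (Ordinal ylt); rewrite inE /= ypos ym; split=> //.
    by rewrite natr_Zp.
  have zlt : (p - y < p)%N by lia.
  exists (Ordinal zlt); rewrite inE /=; split; first by move: ym ypos ylt pE; lia.
  by rewrite natrB ?(ltnW ylt) // pchar_Fp_0 // sub0r sqrrN natr_Zp.
exists j => //; apply: val_inj; apply/eqP => /=.
rewrite -eqz_nat -/(sqres_lt j); have := sqresE j => /= ->.
have rs : ((r : nat)%:Z %% p)%Z = (r : nat)%:Z by rewrite modz_nat modn_small.
rewrite -[X in X == _]rs.
rewrite eqz_mod_dvd -(intr_pchar_eq0 _ charFp) rmorphB rmorphM rmorphXn /= -!pmulrn jE yE.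
by rewrite mulrCA mulfV // mulr1 subrr.
Qed.
Definition res_ind (r : nat) : int := ((leg r == eta) : nat)%:Z.

Lemma sum_sqres (G : nat -> int) :
  \sum_(j in half_range) G (sqres j) = \sum_(1 <= r < p) res_ind r * G r.
Proof.
rewrite -(big_imset (fun r : 'I_p => G r) sqres_inj) sqres_image big_mkcond /=.
rewrite [LHS](eq_bigr (fun r : 'I_p => res_ind r * G r)); last first.
  by move=> r _; rewrite inE /res_ind; case: (_ == _); rewrite ?mul1r ?mul0r.
rewrite -(big_mkord xpredT (fun r : nat => res_ind r * G r)) big_ltn //.
rewrite {1}/res_ind legendre0 //.
by case: (legendre_pm1 pNa) => ->; rewrite mul0r add0r.
Qed.

Lemma card_half_range : #|half_range| = m.
Proof.
rewrite -sum1_card (eq_bigl (fun j : 'I_p => (0 < j < m.+1)%N)); last first.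
  by move=> j; rewrite inE ltnS.
have mE : m = (\sum_(1 <= j < m.+1) 1)%N by rewrite sum_nat_const_nat subSS subn0 muln1.
rewrite [RHS]mE.
have mp : (m.+1 <= p)%N by move: pE; lia.
transitivity (\sum_(0 <= j < p) (if (0 < j < m.+1)%N then 1 else 0))%N.
  by rewrite big_mkord -big_mkcond.
have z : (\sum_(m.+1 <= j < p) (if (0 < j < m.+1)%N then 1 else 0) = 0)%N.
  by rewrite big_nat big1 // => j /andP[mj _]; rewrite [(j < _)%N]ltnNge mj andbF.
rewrite (@big_cat_nat _ _ _ m.+1) //= z addn0.
rewrite big_ltn //= add0n [LHS]big_nat [RHS]big_nat.
by apply: eq_bigr => j /andP[j0 jm]; rewrite j0 jm.
Qed.

Lemma sum_res_ind : \sum_(1 <= r < p) res_ind r = m%:Z.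
Proof.
have := sum_sqres (fun=> 1); under [RHS]eq_bigr => r _ do rewrite mulr1.
by move=> <-; rewrite sumr_const card_half_range natz.
Qed.

(** Each unordered pair is counted twice among the ordered pairs, and the
    diagonal once. *)
Lemma double_pair_set :
  2 * #|pair_set p a|%:Z + \sum_(1 <= r < p) res_ind r * (p < r + r)%N%:Z =
  \sum_(1 <= r < p) res_ind r * \sum_(1 <= s < p) res_ind s * (p < r + s)%N%:Z.
Proof.
pose B (j k : 'I_p) := (p < sqres j + sqres k)%N.
have cardE : #|pair_set p a|%:Z =
    \sum_(j in half_range) \sum_(k in half_range) ((j < k)%N && B j k)%:Z.
  rewrite -sum1_card big_mkcond /= -natz natr_sum.
  rewrite (eq_bigr (fun u : 'I_p * 'I_p => if u.1 \in half_range then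
    (if u.2 \in half_range then ((u.1 < u.2)%N && B u.1 u.2)%:Z else 0) else 0)); last first.
    move=> [j k] _; rewrite !inE /= -!sqresE -PoszD ltz_nat -/(B j k) subn1 divn2.
    case: (ltnP 0 j) => //= j0; case: (ltnP j k) => //= jk; last first.
      by case: ifP => // _; case: ifP => // _; rewrite andbF.
    have -> : (0 < k)%N by exact: ltn_trans jk.
    case: (leqP k m) => km /=; last by rewrite if_same.
    by rewrite (leq_trans (ltnW jk) km); case: (B j k).
  rewrite -(pair_bigA _ (fun j k : 'I_p => if j \in half_range then
    (if k \in half_range then ((j < k)%N && B j k)%:Z else 0) else 0)) /=.
  rewrite [RHS]big_mkcond; apply: eq_bigr => j _; case: ifP => _; last by rewrite big1.
  by rewrite [RHS]big_mkcond.
have -> : \sum_(1 <= r < p) res_ind r * (p < r + r)%N%:Z =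
    \sum_(j in half_range) (B j j)%:Z.
  by rewrite -(sum_sqres (fun r => (p < r + r)%N%:Z)).
have -> : \sum_(1 <= r < p) res_ind r * \sum_(1 <= s < p) res_ind s * (p < r + s)%N%:Z =
    \sum_(j in half_range) \sum_(k in half_range) (B j k)%:Z.
  rewrite -(sum_sqres (fun r => \sum_(1 <= s < p) res_ind s * (p < r + s)%N%:Z)).
  by apply: eq_bigr => j _; rewrite -(sum_sqres (fun s => (p < sqres j + s)%N%:Z)).
have swap : #|pair_set p a|%:Z =
    \sum_(j in half_range) \sum_(k in half_range) ((k < j)%N && B j k)%:Z.
  rewrite cardE exchange_big; apply: eq_bigr => j _; apply: eq_bigr => k _.
  by rewrite /B addnC.
have -> : 2 * #|pair_set p a|%:Z = #|pair_set p a|%:Z + #|pair_set p a|%:Z by ring.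
rewrite {1}cardE swap -!big_split /=; apply: eq_bigr => j jH.
have -> : (B j j)%:Z = \sum_(k in half_range) ((j == k) && B j k)%:Z.
  rewrite (bigD1 j) //= eqxx big1 ?addr0 // => k /andP[_ kj].
  by rewrite eq_sym (negPf kj).
rewrite -!big_split /=; apply: eq_bigr => k _.
by rewrite -val_eqE /=; case: (ltngtP j k) => _; case: (B j k).
Qed.

Lemma leg_pm1 (r : nat) : (0 < r < p)%N -> leg r = 1 \/ leg r = -1.
Proof.
by move=> /andP[r0 rp]; apply: legendre_pm1; rewrite dvdzE /= gtnNdvd.
Qed.

Lemma res_ind2 (r : nat) : (0 < r < p)%N -> 2 * res_ind r = 1 + eta * leg r.
Proof.
by rewrite /res_ind => /leg_pm1[] ->; case: (legendre_pm1 pNa) => ->.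
Qed.

Lemma res_ind_opp (r : nat) : (0 < r < p)%N ->
  res_ind (p - r) = if odd m then 1 - res_ind r else res_ind r.
Proof.
move=> rp; have /andP[_ rp'] := rp; rewrite /res_ind legendre_reflect ?(ltnW rp') // -signr_odd.
case: (odd m); last by rewrite mul1r.
by rewrite expr1 mulN1r; case: (leg_pm1 rp) => ->; case: (legendre_pm1 pNa) => ->.
Qed.

Lemma sum_reflect (F : nat -> int) : \sum_(1 <= r < p) F r = \sum_(1 <= r < p) F (p - r)%N.
Proof.
by rewrite big_nat_rev /=; apply: eq_bigr => r _; rewrite add1n subSS.
Qed.

Definition descents : int :=
  \sum_(1 <= r < p) res_ind r * \sum_(1 <= t < p) res_ind t * (t < r)%N%:Z.

Lemma descentsE : 2 * descents = m%:Z * (m%:Z - 1).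
Proof.
suff : descents + descents + \sum_(1 <= r < p) res_ind r = m%:Z * m%:Z.
  by rewrite sum_res_ind; lia.
have e : descents = \sum_(1 <= r < p) res_ind r * \sum_(1 <= t < p) res_ind t * (r < t)%N%:Z.
  rewrite /descents; under eq_bigr => r _ do rewrite mulr_sumr.
  rewrite exchange_big /=; apply: eq_bigr => t _; rewrite mulr_sumr; apply: eq_bigr => r _.
  by rewrite mulrA [res_ind r * _]mulrC -mulrA.
rewrite {2}e /descents -!big_split /= -[X in X * _]sum_res_ind mulr_suml.
rewrite big_nat [RHS]big_nat; apply: eq_bigr => r rp.
have idem : res_ind r = res_ind r * res_ind r by rewrite /res_ind; case: (_ == _).
have diag : res_ind r = \sum_(1 <= t < p) res_ind t * (t == r)%:Z.
  rewrite (eq_bigr (fun t => if t == r then res_ind t else 0)); last first.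
    by move=> t _; case: (t == r); rewrite ?mulr1 ?mulr0.
  by rewrite -big_mkcond big_nat1_eq rp.
rewrite -mulrDr [X in _ + X]idem -mulrDr -sum_res_ind; congr (_ * _).
rewrite {1}diag -!big_split /=; apply: eq_bigr => t _; rewrite -!mulrDr.
by case: (ltngtP t r) => _; rewrite ?mulr1.
Qed.

(** With s = p - t, the condition p < r + s becomes t < r; the reflection keeps
    the indicator or turns it into its complement. *)
Lemma ordered_pairsE (b := odd m) :
  \sum_(1 <= r < p) res_ind r * \sum_(1 <= s < p) res_ind s * (p < r + s)%N%:Z =
  if b then \sum_(1 <= r < p) res_ind r * (r%:Z - 1) - descents else descents.
Proof.
have e r : \sum_(1 <= s < p) res_ind s * (p < r + s)%N%:Z =
    \sum_(1 <= t < p) (if b then 1 - res_ind t else res_ind t) * (t < r)%N%:Z.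
  rewrite sum_reflect big_nat [RHS]big_nat; apply: eq_bigr => t tp.
  rewrite res_ind_opp //; congr (_ * Posz (nat_of_bool _)).
  by move/andP: tp => [_ tp]; lia.
under eq_bigr => r _ do rewrite e.
rewrite /b /descents; case: (odd m) => //.
rewrite -sumrB big_nat [RHS]big_nat; apply: eq_bigr => r /andP[r0 rp].
rewrite -mulrBr; congr (_ * _); under eq_bigr => t _ do rewrite mulrBl mul1r.
rewrite sumrB; congr (_ - _).
rewrite (@big_cat_nat _ _ _ r) //=; last exact: ltnW.
have z : \sum_(r <= t < p) (t < r)%N%:Z = 0.
  by rewrite big_nat big1 // => t /andP[rt _]; rewrite ltnNge rt.
rewrite z addr0 (eq_big_nat _ _ (F2 := fun=> 1)); last by move=> t /andP[_ ->].
by rewrite sumr_const_nat natz subzn.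
Qed.

Lemma diagonalE :
  2 * (\sum_(1 <= r < p) res_ind r * (p < r + r)%N%:Z) =
  if odd m then m%:Z - eta * \sum_(1 <= k < m.+1) leg k else m%:Z.
Proof.
have e : \sum_(1 <= r < p) res_ind r * (p < r + r)%N%:Z =
    \sum_(1 <= k < m.+1) res_ind (p - k).
  rewrite [in LHS]pE sum_halves big_nat [RHS]big_nat; apply: eq_bigr => k /andP[k0 km].
  rewrite -pE; have -> : (p < k + k)%N = false by move: pE; lia.
  have -> : (p < p - k + (p - k))%N by move: pE; lia.
  by rewrite mulr0 add0r mulr1.
have tot := sum_res_ind; rewrite [in LHS]pE sum_halves -pE in tot.
have kp k : (0 < k < m.+1)%N -> (0 < k < p)%N by move: pE; lia.
rewrite e; case: ifP => om.
  have mE : m%:Z = \sum_(1 <= k < m.+1) 1 by rewrite sumr_const_nat natz subSS subn0.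
  rewrite {1}mE !mulr_sumr -sumrB big_nat [RHS]big_nat; apply: eq_bigr => k /kp kp'.
  rewrite res_ind_opp // om mulrBr res_ind2 //; ring.
rewrite -tot mulr_sumr big_nat [RHS]big_nat; apply: eq_bigr => k /kp kp'.
by rewrite res_ind_opp // om; ring.
Qed.

Theorem pair_count_mod1 : ~~ odd m -> 4 * #|pair_set p a|%:Z = m%:Z * (m%:Z - 2).
Proof.
move=> om; have := double_pair_set; rewrite ordered_pairsE (negPf om).
by have := diagonalE; rewrite (negPf om); have := descentsE; move: descents => x; lia.
Qed.

Theorem pair_count_mod3 : odd m ->
  4 * #|pair_set p a|%:Z = m%:Z * p%:Z + eta * (\sum_(d < p) d%:Z * leg (d : nat))
    - m%:Z * (m%:Z + 2) + eta * \sum_(1 <= k < m.+1) leg k.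
Proof.
move=> om; have := double_pair_set; rewrite ordered_pairsE om.
have := diagonalE; rewrite om; have := descentsE.
have -> : \sum_(d < p) d%:Z * leg (d : nat) = \sum_(1 <= d < p) d%:Z * leg d.
  by rewrite -(big_mkord xpredT (fun d : nat => d%:Z * leg d)) big_ltn // mul0r add0r.
have : 2 * (\sum_(1 <= r < p) res_ind r * (r%:Z - 1)) + 2 * m%:Z =
    m%:Z * p%:Z + eta * \sum_(1 <= d < p) d%:Z * leg d.
  have tot : \sum_(1 <= r < p) r%:Z = m%:Z * p%:Z.
    rewrite [in LHS]pE sum_halves -pE (eq_big_nat _ _ (F2 := fun=> p%:Z)).
      by rewrite sumr_const_nat subSS subn0 -mulr_natl natz.
    by move=> k /andP[k0 km]; rewrite -PoszD subnKC //; move: pE; lia.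
  rewrite -tot -{1}sum_res_ind !mulr_sumr -!big_split /= big_nat [RHS]big_nat.
  apply: eq_bigr => r rp; have e := res_ind2 rp.
  transitivity (2 * res_ind r * r%:Z); [ring | rewrite e; ring].
move: descents (\sum_(1 <= r < p) _) (\sum_(1 <= r < p) _) (\sum_(1 <= r < p) _) => x1 x2 x3 x4.
lia.
Qed.

End PairCount.

(** * Gauss periods and quadratic reciprocity *)

(** Since p divides q^(p-1) - 1, the unit group of the field with q^(p-1)
    elements has an element of order p. *)
Lemma exists_pth_root p q : prime p -> prime q -> q != p ->
  exists (L : finFieldType) (z : L), [/\ q \in [pchar L], z ^+ p = 1 & z != 1].
Proof.
move=> pp pq qp.
have tot_gt0 : (0 < totient p)%N by rewrite totient_gt0 prime_gt0.
have [L charL cardL] := pPrimePowerField pq tot_gt0.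
have dv : (p %| #|[set: {unit L}]%G|)%N.
  rewrite card_finField_unit cardL -subn1 -eqn_mod_dvd ?expn_gt0 ?prime_gt0 //.
  by apply/eqP/Euler_exp_totient; rewrite coprime_sym prime_coprime // dvdn_prime2 // eq_sym.
have [u _ ou] := Cauchy pp dv.
exists L, (val u); split=> //.
  by rewrite -FinRing.val_unitX -ou expg_order.
apply/eqP=> u1; have : #[u]%g = 1%N by apply/eqP; rewrite order_eq1; apply/eqP/val_inj.
by rewrite ou => p1; rewrite p1 in pp.
Qed.

Lemma natr_pchar_eq (R : nzRingType) q (i j : nat) : q \in [pchar R] ->
  (i < q)%N -> (j < q)%N -> (i%:R == j%:R :> R) = (i == j).
Proof.
move=> charR iq jq; rewrite -subr_eq0 !pmulrn -rmorphB (intr_pchar_eq0 _ charR).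
rewrite -eqz_mod_dvd !modz_small //; exact/andP.
Qed.

(** The q multiples of 1 are already all the roots of X^q - X. *)
Lemma prime_subfield (L : fieldType) q (x : L) : prime q -> q \in [pchar L] ->
  x ^+ q = x -> exists2 b, (b < q)%N & x = b%:R.
Proof.
move=> pq charL xq.
have [/mapP[b bI ->]|xN] := boolP (x \in [seq (b%:R : L) | b <- iota 0 q]).
  by exists b => //; move: bI; rewrite mem_iota.
have sz : size ('X^q - 'X : {poly L}) = q.+1.
  by rewrite size_polyDl ?size_polyXn // size_polyN size_polyX ltnS prime_gt1.
have := @max_poly_roots _ ('X^q - 'X) (x :: [seq (b%:R : L) | b <- iota 0 q]) _ _ _.
rewrite sz /= size_map size_iota ltnn => h; suff: false by []; apply: h.
- by rewrite -size_poly_eq0 sz.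
- rewrite /root !hornerE xq subrr eqxx /=; apply/allP=> _ /mapP[b _ ->].
  by rewrite /root !hornerE -(pFrobenius_autE charL) rmorph_nat subrr.
apply/andP; split=> //; rewrite map_inj_in_uniq ?iota_uniq // => i j.
by rewrite !mem_iota !add0n /= => iq jq /eqP; rewrite (natr_pchar_eq charL) // => /eqP.
Qed.

Section GaussPeriods.
Variable p : nat.
Hypotheses (p_prime : prime p) (p_mod4 : (p %% 4 = 3)%N).
Local Notation m := (p.-1)./2.

Lemma odd_mod4 : odd p.
Proof. by move: p_mod4; lia. Qed.
Let p_odd := odd_mod4.
Let charFp : p \in [pchar 'F_p]. Proof. exact: pchar_Fp. Qed.

Lemma odd_half_mod4 : odd m.
Proof. by move: p_mod4; have := prime_odd_half p_prime p_odd; lia. Qed.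

Lemma legendre_opp (d : nat) : (d <= p)%N -> legendre (p - d)%N p = - legendre d p.
Proof.
by move=> dp; rewrite legendre_reflect // -signr_odd odd_half_mod4 expr1 mulN1r.
Qed.

Definition chiF (a : 'F_p) : int := legendre (a : nat)%:Z p.

Lemma legendre_Fp (d : int) : legendre d p = chiF d%:~R.
Proof.
apply: (small_Fp_inj p_prime p_odd); try exact: legendre_le1.
by rewrite !legendre_euler // -pmulrn natr_Zp.
Qed.

Lemma chiFM a b : chiF (a * b) = chiF a * chiF b.
Proof.
rewrite -[a]natr_Zp -[b]natr_Zp -natrM !pmulrn -!legendre_Fp.
by rewrite PoszM legendreM.
Qed.

Lemma chiF0 : chiF 0 = 0.
Proof. by rewrite -(rmorph0 intr) -legendre_Fp legendre0 // dvdz0. Qed.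
Lemma chiF1 : chiF 1 = 1.
Proof. by rewrite -(rmorph1 intr) -legendre_Fp legendre1. Qed.

Lemma chiF_neg1 : chiF (-1) = -1.
Proof.
rewrite -(rmorphN1 intr) -legendre_Fp legendreN1 // -signr_odd.
by rewrite odd_half_mod4.
Qed.

Lemma chiF_pm1 a : a != 0 -> chiF a = 1 \/ chiF a = -1.
Proof.
move=> a0; apply: legendre_pm1.
by rewrite -(intr_pchar_eq0 _ charFp) -pmulrn natr_Zp.
Qed.

Lemma chiF_eq0 a : (chiF a == 0) = (a == 0).
Proof.
by have [->|/chiF_pm1[]->//] := eqVneq a 0; rewrite chiF0.
Qed.

Lemma chiFV a : chiF a^-1 = chiF a.
Proof.
have [->|a0] := eqVneq a 0; first by rewrite invr0.
have : chiF a * chiF a^-1 = 1 by rewrite -chiFM mulfV // chiF1.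
by case: (chiF_pm1 a0) => ->; lia.
Qed.

Lemma chiFN a : chiF (- a) = - chiF a.
Proof. by rewrite -[- a]mulN1r chiFM chiF_neg1 mulN1r. Qed.

Lemma card_chiF_neg : #|[set a | chiF a == -1]| = #|[set a | chiF a == 1]|.
Proof.
have <- : [set - a | a in [set a | chiF a == 1]] = [set a | chiF a == -1].
  apply/setP=> a; rewrite inE; apply/imsetP/idP => [[b] |].
    by rewrite inE => /eqP b1 ->; rewrite chiFN b1.
  move=> /eqP a1; exists (- a); last by rewrite opprK.
  by rewrite inE chiFN a1.
by rewrite card_imset //; exact: oppr_inj.
Qed.

(** As -1 is a nonresidue, negation exchanges residues and nonresidues. *)
Lemma card_chiF_pos : #|[set a | chiF a == 1]| = m.
Proof.
have : addn #|[set a | chiF a == 1]| #|[set a | chiF a == -1]| = p.-1.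
  rewrite -cardsUI; have -> : [set a | chiF a == 1] :&: [set a | chiF a == -1] = finset.set0.
    by apply/setP=> a; rewrite !inE; case: eqP => // ->.
  have -> : [set a | chiF a == 1] :|: [set a | chiF a == -1] = [set~ 0].
    apply/setP=> a; rewrite !inE -chiF_eq0.
    by have [->|/chiF_pm1[]->//] := eqVneq a 0; rewrite chiF0.
  by rewrite cards0 addn0 cardsC1 card_Fp.
rewrite card_chiF_neg addnn => <-; by rewrite doubleK.
Qed.

(** The nonresidues u other than -1 are paired by inversion, which changes the
    quadratic character of 1 + u. *)
Lemma card_chiF_succ_sym :
  #|[set u | (chiF u == -1) && (chiF (1 + u) == 1)]| =
  #|[set u | (chiF u == -1) && (chiF (1 + u) == -1)]|.
Proof.
have chi_inv u : chiF u = -1 -> chiF (1 + u^-1) = - chiF (1 + u).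
  move=> u1; have u0 : u != 0 by rewrite -chiF_eq0 u1.
  have -> : 1 + u^-1 = (1 + u) * u^-1 by rewrite mulrDl mul1r mulfV // addrC.
  by rewrite chiFM chiFV u1 mulrN1.
rewrite -(card_imset _ invr_inj); congr #|pred_of_set _|.
apply/setP=> u; rewrite inE; apply/imsetP/idP => [[v] |].
  by rewrite inE => /andP[/eqP v1 /eqP v2] ->; rewrite chiFV chi_inv // v1 v2.
move=> /andP[/eqP u1 /eqP u2]; exists u^-1; last by rewrite invrK.
by rewrite inE chiFV chi_inv // u1 u2.
Qed.

Lemma card_chiF_succ :
  #|[set u | (chiF u == -1) && (chiF (1 + u) == 1)]| = (p.+1 %/ 4).-1.
Proof.
have sym := card_chiF_succ_sym.
set U := [set u | _] in sym *; set V := [set u | _] in sym.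
have UUV : [set u | chiF u == -1] = -1 |: (U :|: V).
  apply/setP=> u; rewrite !inE.
  have [->|u1] := eqVneq u (-1); first by rewrite chiF_neg1.
  have : 1 + u != 0 by rewrite addrC addr_eq0.
  by case/chiF_pm1 => ->; rewrite /= ?andbT ?andbF ?orbF.
have UIV : U :&: V = finset.set0.
  by apply/setP=> u; rewrite !inE; case: eqP => //= _; case: eqP => // ->.
have /eqP := card_chiF_neg; rewrite UUV cardsU1 !inE subrr chiF0 andbF /= card_chiF_pos.
have := cardsUI U V; rewrite UIV cards0 addn0 -sym => -> /eqP.
by move: #|U| p_mod4 (prime_odd_half p_prime p_odd) => k; lia.
Qed.

Lemma card_chiF_succ_neg :
  #|[set u | (chiF u == -1) && (chiF (1 + u) == -1)]| = (p.+1 %/ 4).-1.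
Proof. by rewrite -card_chiF_succ_sym card_chiF_succ. Qed.

Variables (L : fieldType) (z : L).
Hypotheses (zp : z ^+ p = 1) (z1 : z != 1).

(** The additive character of F_p attached to the root of unity z, with values in
    a field of another characteristic. *)
Definition addchar (a : 'F_p) : L := z ^+ (a : nat).
Definition period (e : int) : L := \sum_(a | chiF a == e) addchar a.

Lemma addcharX (n : nat) : addchar n%:R = z ^+ n.
Proof. by rewrite /addchar val_Fp_nat // expr_mod. Qed.

Lemma addcharD a b : addchar (a + b) = addchar a * addchar b.
Proof. by rewrite -[a]natr_Zp -[b]natr_Zp -natrD !addcharX exprD. Qed.

Lemma addcharM a n : addchar (a * n%:R) = addchar a ^+ n.
Proof. by rewrite -{1}[a]natr_Zp -natrM addcharX exprM. Qed.

Lemma sum_addchar : \sum_a addchar a = 0.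
Proof.
have e1 : addchar 1 = z by rewrite -[1]/(1%:R) addcharX.
have shift : \sum_a addchar a = z * \sum_a addchar a.
  rewrite [LHS](reindex_inj (addrI 1)) /= mulr_sumr; apply: eq_bigr => a _.
  by rewrite addcharD e1.
have : (1 - z) * \sum_a addchar a = 0 by rewrite mulrBl mul1r -shift subrr.
by move/eqP; rewrite mulf_eq0 subr_eq0 eq_sym (negPf z1) => /eqP.
Qed.

Lemma sum_periods : period 1 + period (-1) = -1.
Proof.
have := sum_addchar.
rewrite (bigD1 0) //= {1}/addchar /= expr0.
rewrite (bigID (fun a => chiF a == 1)) /=.
have -> : \sum_(a | (a != 0) && (chiF a == 1)) addchar a = period 1.
  by apply: eq_bigl => a; rewrite -chiF_eq0; case: eqP => //= ->; rewrite ?andbF.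
have -> : \sum_(a | (a != 0) && (chiF a != 1)) addchar a = period (-1).
  apply: eq_bigl => a; have [->|a0] := eqVneq a 0; first by rewrite chiF0.
  by case: (chiF_pm1 a0) => ->.
by move/eqP; rewrite addrC addr_eq0 => /eqP.
Qed.

Lemma period_scale e v : v != 0 ->
  \sum_(a | chiF a == e) addchar (a * v) = period (e * chiF v).
Proof.
move=> v0; rewrite /period [RHS](reindex_inj (mulIf v0)) /=; apply: eq_bigl => a.
by rewrite chiFM; case: (chiF_pm1 v0) => ->; rewrite ?mulr1 // !mulrN1 eqr_opp.
Qed.

(** Writing the nonresidues as a u with u a fixed nonresidue turns the product
    into sums over the lines a (1 + u), each of which is a period again. *)
Lemma mul_periods : period 1 * period (-1) = (p.+1 %/ 4)%:R.
Proof.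
have -> : period 1 * period (-1) =
    \sum_(u | chiF u == -1) \sum_(a | chiF a == 1) addchar (a * (1 + u)).
  rewrite exchange_big /= mulr_suml; apply: eq_bigr => a /eqP a1.
  have a0 : a != 0 by rewrite -chiF_eq0 a1.
  rewrite mulr_sumr (reindex_inj (mulfI a0)) /=; apply: eq_big => u.
    by rewrite chiFM a1 mul1r.
  by move=> _; rewrite mulrDr mulr1 addcharD.
rewrite (bigD1 (-1)) ?chiF_neg1 //= subrr.
have -> : \sum_(a | chiF a == 1) addchar (a * 0) = m%:R.
  rewrite (eq_bigr (fun=> 1)) => [|a _]; last by rewrite mulr0 /addchar expr0.
  by rewrite sumr_const -card_chiF_pos; congr (1 *+ _); apply: eq_card => a; rewrite inE.
rewrite (eq_bigr (fun u => period (chiF (1 + u)))); last first.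
  by move=> u /andP[_ u1]; rewrite period_scale ?mul1r // addrC addr_eq0.
rewrite (bigID (fun u => chiF (1 + u) == 1)) /=.
have -> : \sum_(u | (chiF u == -1) && (u != -1) && (chiF (1 + u) == 1))
    period (chiF (1 + u)) = period 1 *+ (p.+1 %/ 4).-1.
  rewrite (eq_bigr (fun=> period 1)) => [|u /andP[_ /eqP->]//].
  rewrite sumr_const -card_chiF_succ; congr (_ *+ _); apply: eq_card => u.
  rewrite !inE unfold_in; have [->|] := eqVneq u (-1); last by rewrite andbT.
  by rewrite subrr chiF0 !andbF.
have -> : \sum_(u | (chiF u == -1) && (u != -1) && (chiF (1 + u) != 1))
    period (chiF (1 + u)) = period (-1) *+ (p.+1 %/ 4).-1.
  have e u : (chiF u == -1) && (u != -1) && (chiF (1 + u) != 1) ->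
      chiF (1 + u) = -1.
    move=> /andP[/andP[_ u1]]; have /chiF_pm1[->//|->//] : 1 + u != 0.
    by rewrite addrC addr_eq0.
  rewrite (eq_bigr (fun=> period (-1))) => [|u /e->//].
  rewrite sumr_const -card_chiF_succ_neg; congr (_ *+ _); apply: eq_card => u.
  rewrite !inE unfold_in; apply/idP/idP => [ue|/andP[u0 /eqP u1]]; last first.
    rewrite u0 u1 andbT /=; apply/eqP=> u2; move: u1; rewrite u2 subrr chiF0; lia.
  by rewrite (e u ue) eqxx andbT; case/andP: ue => /andP[].
have -> : m = ((p.+1 %/ 4).-1 + p.+1 %/ 4)%N.
  by move: p_mod4; have := prime_odd_half p_prime p_odd; lia.
by rewrite -mulrnDl sum_periods natrD mulNrn; ring.
Qed.

End GaussPeriods.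

(** The norm of b - omega, where omega = (1 + sqrt(-p)) / 2. *)
Definition fnorm (p : nat) (b : int) : int := b ^+ 2 - b + (p.+1 %/ 4)%:Z.

Definition root_count (p n : nat) : nat := #|[set b : 'I_n | (n %| fnorm p (b : nat))%Z]|.

Section Reciprocity.
Variable p : nat.
Hypotheses (p_prime : prime p) (p_mod4 : (p %% 4 = 3)%N).

(** Quadratic reciprocity, in the form that also covers q = 2: the negatives of
    the two Gauss periods are the roots of X^2 - X + (p+1)/4 in characteristic
    q, and the Frobenius map fixes them or swaps them according to the quadratic
    character of q. *)
Lemma root_count_prime q : prime q -> q != p -> (root_count p q)%:Z = 1 + legendre q p.
Proof.
move=> pq qp; have p_odd := odd_mod4 p_prime p_mod4.
have charFp : p \in [pchar 'F_p] by exact: pchar_Fp.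
have [L [z [charL zp z1]]] := exists_pth_root p_prime pq qp.
pose e1 := period p z 1; pose e2 := period p z (-1).
have sum12 : e1 + e2 = -1 := sum_periods p_prime p_mod4 zp z1.
have mul12 : e1 * e2 = (p.+1 %/ 4)%:R := mul_periods p_prime p_mod4 zp z1.
have pL : (p%:R : L) != 0.
  by rewrite -(dvdn_pcharf charL) dvdn_prime2.
have e12 : e1 != e2.
  apply: contra_neq pL => e12; have -> : p = (4 * (p.+1 %/ 4) - 1)%N by lia.
  rewrite natrB; last by lia.
  rewrite natrM -mul12 e12; transitivity (4%:R * (e2 * e2) - (- (e1 + e2)) ^+ 2).
    by rewrite sum12 opprK expr1n.
  by rewrite e12; ring.
have rootE (b : nat) : (q %| fnorm p b)%Z = (b%:R == - e1) || (b%:R == - e2).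
  rewrite -(intr_pchar_eq0 _ charL) /fnorm rmorphD rmorphB rmorphXn /= -!pmulrn -mul12.
  rewrite -[b%:R == - e1]addr_eq0 -[b%:R == - e2]subr_eq0 opprK -mulf_eq0.
  have -> : (b%:R : L) ^+ 2 - b%:R + e1 * e2 =
    b%:R ^+ 2 + b%:R * -1 + e1 * e2 by ring.
  by rewrite -sum12; congr (_ == _); ring.
have frob e : (period p z e) ^+ q = period p z (e * legendre q p).
  rewrite -(pFrobenius_autE charL) rmorph_sum /=.
  rewrite (eq_bigr (fun a => addchar z (a * q%:R))); last first.
    by move=> a _; rewrite pFrobenius_autE addcharM.
  rewrite (period_scale p_prime p_mod4) -1?(dvdn_pcharf charFp) ?dvdn_prime2 1?eq_sym //.
  by rewrite (legendre_Fp p_prime p_mod4).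
have natq (b : nat) : (b%:R : L) ^+ q = b%:R by rewrite -(pFrobenius_autE charL) rmorph_nat.
have natN (x : L) : (- x) ^+ q = - x ^+ q by rewrite -!(pFrobenius_autE charL) rmorphN.
have pNq : ~~ (p %| q%:Z)%Z by rewrite dvdzE /= dvdn_prime2 // eq_sym.
rewrite /root_count; case: (legendre_pm1 pNq) => l1.
- have [b1 b1q eb1] : exists2 b, (b < q)%N & - e1 = b%:R.
    by apply: (prime_subfield pq charL); rewrite natN frob l1 mulr1.
  have [b2 b2q eb2] : exists2 b, (b < q)%N & - e2 = b%:R.
    by apply: (prime_subfield pq charL); rewrite natN frob l1 mulr1.
  have -> : [set b : 'I_q | (q %| fnorm p (b : nat))%Z] = [set Ordinal b1q; Ordinal b2q].
    apply/setP=> b; rewrite !inE rootE eb1 eb2 -!val_eqE /=.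
    by rewrite !(natr_pchar_eq charL).
  by rewrite cards2 -val_eqE /= l1; case: eqP => // b12; move: e12;
    rewrite -[e1]opprK eb1 -[e2]opprK eb2 b12 eqxx.
- have -> : [set b : 'I_q | (q %| fnorm p (b : nat))%Z] = finset.set0.
    apply/setP=> b; rewrite !inE rootE; apply/negP=> /orP[] /eqP be; move/eqP: e12; apply.
      have := natq b; rewrite be natN frob l1 mulrN1 => /oppr_inj; exact/esym.
    by have := natq b; rewrite be natN frob l1 mulrNN mulr1 => /oppr_inj.
  by rewrite cards0 l1.
Qed.

End Reciprocity.

(** * Counting ideals of given norm *)

(** This is what makes multiplicative functions computable one prime at a time. *)
Lemma sum_divisors_pfactor (R : nmodType) (F : nat -> R) q e n : prime q -> (0 < n)%N ->
  coprime q n ->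
  \sum_(d <- divisors (q ^ e * n)) F d =
  \sum_(i < e.+1) \sum_(d <- divisors n) F (q ^ i * d)%N.
Proof.
move=> pq n0 cqn; have q0 := prime_gt0 pq.
have qn0 : (0 < q ^ e * n)%N by rewrite muln_gt0 expn_gt0 q0.
have perm : perm_eq (divisors (q ^ e * n))
    [seq (q ^ i * d)%N | i <- iota 0 e.+1, d <- divisors n].
  apply: uniq_perm; first exact: divisors_uniq.
    apply: allpairs_uniq; rewrite ?iota_uniq ?divisors_uniq //.
    move=> [i d] [j c] /allpairsP[[i1 d1] [_ dn [-> ->]]].
    move=> /allpairsP[[j1 c1] [_ cn [-> ->]]] /=.
    move: dn cn; rewrite /= -!dvdn_divisors // => dn cn eq1.
    have log x i' : (x %| n)%N -> logn q (q ^ i' * x) = i'.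
      move=> xn; have x0 : (0 < x)%N by exact: dvdn_gt0 xn.
      rewrite lognM ?expn_gt0 ?q0 // pfactorK // logn_coprime ?addn0 //.
      exact: coprime_dvdr xn cqn.
    have ij : i1 = j1 by rewrite -(log d1 i1) // eq1 log.
    move: eq1; rewrite ij => /eqP; rewrite eqn_mul2l expn_eq0.
    by rewrite (gtn_eqF q0) /= => /eqP->.
  move=> d; rewrite -dvdn_divisors //; apply/idP/allpairsP => [dq|[[i c] [iI cn ->]]].
    have d0 := dvdn_gt0 qn0 dq.
    have [c cc dE] := pfactor_coprime pq d0.
    exists (logn q d, c); split=> [||/=]; last by rewrite mulnC.
      rewrite mem_iota ltnS /= -(pfactorK e pq) -[logn q (q ^ e)]addn0.
      rewrite -(logn_coprime (m := n) cqn) // -lognM ?expn_gt0 ?q0 //.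
      exact: dvdn_leq_log.
    rewrite /= -dvdn_divisors // -(@Gauss_dvdr _ (q ^ e)) ?coprimeXr 1?coprime_sym //.
    by apply: dvdn_trans dq; rewrite dE dvdn_mulr.
  move: iI cn; rewrite mem_iota /= -dvdn_divisors // => iI cn.
  by apply: dvdn_mul => //; apply: dvdn_exp2l.
rewrite (perm_big _ perm) big_allpairs_dep.
by rewrite -(big_mkord xpredT (fun i => \sum_(d <- divisors n) F (q ^ i * d)%N)) /index_iota subn0.
Qed.

Lemma root_count_sum (p n M : nat) : (n <= M)%N ->
  root_count p n = (\sum_(c < M) ((c < n) && (n %| fnorm p (c : nat))%Z : nat))%N.
Proof.
move=> nM; rewrite /root_count -sum1_card.
rewrite (eq_bigl (fun c : 'I_n => (n %| fnorm p (c : nat))%Z)); last by move=> c; rewrite inE.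
rewrite (big_ord_widen_cond M (fun c : nat => (n %| fnorm p c)%Z) (fun=> 1%N)) //.
by rewrite big_mkcond; apply: eq_bigr => c _; rewrite andbC; case: (_ && _).
Qed.

Section RootCount.
Variable p : nat.
Hypotheses (p_prime : prime p) (p_mod4 : (p %% 4 = 3)%N).

Lemma fnorm4 (b : int) : 4 * fnorm p b = (2 * b - 1) ^+ 2 + p%:Z.
Proof.
have -> : p%:Z = 4 * (p.+1 %/ 4)%:Z - 1 by move: p_mod4; lia.
by rewrite /fnorm; ring.
Qed.

Lemma fnormB (b c : int) : fnorm p b - fnorm p c = (b - c) * (b + c - 1).
Proof. by rewrite /fnorm; ring. Qed.

Lemma fnorm_mod (n : nat) (b c : int) : (n %| b - c)%Z ->
  (n %| fnorm p b)%Z = (n %| fnorm p c)%Z.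
Proof.
move=> nbc; rewrite -[fnorm p b](subrK (fnorm p c)) rpredDl // fnormB.
exact: dvdz_mulr.
Qed.

Lemma root_count1 : root_count p 1 = 1%N.
Proof.
rewrite /root_count; have -> : [set b : 'I_1 | (1%N %| fnorm p (b : nat))%Z] = finset.setT.
  by apply/setP=> b; rewrite !inE dvd1z.
by rewrite cardsT card_ord.
Qed.

Lemma root_countM a b : (0 < a)%N -> (0 < b)%N -> coprime a b ->
  root_count p (a * b) = (root_count p a * root_count p b)%N.
Proof.
move=> a0 b0 cab; rewrite /root_count -cardsX.
have ltm n : (0 < n)%N -> forall x, (x %% n < n)%N by move=> n0 x; rewrite ltn_mod.
pose f (x : 'I_(a * b)) := (Ordinal (ltm a a0 x), Ordinal (ltm b b0 x)).
have modE n (x : nat) : (n %| fnorm p (x %% n)%N)%Z = (n %| fnorm p x)%Z.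
  apply: fnorm_mod; rewrite -eqz_mod_dvd -modz_nat modz_mod; exact: eqxx.
rewrite -(card_in_imset (f := f)); last first.
  move=> x y _ _ [xya xyb]; apply/val_inj/eqP => /=.
  have : x == y %[mod a * b] by rewrite chinese_remainder // xya xyb !eqxx.
  by rewrite !modn_small.
congr #|pred_of_set _|; apply/setP=> [[x y]]; rewrite !inE /=; apply/imsetP/idP.
  move=> [w]; rewrite inE => fw [-> ->] /=; rewrite !modE.
  have : ((a * b)%N%:Z %| fnorm p w)%Z := fw.
  by rewrite PoszM Gauss_dvdz ?coprimezE.
move=> /andP[fx fy].
have wlt : (chinese a b x y %% (a * b) < a * b)%N by rewrite ltn_mod muln_gt0 a0.
have wa : (chinese a b x y %% (a * b) = x %[mod a])%N.
  by rewrite modn_dvdm ?dvdn_mulr // chinese_modl.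
have wb : (chinese a b x y %% (a * b) = y %[mod b])%N.
  by rewrite modn_dvdm ?dvdn_mull // chinese_modr.
exists (Ordinal wlt); last first.
  congr (_, _); apply/val_inj; rewrite /= ?wa ?wb modn_small //.
rewrite inE PoszM Gauss_dvdz ?coprimezE //=.
by rewrite -[(a %| _)%Z]modE wa modE fx -[(b %| _)%Z]modE wb modE fy.
Qed.

(** The discriminant of the polynomial is -p, so its roots modulo q are simple. *)
Lemma fnorm_deriv_unit q (b : nat) : prime q -> q != p -> (q %| fnorm p b)%Z ->
  coprimez q (2 * b%:Z - 1).
Proof.
move=> pq qp qf; rewrite coprimezE prime_coprime // -[X in (_ %| X)%N]/`|_|%N.
apply/negP=> qd; have : (q %| p%:Z)%Z.
  have -> : p%:Z = 4 * fnorm p b - (2 * b%:Z - 1) * (2 * b%:Z - 1).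
    by rewrite fnorm4; ring.
  by rewrite rpredB ?dvdz_mull.
by rewrite dvdzE /= dvdn_prime2 // (negPf qp).
Qed.

(** Hensel lifting: every root modulo q^(e+1) lifts to exactly one root modulo
    q^(e+2), because the derivative 2 b - 1 is a unit modulo q. *)
Lemma root_count_lift q e : prime q -> q != p -> root_count p (q ^ e.+2) = root_count p (q ^ e.+1).
Proof.
move=> pq qp; have q0 := prime_gt0 pq; rewrite /root_count.
set Q := (q ^ e.+1)%N; have QE : (q ^ e.+2 = q * Q)%N by rewrite expnS.
have Q0 : (0 < Q)%N by rewrite expn_gt0 q0.
have qQ : (q %| Q)%N by rewrite /Q expnS dvdn_mulr.
move: Q QE Q0 qQ => Q QE Q0 qQ.
have qQz : (q%:Z %| (q * Q)%N%:Z)%Z by rewrite dvdzE /= dvdn_mulr.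
have qQz' : (q%:Z %| Q%:Z)%Z by rewrite dvdzE.
have cpr (c : int) : coprimez q c -> coprimez (q * Q)%N c.
  by rewrite -QE !coprimezE /=; exact: coprimeXl.
rewrite QE.
have ltm (x : nat) : (x %% Q < Q)%N by rewrite ltn_mod.
pose f (x : 'I_(q * Q)) := Ordinal (ltm x).
have modE (x : nat) : (Q %| fnorm p (x %% Q)%N)%Z = (Q %| fnorm p x)%Z.
  apply: fnorm_mod; rewrite -eqz_mod_dvd -modz_nat modz_mod; exact: eqxx.
rewrite -(card_in_imset (f := f)); last first.
  move=> x y; rewrite !inE => fx fy [xy]; apply/val_inj/eqP => /=.
  have dQ : (Q%:Z %| x%:Z - y%:Z)%Z by rewrite -eqz_mod_dvd !modz_nat xy.
  have : (x == y %[mod q * Q])%Z.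
    rewrite eqz_mod_dvd.
    have : ((q * Q)%N%:Z %| (x%:Z - y%:Z) * (x%:Z + y%:Z - 1))%Z.
      by rewrite -fnormB rpredB.
    rewrite mulrC Gauss_dvdzr //.
    apply: cpr; rewrite coprimezE prime_coprime //; apply/negP=> qd.
    have := fnorm_deriv_unit pq qp (dvdz_trans qQz fx).
    rewrite coprimezE prime_coprime // => /negP; apply.
    have -> : 2 * x%:Z - 1 = x%:Z + y%:Z - 1 + (x%:Z - y%:Z) by ring.
    change (q%:Z %| x%:Z + y%:Z - 1 + (x%:Z - y%:Z))%Z.
    by rewrite rpredD //; exact: dvdz_trans dQ.
  by rewrite !modz_nat eqz_nat !modn_small.
congr #|pred_of_set _|; apply/setP=> x; rewrite !inE /=; apply/imsetP/idP.
  move=> [w]; rewrite inE => fw -> /=; rewrite modE.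
  by apply: dvdz_trans fw; rewrite PoszM dvdz_mull.
move=> fx; have /coprimezP[[u v] /= uv] := fnorm_deriv_unit pq qp (dvdz_trans qQz' fx).
have /dvdzP[k fk] := fx; have /dvdnP[Q' QE'] := qQ.
(* Newton's step, v being the inverse of the derivative modulo q. *)
pose y := x%:Z - Q%:Z * (k * v).
have fy : ((q * Q)%N%:Z %| fnorm p y)%Z.
  apply/dvdzP; exists (k * u + Q'%:Z * (k * v) ^+ 2).
  have -> : fnorm p y = fnorm p x - Q%:Z * k * (v * (2 * x%:Z - 1)) + (Q%:Z * k * v) ^+ 2.
    by rewrite /fnorm /y; ring.
  have -> : v * (2 * x%:Z - 1) = 1 - u * q%:Z by apply/esym/eqP; rewrite subr_eq addrC uv.
  rewrite fk PoszM QE' PoszM; ring.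
have qQ0 : (0 < q * Q)%N by rewrite muln_gt0 q0.
have y0 : 0 <= (y %% (q * Q)%N)%Z by rewrite modz_ge0 // eqz_nat -lt0n.
have wE : `|(y %% (q * Q)%N)%Z|%N%:Z = (y %% (q * Q)%N)%Z by rewrite gez0_abs.
have wlt : (`|(y %% (q * Q)%N)%Z| < q * Q)%N by rewrite -ltz_nat wE ltz_pmod.
exists (Ordinal wlt).
  by rewrite inE /= wE (@fnorm_mod _ _ y) // -eqz_mod_dvd modz_mod.
apply/val_inj => /=; apply/eqP; rewrite -eqz_nat -modz_nat wE.
have : ((y %% (q * Q)%N)%Z == (x : nat)%:Z %[mod Q])%Z.
  rewrite eqz_mod_dvd -[X in (_ %| X)%Z](subrKA y) rpredD //; last first.
    by rewrite /y addrAC subrr add0r rpredN dvdz_mulr.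
  apply: (@dvdz_trans (q * Q)%N); first by rewrite PoszM dvdz_mull.
  by rewrite -eqz_mod_dvd modz_mod.
by move=> /eqP ->; rewrite modz_nat modn_small.
Qed.

Lemma dvdz_sqr (x : int) : (p %| x ^+ 2)%Z = (p %| x)%Z.
Proof. by rewrite !dvdzE abszX Euclid_dvdX // andbT. Qed.

(** Modulo p the polynomial has the double root (p+1)/2, which does not lift
    modulo p^2 because p^2 does not divide the discriminant. *)
Lemma root_count_ramified1 : root_count p p = 1%N.
Proof.
have p_odd := odd_mod4 p_prime p_mod4.
have b0lt : (p.+1 %/ 2 < p)%N by move: p_mod4; lia.
rewrite /root_count; have -> : [set b : 'I_p | (p %| fnorm p (b : nat))%Z] = [set Ordinal b0lt].
  apply/setP=> b; rewrite !inE.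
  have <- : (p %| 4 * fnorm p (b : nat))%Z = (p %| fnorm p (b : nat))%Z.
    rewrite Gauss_dvdzr // coprimezE.
    by apply: (@coprimeXr 2 p 2); rewrite coprimen2.
  rewrite fnorm4 rpredDr // dvdz_sqr dvdzE.
  rewrite -val_eqE /=; apply/idP/eqP => [/dvdnP[k ek]|->].
    have blt := ltn_ord b; case: k ek => [|[|k]] ek; move: p_mod4; lia.
  by have -> : `|(2 * (p.+1 %/ 2)%N%:Z - 1)%R|%N = p by move: p_mod4; lia.
by rewrite cards1.
Qed.

Lemma root_count_ramified e : root_count p (p ^ e.+2) = 0%N.
Proof.
rewrite /root_count; apply/eqP; rewrite cards_eq0; apply/eqP/setP=> b; rewrite !inE.
apply/negP=> pf; have p2f : ((p ^ 2)%N%:Z %| fnorm p (b : nat))%Z.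
  by apply: dvdz_trans pf; rewrite dvdzE /= dvdn_exp2l.
have p1f : (p %| fnorm p (b : nat))%Z.
  by apply: dvdz_trans p2f; rewrite dvdzE /= dvdn_exp.
have pd : (p %| 2 * (b : nat)%:Z - 1)%Z.
  have : (p %| 4 * fnorm p (b : nat))%Z by rewrite dvdz_mull.
  by rewrite fnorm4 rpredDr // dvdz_sqr.
have : ((p ^ 2)%N%:Z %| p%:Z)%Z.
  have -> : p%:Z = 4 * fnorm p (b : nat) - (2 * (b : nat)%:Z - 1) ^+ 2.
    by rewrite fnorm4; ring.
  apply: rpredB; first exact: dvdz_mull.
  by rewrite dvdzE abszX /= dvdn_exp2r.
rewrite dvdzE /= => /dvdn_leq; rewrite prime_gt0 // => /(_ isT).
by have := prime_gt1 p_prime; nia.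
Qed.

Lemma root_count_pfactor q e : prime q ->
  (root_count p (q ^ e.+1))%:Z = legendre q p ^+ e * (1 + legendre q p).
Proof.
move=> pq; have [->|qp] := eqVneq q p.
  rewrite (legendre0 (dvdzz _)) addr0 mulr1; case: e => [|e].
    by rewrite expn1 root_count_ramified1.
  by rewrite root_count_ramified expr0n.
have -> : root_count p (q ^ e.+1) = root_count p q by elim: e => // e <-; rewrite root_count_lift.
rewrite root_count_prime //; elim: e => [|e IH]; first by rewrite mul1r.
rewrite exprS -mulrA -IH mulrDr mulr1 addrC; congr (_ + _).
have p_odd := odd_mod4 p_prime p_mod4.
have pNq : ~~ (p %| q%:Z)%Z by rewrite dvdzE /= dvdn_prime2 // eq_sym.
by case: (legendre_pm1 pNq) => ->.
Qed.

(** The number of ideals of norm n: an ideal is a positive integer g times a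
    primitive ideal, and the primitive ideals of norm k are counted by root_count. *)
Definition ideal_count (n : nat) : nat :=
  \sum_(g <- divisors n | (g ^ 2 %| n)%N) root_count p (n %/ g ^ 2).

(** The Euler factor at q. In both sums the terms of exponent e-2 and below form
    the same identity for e-2. *)
Lemma ideal_count_pfactor q e : prime q ->
  (\sum_(i < e.+1 | (i * 2 <= e)%N) root_count p (q ^ (e - i * 2)))%:Z =
  \sum_(i < e.+1) legendre q p ^+ i.
Proof.
move=> pq; have [k] := ubnP e; elim: k e => // k IH [|[|e]] ltk.
- by rewrite big_mkcond !big_ord1 /= subn0 expn0 root_count1 expr0.
- rewrite big_mkcond !big_ord_recl !big_ord0 /= subn0 !addn0 root_count_pfactor //.
  by rewrite expr0 mul1r addr0.
have -> : (\sum_(i < e.+3 | (i * 2 <= e.+2)%N) root_count p (q ^ (e.+2 - i * 2)) =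
    root_count p (q ^ e.+2) + \sum_(i < e.+1 | (i * 2 <= e)%N) root_count p (q ^ (e - i * 2)))%N.
  rewrite big_mkcond big_ord_recl /= mul0n subn0; congr addn.
  rewrite big_ord_recr /= ifF; last by rewrite /bump; lia.
  rewrite addn0 [RHS]big_mkcond; apply: eq_bigr => i _ /=; rewrite /bump /=.
  by rewrite mulnDl !add2n ltnS ltnS subSS subSS.
rewrite PoszD IH; last by lia.
rewrite root_count_pfactor // [in RHS]big_ord_recr [in RHS]big_ord_recr /=; rewrite [legendre q p ^+ e.+2]exprSr mulrDr mulr1.
by rewrite -[RHS]addrA [RHS]addrC.
Qed.

Lemma ideal_count_mul_pfactor q e n : prime q -> (0 < n)%N -> coprime q n ->
  ideal_count (q ^ e * n) =
  ((\sum_(i < e.+1 | (i * 2 <= e)%N) root_count p (q ^ (e - i * 2))) * ideal_count n)%N.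
Proof.
move=> pq n0 cqn; have q0 := prime_gt0 pq.
rewrite /ideal_count big_mkcond sum_divisors_pfactor //=.
rewrite big_distrl [RHS]big_mkcond; apply: eq_bigr => i _ /=.
rewrite big_distrr /= [in RHS]big_mkcond /=.
have cond d : (d %| n)%N ->
    ((q ^ i * d) ^ 2 %| q ^ e * n)%N = (i * 2 <= e)%N && (d ^ 2 %| n)%N.
  move=> dn; have cqd : coprime q d by exact: coprime_dvdr cqn.
  rewrite expnMn -expnM Gauss_dvd; last by rewrite coprimeXl // coprimeXr.
  rewrite Gauss_dvdl; last by rewrite coprimeXl.
  rewrite Gauss_dvdr; last by rewrite coprimeXl // coprimeXr // coprime_sym.
  by rewrite dvdn_Pexp2l // prime_gt1.
case: ifP => ie; last first.
  by rewrite big_seq big1 // => d; rewrite -dvdn_divisors // => dn; rewrite cond // ie.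
rewrite big_seq [RHS]big_seq; apply: eq_bigr => d; rewrite -dvdn_divisors // => dn.
rewrite cond // ie /=; case: ifP => // d2n.
have [k kE] := dvdnP d2n; have d0 : (0 < d)%N by exact: dvdn_gt0 dn.
have k0 : (0 < k)%N by move: n0; rewrite kE muln_gt0 => /andP[].
have nk : (n %/ d ^ 2 = k)%N by rewrite kE mulnK // expn_gt0 d0.
have -> : ((q ^ e * n) %/ (q ^ i * d) ^ 2 = q ^ (e - i * 2) * k)%N.
  rewrite kE -{1}(subnK ie) expnD expnMn -expnM.
  have -> : (q ^ (e - i * 2) * q ^ (i * 2) * (k * d ^ 2) =
            q ^ (e - i * 2) * k * (q ^ (i * 2) * d ^ 2))%N by ring.
  by rewrite mulnK // muln_gt0 !expn_gt0 q0 d0.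
rewrite nk root_countM // ?expn_gt0 ?q0 // coprimeXl //.
by apply: coprime_dvdr cqn; rewrite kE dvdn_mulr.
Qed.

(** The coefficients of zeta(s) L(s), computed by splitting off one prime power. *)
Lemma ideal_countE n : (0 < n)%N ->
  (ideal_count n)%:Z = \sum_(d <- divisors n) legendre d p.
Proof.
have [k] := ubnP n; elim: k n => // k IH n ltk n0.
have [n1|n1] := leqP n 1.
  have -> : n = 1%N by lia.
  rewrite /ideal_count big_mkcond !big_seq1 /= root_count1 legendre1 //; exact: odd_mod4.
have pq := pdiv_prime n1; have [c cc nE] := pfactor_coprime pq n0.
have c0 : (0 < c)%N by move: n0; rewrite nE muln_gt0 => /andP[].
have e0 : (0 < logn (pdiv n) n)%N by rewrite logn_gt0 mem_primes pq n0 pdiv_dvd.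
have cn : (c < n)%N.
  rewrite [X in (_ < X)%N]nE -{1}[c]muln1 ltn_mul2l c0 -{1}(expn0 (pdiv n)) ltn_exp2l //.
  exact: prime_gt1.
rewrite nE mulnC ideal_count_mul_pfactor // PoszM ideal_count_pfactor // IH //; last first.
  by apply: leq_trans cn _; rewrite -ltnS.
rewrite sum_divisors_pfactor // mulr_suml; apply: eq_bigr => i _.
rewrite mulr_sumr; apply: eq_bigr => d _.
have p_odd := odd_mod4 p_prime p_mod4.
rewrite PoszM legendreM //; congr (_ * _).
elim: (i : nat) => [|j IHj]; first by rewrite expn0 expr0 legendre1.
by rewrite expnS exprS PoszM legendreM // IHj.
Qed.
End RootCount.

(** * The first half of the range *)

Section HalfSum.
Variable p : nat.
Hypotheses (p_prime : prime p) (p_mod4 : (p %% 4 = 3)%N).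
Local Notation m := (p.-1)./2.
Local Notation leg r := (legendre r%:Z p).
Let p_odd := odd_mod4 p_prime p_mod4.
Let pE : p = (m.*2).+1 := prime_odd_half p_prime p_odd.

(** The polynomial X^2 - X + (p+1)/4 modulo 2 is X^2 - X or X^2 - X + 1, according
    to the parity of (p+1)/4. *)
Lemma legendre_two : leg 2 = if (p %% 8 == 7)%N then 1 else -1.
Proof.
have p2 : 2%N != p by apply/eqP => p2; move: p_mod4; rewrite -p2.
have := root_count_prime p_prime p_mod4 (isT : prime 2) p2.
rewrite (@root_count_sum p 2 2) // !big_ord_recl big_ord0 /= /fnorm /=.
rewrite expr0n expr1n /= !subrr !add0r addn0 dvdzE /=.
case: ifP => /eqP h8.
  by have -> : (2 %| p.+1 %/ 4)%N by [lia]; lia.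
by have -> : (2 %| p.+1 %/ 4)%N = false by [move: p_mod4; lia]; lia.
Qed.

(** Summing r (r/p) by halves and by parity gives two expressions in terms of
    sums over the first half of the range. *)
Lemma sum_legendre_half :
  (leg 2 - 2) * (\sum_(d < p) d%:Z * leg (d : nat)) = p%:Z * \sum_(1 <= k < m.+1) leg k.
Proof.
set A := \sum_(d < p) _; set T := \sum_(1 <= k < m.+1) _.
pose U := \sum_(1 <= k < m.+1) k%:Z * leg k.
have AE : A = \sum_(1 <= d < (m.*2).+1) d%:Z * leg d.
  by rewrite /A -(big_mkord xpredT (fun d : nat => d%:Z * leg d)) -pE big_ltn ?prime_gt0 // mul0r add0r.
have half : A = 2 * U - p%:Z * T.
  rewrite AE sum_halves -pE /U /T !mulr_sumr -sumrB big_nat [RHS]big_nat.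
  apply: eq_bigr => k /andP[k0 km].
  have kp : (k <= p)%N by move: pE; lia.
  by rewrite legendre_opp // -subzn //; ring.
have parity : A = leg 2 * (4 * U - p%:Z * T).
  rewrite AE sum_even_odd -pE /U /T !mulr_sumr -sumrB mulr_sumr big_nat [RHS]big_nat.
  apply: eq_bigr => k /andP[k0 km].
  have kp : (k.*2 <= p)%N by move: pE; lia.
  have l2 : leg k.*2 = leg 2 * leg k by rewrite -mul2n PoszM legendreM.
  by rewrite legendre_opp // l2 -subzn // -mul2n PoszM; ring.
have l2 : leg 2 * leg 2 = 1 by rewrite legendre_two; case: ifP.
have : leg 2 * A = 4 * U - p%:Z * T by rewrite {1}parity mulrA l2 mul1r.
by move: half; move: (p%:Z * T) => pT h1 h2; rewrite mulrBl h2; lia.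
Qed.

End HalfSum.

(** * Periodic sequences against cubic splines *)

Lemma count_multiples (Y s n : nat) :
  (\sum_(i < n) (if i * s < Y then s else 0) <= Y + s)%N.
Proof.
suff : (\sum_(i < n) (if i * s < Y then s else 0) <= minn (n * s) (Y + s))%N.
  by rewrite leq_min => /andP[].
elim: n => [|n IH]; first by rewrite big_ord0.
rewrite big_ord_recr /= leq_min; move: IH; rewrite leq_min => /andP[h1 h2].
rewrite mulSn; move: (n * s)%N (\sum_(i < n) _)%N h1 h2 => t S h1 h2.
by case: ifP => h; lia.
Qed.

Section AbelSummation.
Variable R : realFieldType.
Implicit Types (c b F : nat -> R) (P n i : nat).

Definition fdiff F i := F i.+1 - F i.

(** Periodic of period P, with sum 0 over a period. *)
Definition balanced P c := (forall i, c (i + P)%N = c i) /\ \sum_(i < P) c i = 0.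

Lemma balanced_shift P c : (0 < P)%N -> balanced P c -> balanced P (fun i => c i.+1).
Proof.
move=> P0 [cP c0]; split=> [i|]; first by rewrite -addSn cP.
case: P P0 cP c0 => // P _ cP c0.
rewrite big_ord_recr /= -[P.+1]add0n cP addrC.
by move: c0; rewrite big_ord_recl.
Qed.

Definition mean_partial P c : R := (\sum_(j < P) \sum_(i < j) c i) / P%:R.

(** The discrete primitive normalized to have mean zero, so that it can be summed
    by parts again. *)
Definition primitive P c i : R := \sum_(j < i) c j - mean_partial P c.

Lemma primitiveP P c i : c i = fdiff (primitive P c) i.
Proof. by rewrite /fdiff /primitive big_ord_recr /=; ring. Qed.

Lemma primitive0 P c : primitive P c 0 = - mean_partial P c.
Proof. by rewrite /primitive big_ord0 sub0r. Qed.

Lemma primitive_balanced P c : (0 < P)%N -> balanced P c -> balanced P (primitive P c).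
Proof.
move=> P0 [cP c0]; have PN0 : (P%:R : R) != 0 by rewrite pnatr_eq0 -lt0n.
split=> [i|]; last first.
  rewrite /primitive sumrB sumr_const card_ord /mean_partial.
  by rewrite -[X in _ - X]mulr_natr divfK // subrr.
congr (_ - _); elim: i => [|i IH]; first by rewrite add0n c0 big_ord0.
by rewrite addSn !big_ord_recr /= IH cP.
Qed.

Lemma balanced_bounded P c : (0 < P)%N -> balanced P c ->
  exists2 C, 0 <= C & forall i, `|c i| <= C.
Proof.
move=> P0 [cP _]; exists (\sum_(j < P) `|c j|); first by apply: sumr_ge0.
move=> i; have -> : c i = c (i %% P)%N.
  rewrite {1}(divn_eq i P) addnC; elim: (i %/ P)%N => [|k IH]; first by rewrite mul0n addn0.
  by rewrite mulSn [(P + _)%N]addnC addnA cP.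
have lt : (i %% P < P)%N by rewrite ltn_mod.
by rewrite (bigD1 (Ordinal lt)) //= lerDl sumr_ge0.
Qed.

Lemma abel_step c b F n : (forall i, c i = fdiff b i) -> F n = 0 ->
  \sum_(i < n) c i * F i = - b 0%N * F 0%N - \sum_(i < n) b i.+1 * fdiff F i.
Proof.
move=> cb Fn; apply/eqP; rewrite -subr_eq opprK -big_split /=.
rewrite (eq_bigr (fun i : 'I_n => b i.+1 * F i.+1 - b i * F i)); last first.
  by move=> i _; rewrite cb /fdiff; ring.
rewrite -(big_mkord xpredT (fun i => b i.+1 * F i.+1 - b i * F i)).
by rewrite telescope_sumr // Fn mulr0 sub0r mulNr.
Qed.

(** Three summations by parts. The first boundary coefficient is the mean of the
    partial sums of c, the Abel sum of c. *)
Lemma abel_summation3 P c : (0 < P)%N -> balanced P c ->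
  exists b1 b2 C : R, 0 <= C /\ forall F n, (forall i, (n <= i)%N -> F i = 0) ->
    `|\sum_(i < n) c i * F i -
      (mean_partial P c * F 0%N + b1 * fdiff F 0 + b2 * fdiff (fdiff F) 0)|
    <= C * \sum_(i < n) `|fdiff (fdiff (fdiff F)) i|.
Proof.
move=> P0 bc0; pose b := primitive P c; have bb := primitive_balanced P0 bc0.
pose c1 i := b i.+1; have bc1 : balanced P c1 := balanced_shift P0 bb.
pose b' := primitive P c1; have bb' := primitive_balanced P0 bc1.
pose c2 i := b' i.+1; have bc2 : balanced P c2 := balanced_shift P0 bb'.
pose b'' := primitive P c2; have bb'' := primitive_balanced P0 bc2.
have [C C0 bC] := balanced_bounded P0 bb''.
exists (b' 0%N), (- b'' 0%N), C; split=> // F n Fn.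
have Fn1 i : (n <= i)%N -> fdiff F i = 0.
  by move=> ni; rewrite /fdiff !Fn ?subrr // leqW.
have Fn2 : fdiff (fdiff F) n = 0 by rewrite {1}/fdiff !Fn1 ?subrr.
rewrite (abel_step (b := b)); [|exact: primitiveP|exact: Fn].
rewrite -/c1 (abel_step (c := c1) (b := b')); [|exact: primitiveP|exact: Fn1].
rewrite -/c2 (abel_step (c := c2) (b := b'')); [|exact: primitiveP|exact: Fn2].
rewrite {1}/b primitive0 opprK.
set S := \sum_(i < n) _.
rewrite (_ : _ - _ = - S); last by ring.
rewrite normrN (le_trans (ler_norm_sum _ _ _)) // mulr_sumr ler_sum // => i _.
by rewrite normrM ler_wpM2r.
Qed.

End AbelSummation.

Section Splines.
Variable R : realFieldType.

(** The cube makes the truncation twice differentiable at its zero, which is what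
    the three summations by parts need. *)
Definition pos_cube (x : R) : R := Num.max x 0 ^+ 3.

Lemma pos_cube_ge0 x : 0 <= x -> pos_cube x = x ^+ 3.
Proof. by move=> x0; rewrite /pos_cube max_l. Qed.

Lemma pos_cube_le0 x : x <= 0 -> pos_cube x = 0.
Proof. by move=> x0; rewrite /pos_cube max_r // expr0n. Qed.

Lemma pos_cubeE x : 0 <= x /\ pos_cube x = x ^+ 3 \/ x <= 0 /\ pos_cube x = 0.
Proof.
by case: (lerP 0 x) => [/[dup] x0 /pos_cube_ge0|/ltW/[dup] x0 /pos_cube_le0]; [left|right].
Qed.

Lemma pos_cube_diff1 (Y s : R) : 0 <= Y -> 0 <= s ->
  `|pos_cube (Y - s) - pos_cube Y + 3%:R * s * Y ^+ 2| <= 4%:R * s ^+ 2 * (Y + s).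
Proof.
move=> Y0 s0; rewrite (pos_cube_ge0 Y0) ler_norml.
have a1 := mulr_ge0 (mulr_ge0 s0 s0) Y0; have a2 := mulr_ge0 (mulr_ge0 s0 s0) s0.
have [[h ->]|[h ->]] := pos_cubeE (Y - s); first by apply/andP; split; lra.
have h' : 0 <= s - Y by lra.
have a3 := mulr_ge0 (mulr_ge0 s0 Y0) h'; have a4 := mulr_ge0 (mulr_ge0 Y0 Y0) h'.
have a5 := mulr_ge0 (mulr_ge0 Y0 Y0) Y0.
by apply/andP; split; lra.
Qed.

Lemma pos_cube_diff2 (Y s : R) : 0 <= Y -> 0 <= s ->
  `|pos_cube (Y - s - s) - pos_cube (Y - s) - (pos_cube (Y - s) - pos_cube Y)|
  <= 6%:R * s ^+ 2 * (Y + s).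
Proof.
move=> Y0 s0; rewrite (pos_cube_ge0 Y0) ler_norml.
have a1 := mulr_ge0 (mulr_ge0 s0 s0) Y0; have a2 := mulr_ge0 (mulr_ge0 s0 s0) s0.
have a5 := mulr_ge0 (mulr_ge0 Y0 Y0) Y0.
have [[h ->]|[h ->]] := pos_cubeE (Y - s); have [[h' ->]|[h' ->]] := pos_cubeE (Y - s - s).
- by apply/andP; split; lra.
- have h2 : 0 <= s - (Y - s) by lra.
  have a3 := mulr_ge0 (mulr_ge0 h h) h2; have a4 := mulr_ge0 (mulr_ge0 h s0) h2.
  have a6 := mulr_ge0 (mulr_ge0 s0 s0) h2.
  by apply/andP; split; lra.
- have sE : s = 0 by lra.
  have YE : Y = 0 by lra.
  by rewrite sE YE; apply/andP; split; lra.
- have h2 : 0 <= s - Y by lra.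
  have a3 := mulr_ge0 (mulr_ge0 Y0 Y0) h2; have a4 := mulr_ge0 (mulr_ge0 Y0 s0) h2.
  by apply/andP; split; lra.
Qed.

Lemma pos_cube_small (Y s : R) : 0 <= s -> Y <= 3%:R * s -> 0 <= pos_cube Y <= 27%:R * s ^+ 3.
Proof.
move=> s0 Ys; have s3 := exprn_ge0 3 s0.
have [[h ->]|[h ->]] := pos_cubeE Y; last by rewrite lexx mulr_ge0.
have s1 : 0 <= 3%:R * s by lra.
have h3 : Y ^+ 3 <= (3%:R * s) ^+ 3 by rewrite lerXn2r // nnegrE.
apply/andP; split; first exact: exprn_ge0.
by rewrite (le_trans h3) // (_ : (3%:R * s) ^+ 3 = 27%:R * s ^+ 3) //; ring.
Qed.

Lemma pos_cube_diff3 (Y s : R) : 0 <= s ->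
  `|pos_cube (Y - s - s - s) - 3%:R * pos_cube (Y - s - s) + 3%:R * pos_cube (Y - s) - pos_cube Y|
  <= if 0 < Y then 216%:R * s ^+ 3 else 0.
Proof.
move=> s0; case: ltP => [Y0|Y0]; last first.
  have z1 : Y - s <= 0 by lra.
  have z2 : Y - s - s <= 0 by lra.
  have z3 : Y - s - s - s <= 0 by lra.
  by rewrite (pos_cube_le0 z3) (pos_cube_le0 z2) (pos_cube_le0 z1) (pos_cube_le0 Y0) !mulr0 !subr0 addr0 normr0.
have [h|h] := lerP 0 (Y - s - s - s).
  have y3 : 0 <= Y - s - s by lra.
  have y2 : 0 <= Y - s by lra.
  rewrite (pos_cube_ge0 h) (pos_cube_ge0 y3) (pos_cube_ge0 y2) (pos_cube_ge0 (ltW Y0)).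
  rewrite (_ : _ - _ = - (6%:R * s ^+ 3)); last by ring.
  have s3 := exprn_ge0 3 s0; have s6 : 0 <= 6%:R * s ^+ 3 by lra.
  by rewrite normrN ger0_norm //; lra.
have s3 := exprn_ge0 3 s0.
have y1 : Y <= 3%:R * s by lra.
have /andP[a1 b1] := pos_cube_small s0 y1.
have y2 : Y - s <= 3%:R * s by lra.
have /andP[a2 b2] := pos_cube_small s0 y2.
have y3 : Y - s - s <= 3%:R * s by lra.
have /andP[a3 b3] := pos_cube_small s0 y3.
have y4 : Y - s - s - s <= 3%:R * s by lra.
have /andP[a4 b4] := pos_cube_small s0 y4.
rewrite ler_norml; move: (s ^+ 3) s3 (pos_cube _) (pos_cube _) (pos_cube _) (pos_cube _) a1 b1 a2 b2 a3 b3 a4 b4.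
by move=> *; apply/andP; split; lra.
Qed.

(** Summation of a balanced periodic sequence against a cubic spline: only the
    first two Taylor coefficients at the origin survive. *)
Lemma spline_sum P c : (0 < P)%N -> balanced P c ->
  exists b1 C : R, 0 <= C /\ forall Y s n : nat, (0 < s)%N -> (Y <= n * s)%N ->
    `|\sum_(i < n) c i * pos_cube (Y%:R - i%:R * s%:R) -
      (mean_partial P c * Y%:R ^+ 3 + b1 * s%:R * Y%:R ^+ 2)|
    <= C * s%:R ^+ 2 * (Y%:R + s%:R).
Proof.
move=> P0 bc; have [b1 [b2 [C [C0 abel]]]] := abel_summation3 P0 bc.
exists (- 3%:R * b1), (4%:R * `|b1| + 6%:R * `|b2| + 216%:R * C); split.
  by rewrite !addr_ge0 ?mulr_ge0.
move=> Y s n s0 Yn.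
pose F i : R := pos_cube (Y%:R - i%:R * s%:R).
have Y0 : 0 <= Y%:R :> R by [].
have s0' : 0 <= s%:R :> R by [].
have FD3 i (u := Y%:R - i%:R * s%:R) : fdiff (fdiff (fdiff F)) i =
    pos_cube (u - s%:R - s%:R - s%:R) - 3%:R * pos_cube (u - s%:R - s%:R) +
    3%:R * pos_cube (u - s%:R) - pos_cube u.
  have e1 : F i.+1 = pos_cube (u - s%:R) by rewrite /F -natr1; congr pos_cube; rewrite /u; ring.
  have e2 : F i.+2 = pos_cube (u - s%:R - s%:R).
    by rewrite /F -!natr1; congr pos_cube; rewrite /u; ring.
  have e3 : F i.+3 = pos_cube (u - s%:R - s%:R - s%:R).
    by rewrite /F -!natr1; congr pos_cube; rewrite /u; ring.
  by rewrite /fdiff e1 e2 e3 /F -/u; ring.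
have Fn i : (n <= i)%N -> F i = 0.
  move=> ni; apply: pos_cube_le0; rewrite subr_le0 -natrM ler_nat.
  by apply: leq_trans Yn _; rewrite leq_mul2r ni orbT.
have D3 : \sum_(i < n) `|fdiff (fdiff (fdiff F)) i| <= 216%:R * s%:R ^+ 2 * (Y%:R + s%:R).
  apply: (@le_trans _ _ (\sum_(i < n) 216%:R * s%:R ^+ 2 * (if i * s < Y then s else 0)%N%:R)).
    apply: ler_sum => i _.
    have := @pos_cube_diff3 (Y%:R - i%:R * s%:R) _ s0'.
    rewrite FD3 subr_gt0 -natrM ltr_nat; case: ifP => h; last by rewrite mulr0.
    by rewrite (_ : _ * s%:R ^+ 2 * s%:R = 216%:R * s%:R ^+ 3) //; ring.
  rewrite -mulr_sumr -natr_sum ler_wpM2l ?mulr_ge0 ?exprn_ge0 // -natrD ler_nat.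
  exact: count_multiples.
have F0 : F 0%N = Y%:R ^+ 3 by rewrite /F mul0r subr0 pos_cube_ge0.
have E1 : F 1%N = pos_cube (Y%:R - s%:R) by rewrite /F mul1r.
have E2 : F 2%N = pos_cube (Y%:R - s%:R - s%:R) by rewrite /F; congr pos_cube; ring.
have F1 : fdiff F 0 = pos_cube (Y%:R - s%:R) - pos_cube Y%:R.
  by rewrite /fdiff E1 F0 (pos_cube_ge0 Y0).
have F2 : fdiff (fdiff F) 0 = pos_cube (Y%:R - s%:R - s%:R) - pos_cube (Y%:R - s%:R) -
    (pos_cube (Y%:R - s%:R) - pos_cube Y%:R).
  by rewrite -F1 -E2 -E1.
have h1 := pos_cube_diff1 Y0 s0'; have h2 := pos_cube_diff2 Y0 s0'.
rewrite -F1 in h1; rewrite -F2 in h2.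
have h := abel F n Fn; rewrite F0 in h.
set S := \sum_(i < n) _ in h *.
have -> : S - (mean_partial P c * Y%:R ^+ 3 + - 3%:R * b1 * s%:R * Y%:R ^+ 2) =
  (S - (mean_partial P c * Y%:R ^+ 3 + b1 * fdiff F 0 + b2 * fdiff (fdiff F) 0)) +
  (b1 * (fdiff F 0 + 3%:R * s%:R * Y%:R ^+ 2) + b2 * fdiff (fdiff F) 0) by ring.
apply: le_trans (ler_normD _ _) _; apply: (@le_trans _ _ (C * (216%:R * s%:R ^+ 2 * (Y%:R + s%:R)) +
  (`|b1| * (4%:R * s%:R ^+ 2 * (Y%:R + s%:R)) + `|b2| * (6%:R * s%:R ^+ 2 * (Y%:R + s%:R))))); last first.
  by rewrite le_eqVlt; apply/orP; left; apply/eqP; ring.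
apply: lerD; first by apply: le_trans h _; exact: ler_wpM2l.
by apply: le_trans (ler_normD _ _) _; apply: lerD; rewrite normrM ler_wpM2l.
Qed.

End Splines.

Section Multiples.
Variable R : realFieldType.

Lemma sum_multiples (X d : nat) (g : nat -> R) : (0 < d)%N ->
  (forall n, (X < n)%N -> g n = 0) ->
  \sum_(1 <= n < X.+1 | (d %| n)%N) g n = \sum_(1 <= k < X.+1) g (d * k)%N.
Proof.
move=> d0 g0.
have -> : \sum_(1 <= k < X.+1) g (d * k)%N =
    \sum_(1 <= k < X.+1) \sum_(1 <= n < X.+1) (if (n == d * k)%N then g n else 0).
  rewrite big_nat [RHS]big_nat; apply: eq_bigr => k /andP[k0 kX].
  rewrite -big_mkcond /=; have [h|h] := ltnP X (d * k).
    rewrite g0 // big_nat_cond big1 // => n /andP[/andP[_ nX] /eqP e].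
    by move: nX; rewrite ltnS e leqNgt h.
  rewrite big_nat1_eq muln_gt0 d0 k0 ltnS h //.
rewrite exchange_big /= big_mkcond big_nat [RHS]big_nat; apply: eq_bigr => n /andP[n0 nX].
case: ifP => dn; last first.
  by rewrite big1 // => k _; case: eqP => // e; rewrite e dvdn_mulr in dn.
have [k kE] := dvdnP dn; have k0 : (0 < k)%N by move: n0; rewrite kE muln_gt0 => /andP[].
rewrite -(big_mkcond (fun k => n == d * k)%N (fun=> g n)) /=.
rewrite (eq_bigl (fun k' => k' == k)); last first.
  by move=> k' /=; rewrite kE mulnC eqn_pmul2l // eq_sym.
rewrite big_nat1_eq k0 /= ifT // ltnS (leq_trans _ (ltnSE nX)) // kE leq_pmulr //.
Qed.

(** 4 [4 | k] - 1, which has mean zero. *)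
Definition mod4_weight (k : nat) : R := if (4 %| k)%N then 3%:R else -1.

Lemma mod4_weight_balanced : balanced 4 mod4_weight.
Proof.
split=> [i|]; first by rewrite /mod4_weight dvdn_addl.
by rewrite !big_ord_recl big_ord0 /mod4_weight /=; ring.
Qed.

Lemma mod4_weight_mean : mean_partial 4 mod4_weight = 3%:R / 2%:R.
Proof.
rewrite /mean_partial; do 4![rewrite big_ord_recr /=].
by rewrite !big_ord_recr !big_ord0 /mod4_weight /=; field.
Qed.

Lemma mod4_weight_le k : `|mod4_weight k| <= 3%:R.
Proof.
by rewrite /mod4_weight; case: ifP => _; rewrite ?normrN1 ?ler1n // ger0_norm ?ler0n.
Qed.

Lemma mod4_weight_sums q : \sum_(k < 4 * q) mod4_weight k = 0 /\
  \sum_(k < 4 * q) mod4_weight k * k%:R = - 6%:R * q%:R.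
Proof.
elim: q => [|q [IH1 IH2]]; first by rewrite muln0 !big_ord0 mulr0.
rewrite mulnS addnC; rewrite !addnS addn0 !big_ord_recr /= IH1 IH2 /mod4_weight.
have -> : (4 %| 4 * q)%N = true by rewrite dvdn_mulr.
have -> : (4 %| (4 * q).+1)%N = false by lia.
have -> : (4 %| (4 * q).+2)%N = false by lia.
have -> : (4 %| (4 * q).+3)%N = false by lia.
split; first by ring.
rewrite -[(4 * q).+3%:R]natr1 -[(4 * q).+2%:R]natr1 -[(4 * q).+1%:R]natr1 -[q.+1%:R]natr1 natrM.
by ring.
Qed.

End Multiples.

Section Hyperbola.
Variable R : realFieldType.
Local Notation mod4_weight := (mod4_weight R).
Variables (P : nat) (c : nat -> R).
Hypotheses (P_gt0 : (0 < P)%N) (c_bal : balanced P c) (c0 : c 0%N = 0)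
  (c_le1 : forall i, `|c i| <= 1).
Local Notation H := (mean_partial P c).

(** Dirichlet's hyperbola method. For k < K the sum over d is a spline sum in
    which the weight cancels the two leading terms; for k >= K it is the sum over
    k that is a spline sum. *)
Lemma hyperbola_sum : exists2 C : R, 0 <= C & forall X q : nat,
  (0 < q)%N -> (4 * q <= X)%N ->
  `|\sum_(1 <= k < X.+1) mod4_weight k * (\sum_(d < X.+1) c d * pos_cube (X%:R - d%:R * k%:R))
    + 3%:R / 2%:R * H * X%:R ^+ 3|
  <= C * (q%:R ^+ 3 * X%:R + X%:R ^+ 4 / q%:R ^+ 2).
Proof.
have [b1 [C1 [C1_ge0 spl]]] := spline_sum P_gt0 c_bal.
have [b2 [C2 [C2_ge0 splw]]] := spline_sum (ltn0Sn 3) (mod4_weight_balanced R).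
rewrite mod4_weight_mean in splw.
exists (1000%:R * C1 + 2%:R * (`|b2| + 2%:R * C2)).
  apply: addr_ge0; first by apply: mulr_ge0; first exact: ler0n.
  by rewrite mulr_ge0 ?addr_ge0 ?mulr_ge0.
move=> X q q0 qX; pose K := (4 * q)%N.
have K0 : (0 < K)%N by rewrite muln_gt0.
have X0 : (0 < X)%N by apply: leq_trans qX.
pose T k := \sum_(d < X.+1) c d * pos_cube (X%:R - d%:R * k%:R).
have TE (k : nat) : (0 < k <= K)%N ->
   `|T k - (H * X%:R ^+ 3 + b1 * k%:R * X%:R ^+ 2)| <= C1 * K%:R ^+ 2 * (2%:R * X%:R).
  move=> /andP[k0 kK]; apply: le_trans (spl X k X.+1 k0 _) _.
    by rewrite mulSn mulnC -{1}[X]mul1n (leq_trans _ (leq_addl _ _)) // leq_mul2r k0 orbT.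
  apply: ler_pM; rewrite ?mulr_ge0 ?exprn_ge0 ?addr_ge0 //.
    by rewrite ler_wpM2l // lerXn2r ?nnegrE // ler_nat.
  by rewrite mulrDl mul1r lerD2l ler_nat; exact: leq_trans kK qX.
have KE : K%:R = 4%:R * q%:R :> R by rewrite /K natrM.
have qle : q%:R ^+ 2 * X%:R <= q%:R ^+ 3 * X%:R :> R.
  rewrite (_ : q%:R ^+ 3 * X%:R = q%:R * (q%:R ^+ 2 * X%:R)); last by ring.
  by rewrite ler_peMl ?mulr_ge0 ?exprn_ge0 // ler1n.
(* The weights have sum -3 and first moment -6 q over 1 <= k < K. *)
have partA : `|\sum_(1 <= k < K) mod4_weight k * T k + 3%:R * H * X%:R ^+ 3 +
    6%:R * q%:R * b1 * X%:R ^+ 2| <= 400%:R * C1 * (q%:R ^+ 3 * X%:R).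
  have [s1 s2] := mod4_weight_sums R q; rewrite -/K in s1 s2.
  have s1' : \sum_(1 <= k < K) mod4_weight k = - 3%:R.
    move: s1; rewrite -(big_mkord xpredT mod4_weight) big_ltn // {1}/mod4_weight dvdn0 => /eqP.
    by rewrite addrC addr_eq0 => /eqP.
  have s2' : \sum_(1 <= k < K) mod4_weight k * k%:R = - 6%:R * q%:R.
    by rewrite -s2 -(big_mkord xpredT (fun k => mod4_weight k * k%:R)) [RHS]big_ltn // mulr0 add0r.
  have -> : \sum_(1 <= k < K) mod4_weight k * T k + 3%:R * H * X%:R ^+ 3 +
     6%:R * q%:R * b1 * X%:R ^+ 2 =
     \sum_(1 <= k < K) mod4_weight k * (T k - (H * X%:R ^+ 3 + b1 * k%:R * X%:R ^+ 2)).
    have -> : 3%:R * H * X%:R ^+ 3 = - (\sum_(1 <= k < K) mod4_weight k * (H * X%:R ^+ 3)).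
      by rewrite -mulr_suml s1'; ring.
    have -> : 6%:R * q%:R * b1 * X%:R ^+ 2 =
        - (\sum_(1 <= k < K) (mod4_weight k * k%:R) * (b1 * X%:R ^+ 2)).
      by rewrite -mulr_suml s2'; ring.
    by rewrite -!sumrB; apply: eq_bigr => k _; ring.
  apply: le_trans (ler_norm_sum _ _ _) _.
  apply: (@le_trans _ _ (\sum_(1 <= k < K) 3%:R * (C1 * K%:R ^+ 2 * (2%:R * X%:R)))).
    rewrite big_nat [X in _ <= X]big_nat; apply: ler_sum => k /andP[k0 kK].
    by rewrite normrM ler_pM ?mod4_weight_le // TE // k0 ltnW.
  rewrite sumr_const_nat -[_ *+ _]mulr_natr.
  apply: (@le_trans _ _ (3%:R * (C1 * K%:R ^+ 2 * (2%:R * X%:R)) * K%:R)).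
    by rewrite ler_wpM2l ?ler_nat ?leq_subr // !mulr_ge0 ?exprn_ge0.
  rewrite KE; have : 0 <= C1 * (q%:R ^+ 3 * X%:R) by rewrite !mulr_ge0 ?exprn_ge0.
  by lra.
(* Shifting k by K, a multiple of 4, preserves the weights. *)
have partB : `|\sum_(K <= k < X.+1) mod4_weight k * T k - 3%:R / 2%:R * T K|
    <= 2%:R * (`|b2| + 2%:R * C2) * (X%:R ^+ 4 / q%:R ^+ 2).
  pose U d := \sum_(j < X.+1 - K) mod4_weight j * pos_cube (X%:R - d%:R * K%:R - j%:R * d%:R).
  have BE : \sum_(K <= k < X.+1) mod4_weight k * T k = \sum_(d < X.+1) c d * U d.
    rewrite -{1}[K]add0n big_addn big_mkord.
    under eq_bigr => j _ do rewrite mulr_sumr.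
    rewrite exchange_big /=; apply: eq_bigr => d _; rewrite mulr_sumr.
    apply: eq_bigr => j _; rewrite mulrCA; congr (_ * (_ * pos_cube _)).
      by rewrite /mod4_weight /K dvdn_addl // dvdn_mulr.
    by rewrite natrD; ring.
  have UE (d : nat) : (0 < d)%N -> `|U d - 3%:R / 2%:R * pos_cube (X%:R - d%:R * K%:R)| <=
      (`|b2| + 2%:R * C2) * (if d * K < X then (d : nat) else 0)%N%:R * X%:R ^+ 2.
    move=> d0; case: ltnP => dK; last first.
      rewrite mulr0 mul0r /U big1 ?pos_cube_le0 ?mulr0 ?subrr ?normr0 //.
        by rewrite subr_le0 -natrM ler_nat.
      move=> j _; rewrite pos_cube_le0 ?mulr0 //.
      by rewrite -addrA -opprD subr_le0 -!natrM -natrD ler_nat (leq_trans dK) ?leq_addr.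
    have YE : X%:R - d%:R * K%:R = (X - d * K)%:R :> R by rewrite natrB ?natrM // ltnW.
    rewrite /U YE; have YX : (X - d * K <= X)%N by rewrite leq_subr.
    have dX : (d <= X)%N by rewrite (leq_trans _ (ltnW dK)) // leq_pmulr.
    have hn : (X - d * K <= (X.+1 - K) * d)%N.
      by rewrite mulnBl [(K * d)%N]mulnC leq_sub2r // mulSn (leq_trans _ (leq_addl _ _)) // leq_pmulr.
    have := splw _ _ _ d0 hn; rewrite (pos_cube_ge0 (ler0n _ _)).
    move: (X - d * K)%N YX => Y YX; set S := \sum_(i < _) _ => h.
    have -> : S - 3%:R / 2%:R * Y%:R ^+ 3 =
      (S - (3%:R / 2%:R * Y%:R ^+ 3 + b2 * d%:R * Y%:R ^+ 2)) + b2 * d%:R * Y%:R ^+ 2 by ring.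
    apply: le_trans (ler_normD _ _) _.
    have Y2 : Y%:R ^+ 2 <= X%:R ^+ 2 :> R by rewrite lerXn2r ?nnegrE // ler_nat.
    apply: (@le_trans _ _ (C2 * d%:R ^+ 2 * (Y%:R + d%:R) + `|b2| * d%:R * X%:R ^+ 2)).
      apply: lerD => //; rewrite !normrM !normr_nat -expr2.
      by rewrite ler_wpM2l // mulr_ge0.
    have : d%:R ^+ 2 * (Y%:R + d%:R) <= d%:R * (2%:R * X%:R ^+ 2) :> R.
      rewrite expr2 -mulrA ler_wpM2l //.
      have -> : 2%:R * X%:R ^+ 2 = X%:R * (X%:R + X%:R) :> R by ring.
      by rewrite ler_pM ?addr_ge0 ?lerD ?ler_nat.
    by move=> /(ler_wpM2l C2_ge0); lra.
  rewrite BE mulr_sumr -sumrB.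
  rewrite (eq_bigr (fun d : 'I_X.+1 => c d * (U d - 3%:R / 2%:R * pos_cube (X%:R - d%:R * K%:R)))); last first.
    by move=> d _; ring.
  apply: le_trans (ler_norm_sum _ _ _) _.
  pose B : R := `|b2| + 2%:R * C2; have B0 : 0 <= B by rewrite addr_ge0 ?mulr_ge0.
  apply: (@le_trans _ _ (\sum_(d < X.+1) B * (if d * K < X then (d : nat) else 0)%N%:R * X%:R ^+ 2)).
    apply: ler_sum => d _; rewrite normrM; have [d0|d0] := posnP d.
      by rewrite d0 c0 normr0 mul0r !mulr_ge0 ?exprn_ge0.
    by rewrite -[X in _ <= X]mul1r ler_pM // UE.
  rewrite -mulr_suml -mulr_sumr -natr_sum -/B.
  have cnt : (\sum_(d < X.+1) (if d * K < X then (d : nat) else 0) * K ^ 2 <= 2 * X ^ 2)%N.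
    apply: (@leq_trans (\sum_(d < X.+1) X * (if d * K < X then K else 0))%N).
      apply: leq_sum => d _; case: ifP => h //; rewrite -mulnn mulnA leq_mul2r (ltnW h) orbT //.
    rewrite -big_distrr /= mul2n -addnn -mulnn -mulnDr leq_mul2l.
    by rewrite (leq_trans (count_multiples X K X.+1)) ?orbT // leq_add2l.
  have q2 : 0 < q%:R ^+ 2 :> R by rewrite exprn_gt0 // ltr0n.
  rewrite [X in _ <= X]mulrA ler_pdivlMr //.
  have : (\sum_(d < X.+1) (if d * K < X then (d : nat) else 0))%N%:R * K%:R ^+ 2 <= 2%:R * X%:R ^+ 2 :> R.
    by rewrite -!natrX -!natrM ler_nat big_distrl.
  rewrite KE; set S := (\sum_(d < X.+1) _)%N%:R => hS.
  have hS' : S * q%:R ^+ 2 <= 2%:R * X%:R ^+ 2.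
    have sq : 0 <= S * q%:R ^+ 2 by apply: mulr_ge0; [exact: ler0n | exact: ltW].
    by lra.
  have -> : B * S * X%:R ^+ 2 * q%:R ^+ 2 = B * X%:R ^+ 2 * (S * q%:R ^+ 2) by ring.
  have -> : 2%:R * B * X%:R ^+ 4 = B * X%:R ^+ 2 * (2%:R * X%:R ^+ 2) by ring.
  by rewrite ler_wpM2l // mulr_ge0 ?exprn_ge0.
have partT : `|T K - (H * X%:R ^+ 3 + b1 * K%:R * X%:R ^+ 2)| <= 32%:R * C1 * (q%:R ^+ 3 * X%:R).
  apply: le_trans (TE K _) _; first by rewrite K0 leqnn.
  by rewrite KE; have := ler_wpM2l C1_ge0 qle; lra.
rewrite (eq_bigr (fun k => mod4_weight k * T k)) //.
rewrite (@big_cat_nat _ _ _ K) //=; last exact: leqW.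
set A := \sum_(1 <= k < K) _ in partA *; set Bs := \sum_(K <= k < X.+1) _ in partB *.
have -> : A + Bs + 3%:R / 2%:R * H * X%:R ^+ 3 =
  (A + 3%:R * H * X%:R ^+ 3 + 6%:R * q%:R * b1 * X%:R ^+ 2) + (Bs - 3%:R / 2%:R * T K) +
  3%:R / 2%:R * (T K - (H * X%:R ^+ 3 + b1 * K%:R * X%:R ^+ 2)).
  by rewrite KE; field.
apply: le_trans (ler_normD _ _) _.
apply: (@le_trans _ _ (400%:R * C1 * (q%:R ^+ 3 * X%:R) +
   2%:R * (`|b2| + 2%:R * C2) * (X%:R ^+ 4 / q%:R ^+ 2) +
   3%:R / 2%:R * (32%:R * C1 * (q%:R ^+ 3 * X%:R)))).
  apply: lerD; last first.
    have h32 : 0 <= 3%:R / 2%:R :> R by rewrite divr_ge0.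
    by rewrite normrM (ger0_norm h32); apply: ler_wpM2l.
  by apply: le_trans (ler_normD _ _) _; apply: lerD.
have e1 : 0 <= C1 * (q%:R ^+ 3 * X%:R) by rewrite !mulr_ge0 ?exprn_ge0.
have e2 : 0 <= C1 * (X%:R ^+ 4 / q%:R ^+ 2) by rewrite !mulr_ge0 ?invr_ge0 ?exprn_ge0.
have e3 : 0 <= (`|b2| + 2%:R * C2) * (q%:R ^+ 3 * X%:R).
  by rewrite !mulr_ge0 ?addr_ge0 ?mulr_ge0 ?exprn_ge0.
move: (q%:R ^+ 3 * X%:R) (X%:R ^+ 4 / q%:R ^+ 2) (`|b2| + 2%:R * C2) e1 e2 e3 => x y z.
by lra.
Qed.
End Hyperbola.

(** * Alternating sums over the plane lattice *)

(** Sums over the integers of absolute value at most R are written as sums over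
    ordinals. *)
Definition centered (R : nat) (i : 'I_(2 * R).+1) : int := (i : nat)%:Z - R%:Z.

Lemma centered_inj R : injective (@centered R).
Proof. by move=> i j e; apply/val_inj; move: e; rewrite /centered /=; lia. Qed.

Lemma centeredP R (x : int) : `|x| <= R%:Z -> exists i : 'I_(2 * R).+1, centered i = x.
Proof.
move=> xR; have lt : (`|(x + R%:Z)%R|%N < (2 * R).+1)%N by lia.
by exists (Ordinal lt); rewrite /centered /=; lia.
Qed.

Section Lattice.
Variable R : realFieldType.

(** The third difference of the cube of the positive part of a quadratic
    sequence: away from the zeros the quadratic growth of u cancels, and next to a
    zero all the values are small. *)
Lemma pos_cube_quadratic_diff3 (u d a L M : R) : 1 <= L -> 1 <= M -> u <= M ^+ 2 ->
  `|d| <= L * M -> 0 <= a <= L ->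
  `|pos_cube (u + 3%:R * d - 6%:R * a) - 3%:R * pos_cube (u + 2%:R * d - 2%:R * a)
    + 3%:R * pos_cube (u + d) - pos_cube u| <= 8%:R * (9%:R * (L * M)) ^+ 3.
Proof.
move=> L1 M1 uM dT /andP[a0 aL].
have T1 : L <= L * M by rewrite ler_peMr //; lra.
set T := L * M in dT T1 *.
have aT : a <= T by lra.
have T0 : 0 <= T by lra.
have dT' : - T <= d <= T by rewrite -ler_norml.
case/andP: dT' => dT1 dT2.
(* If one of the four values of u is negative, all are at most 9 T. *)
have small x : x <= 9%:R * T -> 0 <= pos_cube x <= (9%:R * T) ^+ 3.
  move=> xT; have [[h ->]|[h ->]] := pos_cubeE x.
    by rewrite exprn_ge0 // lerXn2r // nnegrE; lra.
  by rewrite lexx exprn_ge0 //; lra.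
have small4 : u <= 9%:R * T -> u + d <= 9%:R * T -> u + 2%:R * d - 2%:R * a <= 9%:R * T ->
   u + 3%:R * d - 6%:R * a <= 9%:R * T ->
   `|pos_cube (u + 3%:R * d - 6%:R * a) - 3%:R * pos_cube (u + 2%:R * d - 2%:R * a)
    + 3%:R * pos_cube (u + d) - pos_cube u| <= 8%:R * (9%:R * T) ^+ 3.
  move=> /small/andP[a1 b1] /small/andP[a2 b2] /small/andP[a3 b3] /small/andP[a4 b4].
  move: ((9%:R * T) ^+ 3) (pos_cube _) (pos_cube _) (pos_cube _) (pos_cube _) a1 b1 a2 b2 a3 b3 a4 b4 => B x1 x2 x3 x4 *.
  by rewrite ler_norml; apply/andP; split; lra.
have [h1|h1] := lerP 0 u; last by apply: small4; lra.
have [h2|h2] := lerP 0 (u + d); last by apply: small4; lra.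
have [h3|h3] := lerP 0 (u + 2%:R * d - 2%:R * a); last by apply: small4; lra.
have [h4|h4] := lerP 0 (u + 3%:R * d - 6%:R * a); last by apply: small4; lra.
rewrite (pos_cube_ge0 h1) (pos_cube_ge0 h2) (pos_cube_ge0 h3) (pos_cube_ge0 h4).
pose e := `|d|; have e0 : 0 <= e by exact: normr_ge0.
have -> : (u + 3%:R * d - 6%:R * a) ^+ 3 - 3%:R * (u + 2%:R * d - 2%:R * a) ^+ 3 +
    3%:R * (u + d) ^+ 3 - u ^+ 3 =
    6%:R * d ^+ 3 - 36%:R * (u * (d * a)) + 72%:R * (u * a ^+ 2) - 90%:R * (d ^+ 2 * a)
    + 252%:R * (d * a ^+ 2) - 192%:R * a ^+ 3.
  by ring.
have L0 : 0 <= L by lra.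
have M0 : 0 <= M by lra.
have dn : `|d| <= T by rewrite ler_norml dT1.
have an : `|a| <= T by rewrite ger0_norm.
have b1 : `|d ^+ 3| <= T ^+ 3 by rewrite normrX lerXn2r // nnegrE.
have b6 : `|a ^+ 3| <= T ^+ 3 by rewrite normrX lerXn2r // nnegrE.
have b4 : `|d ^+ 2 * a| <= T ^+ 3.
  by rewrite normrM normrX [X in _ <= X]exprSr ler_pM ?exprn_ge0 // lerXn2r // nnegrE.
have b5 : `|d * a ^+ 2| <= T ^+ 3.
  by rewrite normrM normrX [X in _ <= X]exprS ler_pM ?exprn_ge0 // lerXn2r // nnegrE.
have TL : M ^+ 2 * (T * L) <= T ^+ 3.
  have -> : T ^+ 3 = L * (M ^+ 2 * (T * L)) by rewrite /T; ring.
  by rewrite ler_peMl // !mulr_ge0 ?exprn_ge0.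
have b2 : `|u * (d * a)| <= T ^+ 3.
  apply: le_trans TL; rewrite !normrM (ger0_norm h1) ler_pM ?mulr_ge0 //.
  by rewrite ler_pM // ger0_norm.
have b3 : `|u * a ^+ 2| <= T ^+ 3.
  apply: le_trans TL; rewrite normrM (ger0_norm h1) ler_pM // normrX expr2.
  by rewrite ler_pM // ger0_norm.
have T3 : (9%:R * T) ^+ 3 = 729%:R * T ^+ 3 by ring.
rewrite T3; move: b1 b2 b3 b4 b5 b6; rewrite !ler_norml.
move: (T ^+ 3) (d ^+ 3) (u * (d * a)) (u * a ^+ 2) (d ^+ 2 * a) (d * a ^+ 2) (a ^+ 3).
move=> t x1 x2 x3 x4 x5 x6 /andP[? ?] /andP[? ?] /andP[? ?] /andP[? ?] /andP[? ?] /andP[? ?].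
by apply/andP; split; lra.
Qed.

Lemma alt_balanced : balanced 2 (fun i => (-1) ^+ i : R).
Proof.
split=> [i|]; first by rewrite exprD sqrrN expr1n mulr1.
by rewrite !big_ord_recl big_ord0 /= expr0 expr1 addr0 subrr.
Qed.

Definition quad (A B C x y : int) : int := A * x ^+ 2 + B * x * y + C * y ^+ 2.

Definition norm_weight (X : nat) (v : int) : R := pos_cube (X%:R - v%:~R).

(** One row of an alternating lattice sum. The weight vanishes near both ends of
    the row, so summation by parts leaves no boundary term, and each of the O(M)
    third differences is O(M^3). *)
Lemma row_bound (A B C : int) (kappa : nat) : 0 < A ->
  (forall x y, 0 <= quad A B C x y) -> (2 < kappa)%N ->
  exists2 c : R, 0 <= c & forall (M : nat) (y : int), (0 < M)%N ->
    `|y| <= (2 * (kappa * M))%N%:Z ->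
    (forall x, quad A B C x y < (M ^ 2)%N%:Z -> `|x| <= (kappa * M)%N%:Z) ->
    `|\sum_(i < (2 * (2 * (kappa * M))).+1)
        (-1) ^+ i * norm_weight (M ^ 2) (quad A B C (centered i) y)| <= c * M%:R ^+ 4.
Proof.
move=> A0 Q0 k3; have [b1 [b2 [C0 [C0_ge0 abel]]]] := abel_summation3 (ltn0Sn 1) alt_balanced.
pose Ln := ((5 * `|A| + 2 * `|B|) * kappa)%N.
exists (C0 * (5%:R * kappa%:R * (8%:R * (9%:R * Ln%:R) ^+ 3))).
  by rewrite !mulr_ge0 ?exprn_ge0 ?mulr_ge0.
move=> M y M0 yR edge.
set K := (kappa * M)%N; set n := (2 * (2 * K)).+1.
pose F (i : nat) : R := norm_weight (M ^ 2) (quad A B C (i%:Z - (2 * K)%N%:Z) y).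
have Fout (i : nat) : K%:Z < `|i%:Z - (2 * K)%N%:Z| -> F i = 0.
  move=> h; rewrite /F /norm_weight pos_cube_le0 // subr_le0 pmulrn ler_int.
  by rewrite leNgt; apply/negP=> /edge; rewrite leNgt h.
have K3 : (2 < K)%N by rewrite /K; nia.
have Fn i : (n <= i)%N -> F i = 0 by move=> ni; apply: Fout; rewrite /n in ni; lia.
have F0 : F 0%N = 0 by apply: Fout; lia.
have F1 : F 1%N = 0 by apply: Fout; lia.
have F2 : F 2%N = 0 by apply: Fout; lia.
have := abel F n Fn; rewrite /fdiff F0 F1 F2 !subrr !mulr0 !addr0 subr0.
move=> h; apply: le_trans h _.
rewrite -mulrA ler_wpM2l //.
apply: (@le_trans _ _ (\sum_(i < n) 8%:R * (9%:R * (Ln%:R * M%:R)) ^+ 3)); last first.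
  rewrite sumr_const card_ord -[_ *+ n]mulr_natr.
  have nle : n%:R <= 5%:R * kappa%:R * M%:R :> R.
    by rewrite -!natrM ler_nat /n /K; move: K3; rewrite /K; nia.
  have e0 : 0 <= 8%:R * (9%:R * (Ln%:R * M%:R)) ^+ 3 :> R.
    by rewrite !mulr_ge0 ?exprn_ge0 ?mulr_ge0.
  apply: le_trans (ler_wpM2l e0 nle) _.
  by rewrite le_eqVlt; apply/orP; left; apply/eqP; ring.
apply: ler_sum => i _.
pose x := (i : nat)%:Z - (2 * K)%N%:Z.
pose q0 := quad A B C x y; pose d := - (A * (2 * x + 1) + B * y).
have fE (k : nat) (v : int) : quad A B C (x + k%:Z) y = q0 - v ->
    F (i + k)%N = pos_cube ((M ^ 2)%:R - q0%:~R + v%:~R).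
  move=> e; rewrite /F /norm_weight.
  have -> : (i + k)%N%:Z - (2 * K)%N%:Z = x + k%:Z by rewrite /x PoszD; ring.
  by rewrite e rmorphB /=; congr pos_cube; ring.
have f0 : F i = pos_cube ((M ^ 2)%:R - q0%:~R) by rewrite /F /norm_weight.
have f1 : F i.+1 = pos_cube ((M ^ 2)%:R - q0%:~R + d%:~R).
  by rewrite -addn1; apply: fE; rewrite /q0 /d /quad; ring.
have f2 : F i.+2 = pos_cube ((M ^ 2)%:R - q0%:~R + 2%:R * d%:~R - 2%:R * A%:~R).
  rewrite -addn2 (fE _ (2 * d - 2 * A)); last by rewrite /q0 /d /quad; ring.
  by rewrite rmorphB !rmorphM /=; congr pos_cube; ring.
have f3 : F i.+3 = pos_cube ((M ^ 2)%:R - q0%:~R + 3%:R * d%:~R - 6%:R * A%:~R).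
  rewrite -addn3 (fE _ (3 * d - 6 * A)); last by rewrite /q0 /d /quad; ring.
  by rewrite rmorphB !rmorphM /=; congr pos_cube; ring.
have -> : F i.+3 - F i.+2 - (F i.+2 - F i.+1) - (F i.+2 - F i.+1 - (F i.+1 - F i)) =
   F i.+3 - 3%:R * F i.+2 + 3%:R * F i.+1 - F i by ring.
rewrite f0 f1 f2 f3; apply: pos_cube_quadratic_diff3.
- rewrite ler1n /Ln muln_gt0 (leq_trans _ k3) // andbT; lia.
- by rewrite ler1n.
- rewrite natrX lerBlDr lerDl ler0z; exact: Q0.
- rewrite -natrM -intr_norm pmulrn ler_int /d normrN.
  have xR : `|2 * x + 1| <= 5 * K%:Z by have := ltn_ord i; rewrite /x /n; lia.
  have -> : (Ln * M)%N%:Z = `|A| * (5 * K%:Z) + `|B| * (2 * K)%N%:Z.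
    by rewrite /Ln /K !(PoszM, PoszD) !abszE; ring.
  apply: le_trans (ler_normD _ _) _; rewrite !normrM.
  by apply: lerD; apply: ler_wpM2l.
- rewrite ler0z ltW //= -[Ln%:R]/(Ln%:Z%:~R) ler_int /Ln.
  have : (5 * `|A| <= Ln)%N by rewrite /Ln; nia.
  by rewrite /Ln; lia.
Qed.
(** The number of rows is O(M), whatever bounded factor each row carries. *)
Lemma box_bound (A B C : int) (kappa : nat) : 0 < A ->
  (forall x y, 0 <= quad A B C x y) -> (2 < kappa)%N ->
  exists2 c : R, 0 <= c & forall (M : nat) (sg : nat -> R), (0 < M)%N ->
    (forall i, `|sg i| = 1) ->
    (forall x y, quad A B C x y < (M ^ 2)%N%:Z -> `|x| <= (kappa * M)%N%:Z) ->
    `|\sum_(j < (2 * (2 * (kappa * M))).+1) \sum_(i < (2 * (2 * (kappa * M))).+1)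
        sg j * (-1) ^+ i * norm_weight (M ^ 2) (quad A B C (centered i) (centered j))| <= c * M%:R ^+ 5.
Proof.
move=> A0 Q0 k3; have [c c0 row] := row_bound A0 Q0 k3.
exists (5%:R * kappa%:R * c); first by rewrite !mulr_ge0.
move=> M sg M0 sg1 edge; apply: le_trans (ler_norm_sum _ _ _) _.
apply: (@le_trans _ _ (\sum_(j < (2 * (2 * (kappa * M))).+1) c * M%:R ^+ 4)).
  apply: ler_sum => j _; under eq_bigr => i _ do rewrite -mulrA.
  rewrite -mulr_sumr normrM sg1 mul1r; apply: row => //; last by move=> x; exact: edge.
  by rewrite /centered; have := ltn_ord j; lia.
rewrite sumr_const card_ord -[_ *+ _]mulr_natr.
have nle : (2 * (2 * (kappa * M))).+1%:R <= 5%:R * kappa%:R * M%:R :> R.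
  by rewrite -!natrM ler_nat; nia.
have e0 : 0 <= c * M%:R ^+ 4 by rewrite mulr_ge0 ?exprn_ge0.
apply: le_trans (ler_wpM2l e0 nle) _.
by rewrite le_eqVlt; apply/orP; left; apply/eqP; ring.
Qed.

(** 4 [x and y even] - 1 is the sum of the signs of x, of y and of x + y. Two of
    them alternate along rows, the third one along columns. *)
Lemma lattice_bound (A B C : int) (kappa : nat) : 0 < A -> 0 < C ->
  (forall x y, 0 <= quad A B C x y) -> (2 < kappa)%N ->
  exists2 c : R, 0 <= c & forall M : nat, (0 < M)%N ->
    (forall x y, quad A B C x y < (M ^ 2)%N%:Z ->
       `|x| <= (kappa * M)%N%:Z /\ `|y| <= (kappa * M)%N%:Z) ->
    `|\sum_(i < (2 * (2 * (kappa * M))).+1) \sum_(j < (2 * (2 * (kappa * M))).+1)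
        (4%:R * (~~ odd i && ~~ odd j)%:R - 1) *
        norm_weight (M ^ 2) (quad A B C (centered i) (centered j))| <= c * M%:R ^+ 5.
Proof.
move=> A0 C0 Q0 k3.
have swap x y : quad C B A y x = quad A B C x y by rewrite /quad; ring.
have Q0' x y : 0 <= quad C B A x y by rewrite swap.
have [c c0 box] := box_bound A0 Q0 k3.
have [c' c0' box'] := box_bound C0 Q0' k3.
exists (2%:R * c + c'); first by rewrite addr_ge0 ?mulr_ge0.
move=> M M0 edge; set n := (2 * _).+1.
have e1 x y : quad A B C x y < (M ^ 2)%N%:Z -> `|x| <= (kappa * M)%N%:Z by case/edge.
have e2 x y : quad C B A x y < (M ^ 2)%N%:Z -> `|x| <= (kappa * M)%N%:Z.
  by rewrite swap => /edge[].
have sgn1 i : `|(-1) ^+ i : R| = 1 by rewrite normrX normrN1 expr1n.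
have h1 := box M (fun=> 1) M0 (fun=> normr1 _) e1.
have h2 := box M (fun j => (-1) ^+ j) M0 sgn1 e1.
have h3 := box' M (fun=> 1) M0 (fun=> normr1 _) e2.
rewrite -/n exchange_big /= in h1; rewrite -/n exchange_big /= in h2; rewrite -/n in h3.
rewrite (eq_bigr (fun i : 'I_n => \sum_(j < n) 1 * (-1) ^+ j *
  norm_weight (M ^ 2) (quad A B C (centered i) (centered j)))) in h3; last first.
  by move=> i _; apply: eq_bigr => j _; rewrite swap.
rewrite (_ : \sum_(i < n) _ = 
  \sum_(i < n) \sum_(j < n) 1 * (-1) ^+ i * norm_weight (M ^ 2) (quad A B C (centered i) (centered j)) +
  \sum_(i < n) \sum_(j < n) (-1) ^+ j * (-1) ^+ i * norm_weight (M ^ 2) (quad A B C (centered i) (centered j)) +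
  \sum_(i < n) \sum_(j < n) 1 * (-1) ^+ j * norm_weight (M ^ 2) (quad A B C (centered i) (centered j))); last first.
  rewrite -!big_split /=; apply: eq_bigr => i _; rewrite -!big_split /=; apply: eq_bigr => j _.
  rewrite -[(-1) ^+ i]signr_odd -[(-1) ^+ j]signr_odd.
  by case: (odd i); case: (odd j); rewrite /= ?expr0 ?expr1; ring.
apply: le_trans (ler_normD _ _) _; rewrite (_ : _ * _ = c * M%:R ^+ 5 + c * M%:R ^+ 5 + c' * M%:R ^+ 5); last by ring.
by apply: lerD => //; apply: le_trans (ler_normD _ _) _; apply: lerD.
Qed.

Lemma sum_even_ord (V : nmodType) (f : nat -> V) (m : nat) :
  \sum_(i < (2 * m).+1 | ~~ odd i) f i = \sum_(i < m.+1) f (2 * i)%N.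
Proof.
elim: m => [|m IH]; first by rewrite big_mkcond !big_ord1.
have -> : (2 * m.+1).+1 = (2 * m).+3 by lia.
rewrite big_mkcond big_ord_recr big_ord_recr -big_mkcond /= IH oddM /=.
by rewrite addr0 [RHS]big_ord_recr /=; congr (_ + f _); lia.
Qed.

(** A point of the box of radius 2 K with even coordinates is twice a point of the
    box of radius K; the radius 2 K is even, so parity is not affected by the
    shift to ordinals. *)
Lemma sum_even_box (g : int -> int -> R) (K : nat) :
  \sum_(i < (2 * (2 * K)).+1) \sum_(j < (2 * (2 * K)).+1)
     (~~ odd i && ~~ odd j)%:R * g (centered i) (centered j) =
  \sum_(i < (2 * K).+1) \sum_(j < (2 * K).+1) g (2 * centered i) (2 * centered j).
Proof.
have centeredE (i : nat) : (2 * i)%N%:Z - (2 * K)%N%:Z = 2 * (i%:Z - K%:Z) by lia.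
transitivity (\sum_(i < (2 * (2 * K)).+1 | ~~ odd i)
    \sum_(j < (2 * (2 * K)).+1 | ~~ odd j) g (centered i) (centered j)).
  rewrite [RHS]big_mkcond; apply: eq_bigr => i _.
  case: (~~ odd i); last by rewrite big1 // => j _; rewrite mul0r.
  rewrite [RHS]big_mkcond; apply: eq_bigr => j _.
  by case: (~~ odd j); rewrite ?mul1r ?mul0r.
rewrite (sum_even_ord (fun i => \sum_(j < (2 * (2 * K)).+1 | ~~ odd j)
  g (i%:Z - (2 * K)%N%:Z) (centered j))); apply: eq_bigr => i _.
rewrite (sum_even_ord (fun j => g ((2 * i)%N%:Z - (2 * K)%N%:Z) (j%:Z - (2 * K)%N%:Z))).
by apply: eq_bigr => j _; rewrite !centeredE.
Qed.
End Lattice.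

(** * Integers of the quadratic field *)

Lemma Aint_quadratic (z : algC) (a b : int) :
  z ^+ 2 = a%:~R * z + b%:~R -> z \in Aint.
Proof.
move=> zz; apply: (@root_monic_Aint ('X^2 - (a%:~R *: 'X + b%:~R%:P))).
- by rewrite /root !hornerE zz subrr.
- rewrite monicE lead_coefDl ?lead_coefXn // size_polyN size_polyXn ltnS.
  rewrite (leq_trans (size_polyD _ _)) // geq_max (leq_trans (size_scale_leq _ _)) ?size_polyX //.
  by rewrite (leq_trans (size_polyC_leq1 _)).
- apply/polyOverP=> i; rewrite !coefE.
  apply: rpredB; first by rewrite natr_int.
  by apply: rpredD; [apply: rpredM; rewrite ?intr_int ?natr_int | case: ifP => _; rewrite ?intr_int ?rpred0].
Qed.

Lemma AintD (x y : algC) : x \in Aint -> y \in Aint -> x + y \in Aint.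
Proof. exact: rpredD. Qed.

Lemma AintM (x y : algC) : x \in Aint -> y \in Aint -> x * y \in Aint.
Proof. exact: rpredM. Qed.

Section QuadraticIntegers.
Local Open Scope classical_set_scope.
Local Open Scope ring_scope.
Variable p : nat.
Hypotheses (p_prime : prime p) (p_mod4 : (p %% 4 = 3)%N).

Definition sqrtmp : algC := sqrtC (- p%:Z)%:~R.
Definition omega : algC := (1 + sqrtmp) / 2%:R.
Definition qint (x y : int) : algC := x%:~R + y%:~R * omega.
Definition qnorm (x y : int) : int := x ^+ 2 + x * y + (p.+1 %/ 4)%:Z * y ^+ 2.

Local Notation s := sqrtmp.
Local Notation w := omega.
Local Notation K := (quadratic_field (- p%:Z)).
Local Notation O := (ring_of_integers K).

Lemma sqrtmp_sq : s ^+ 2 = - p%:R.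
Proof. by rewrite sqrtCK mulrNz. Qed.

Lemma omega_sq : w ^+ 2 = w - (p.+1 %/ 4)%:R.
Proof.
have two0 : (2%:R : algC) != 0 by rewrite pnatr_eq0.
have pE : (p%:R : algC) = 4%:R * (p.+1 %/ 4)%:R - 1.
  by rewrite -natrM -[1]/(1%:R) -natrB; [congr _%:R; move: p_mod4; lia | move: p_mod4; lia].
by rewrite /omega exprMn sqrrD sqrtmp_sq pE expr1n; field.
Qed.

Lemma conj_sqrtmp : s^* = - s.
Proof.
have : (s^*) ^+ 2 == s ^+ 2 by rewrite -rmorphXn sqrtmp_sq rmorphN rmorph_nat.
rewrite eqf_sqr => /orP[] /eqP // sr; have := sqrtmp_sq.
have : s \is Num.real by apply/CrealP.
move=> /real_exprn_even_ge0 -/(_ 2%N isT) => s0 sq; move: s0; rewrite sq.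
by rewrite oppr_ge0 lern0 => /eqP p0; move: p_prime; rewrite p0.
Qed.

Lemma conj_omega : w^* = 1 - w.
Proof.
rewrite /omega rmorphM /= rmorphD rmorph1 /= conj_sqrtmp fmorphV rmorph_nat.
by field.
Qed.

Lemma conj_qint x y : (qint x y)^* = qint (x + y) (- y).
Proof.
rewrite /qint rmorphD rmorphM /= conj_omega !rmorph_int rmorphD rmorphN /=.
by ring.
Qed.

Lemma qintM x y x' y' : qint x y * qint x' y' =
  qint (x * x' - (p.+1 %/ 4)%:Z * y * y') (x * y' + y * x' + y * y').
Proof.
rewrite /qint !(rmorphD, rmorphB, rmorphM) /=.
transitivity (x%:~R * x'%:~R + (x%:~R * y'%:~R + y%:~R * x'%:~R) * w + y%:~R * y'%:~R * w ^+ 2).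
  by ring.
by rewrite omega_sq pmulrn; ring.
Qed.

Lemma qint_norm x y : qint x y * (qint x y)^* = (qnorm x y)%:~R.
Proof.
rewrite conj_qint qintM /qint /qnorm.
have -> : x * - y + y * (x + y) + y * - y = 0 by ring.
by rewrite mul0r addr0; congr _%:~R; ring.
Qed.

Lemma qintD x y x' y' : qint x y + qint x' y' = qint (x + x') (y + y').
Proof. by rewrite /qint !rmorphD /=; ring. Qed.

Lemma qintN x y : - qint x y = qint (- x) (- y).
Proof. by rewrite /qint !rmorphN /=; ring. Qed.

Lemma qintZ (k x y : int) : k%:~R * qint x y = qint (k * x) (k * y).
Proof. by rewrite /qint !rmorphM /=; ring. Qed.

Lemma qintr (k : int) : k%:~R = qint k 0.
Proof. by rewrite /qint mul0r addr0. Qed.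

Lemma qnorm4 x y : 4 * qnorm x y = (2 * x + y) ^+ 2 + p%:Z * y ^+ 2.
Proof.
have -> : p%:Z = 4 * (p.+1 %/ 4)%:Z - 1 by move: p_mod4; lia.
by rewrite /qnorm; ring.
Qed.

Lemma qnorm_eq0 x y : (qnorm x y == 0) = (x == 0) && (y == 0).
Proof.
apply/eqP/andP => [n0|[/eqP-> /eqP->]]; last by rewrite /qnorm; ring.
have := qnorm4 x y; rewrite n0 mulr0 => e.
have p0 : (0 < p)%N := prime_gt0 p_prime.
have y0 : y = 0 by nia.
by split; apply/eqP => //; move: e; rewrite y0; nia.
Qed.

Lemma qnorm_ge0 x y : 0 <= qnorm x y.
Proof. by have := qnorm4 x y; nia. Qed.

Lemma qint_eq0 x y : (qint x y == 0) = (x == 0) && (y == 0).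
Proof.
rewrite -qnorm_eq0; apply/eqP/eqP => [e|/eqP].
  by apply/eqP; rewrite -(intr_eq0 algC) -qint_norm e mul0r.
by rewrite -(intr_eq0 algC) -qint_norm mul_conjC_eq0 => /eqP.
Qed.

Lemma qint_inj x y x' y' : qint x y = qint x' y' -> x = x' /\ y = y'.
Proof.
move=> /eqP; rewrite -subr_eq0 qintN qintD qint_eq0 !subr_eq0.
by move=> /andP[/eqP-> /eqP->].
Qed.

Lemma Aint_omega : w \in Aint.
Proof.
apply: (@Aint_quadratic _ 1 (- (p.+1 %/ 4)%:Z)).
by rewrite omega_sq mul1r rmorphN.
Qed.

(** The trace and the norm of an algebraic integer of the field are rational
    integers. The norm equation first shows that 2 p y, then 2 y is an integer,
    and finally that 2 x and 2 y have the same parity. *)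
Lemma ring_of_integersP z : O z <-> exists x y, z = qint x y.
Proof.
split=> [[[x [y zE]] zA]|[x [y ->]]]; last first.
  split; last by apply: AintD; [|apply: AintM]; rewrite ?Aint_omega ?Aint_int.
  exists (x%:~R + y%:~R / 2%:R), (y%:~R / 2%:R).
  rewrite !(ratr_nat, ratr_int, rmorphD, rmorphM, fmorphV) /= /qint /omega -/sqrtmp.
  by field.
have zcE : z^* = ratr x - ratr y * s.
  rewrite zE -/sqrtmp rmorphD [X in _ + X]rmorphM /= conj_sqrtmp mulrN.
  by congr (_ + - (_ * _)); apply: conj_Creal; apply: Creal_Crat; apply/CratP; eexists.
have zcA : z^* \in Aint by rewrite (Aint_aut Num.conj).
have toint (u : rat) : ratr u \in Aint -> exists k : int, u = k%:~R.
  move=> uA; have /intrP[k ek] : (ratr u : algC) \in Num.int.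
    by apply: Cint_rat_Aint => //; apply/CratP; exists u.
  by exists k; apply: (fmorph_inj (ratr : rat -> algC)); rewrite /= ratr_int -ek.
have [a ea] : exists k : int, 2%:R * x = k%:~R.
  apply: toint; have -> : ratr (2%:R * x) = z + z^*.
    by rewrite zcE zE rmorphM /= ratr_nat -/sqrtmp; ring.
  exact: AintD.
have [n en] : exists k : int, x ^+ 2 + p%:R * y ^+ 2 = k%:~R.
  apply: toint; have -> : ratr (x ^+ 2 + p%:R * y ^+ 2) = z * z^*.
    rewrite zcE zE rmorphD rmorphM !rmorphXn /= ratr_nat -/sqrtmp.
    transitivity (ratr x ^+ 2 - ratr y ^+ 2 * s ^+ 2); last by ring.
    by rewrite sqrtmp_sq; ring.
  exact: AintM.
have [c ec] : exists k : int, 2%:R * p%:R * y = k%:~R.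
  apply: toint; apply: (@Aint_quadratic _ 0 (p%:Z * (4 * n - a ^+ 2))).
  rewrite mul0r add0r -rmorphXn /= -[RHS]ratr_int; congr ratr.
  by rewrite !(rmorphM, rmorphB, rmorphXn) /= -ea -en; ring.
have pc : (p %| c)%Z.
  rewrite -(dvdz_sqr p_prime); apply/dvdzP; exists (4 * n - a ^+ 2).
  by apply: (@intr_inj rat); rewrite !(rmorphM, rmorphB, rmorphXn) /= -ea -ec -en; ring.
have [b eb] := dvdzP pc.
have p0 : (p%:R : rat) != 0 by rewrite pnatr_eq0 -lt0n prime_gt0.
have ey : 2%:R * y = b%:~R.
  by apply: (mulfI p0); rewrite mulrA [p%:R * 2%:R]mulrC ec eb rmorphM /= mulrC.
have eab : a ^+ 2 + p%:Z * b ^+ 2 = 4 * n.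
  by apply: (@intr_inj rat); rewrite !(rmorphM, rmorphD, rmorphXn) /= -ea -ey -en; ring.
have [k ek] : exists k, a - b = 2 * k.
  have : (2 %| (a - b) ^+ 2)%Z.
    apply/dvdzP; exists (2 * n - a * b - (p.+1 %/ 2)%N%:Z * b ^+ 2 + b ^+ 2).
    have eq1 : a ^+ 2 = 4 * n - p%:Z * b ^+ 2 by rewrite -eab; ring.
    have pE : p%:Z = 2 * (p.+1 %/ 2)%N%:Z - 1 by move: p_mod4; lia.
    transitivity (a ^+ 2 - 2 * a * b + b ^+ 2); first by ring.
    by rewrite eq1 pE; ring.
  by rewrite (@dvdz_sqr 2) // => /dvdzP[k ->]; exists k; rewrite mulrC.
exists k, b; rewrite zE -/sqrtmp /qint /omega.
have -> : x = k%:~R + b%:~R / 2%:R.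
  have -> : x = a%:~R / 2%:R by rewrite -ea; field.
  have -> : a = 2 * k + b by rewrite -ek; ring.
  by rewrite rmorphD rmorphM /=; field.
have -> : y = b%:~R / 2%:R by rewrite -ey; field.
rewrite !(ratr_nat, ratr_int, rmorphD, rmorphM, fmorphV) /=.
by field.
Qed.

Lemma qint_O x y : O (qint x y).
Proof. by apply/ring_of_integersP; exists x, y. Qed.

End QuadraticIntegers.

(** * Nonzero ideals in Hermite normal form *)

Section IntegerSubgroups.
Local Open Scope classical_set_scope.
Local Open Scope ring_scope.

Lemma int_subgroup (H : set int) : (forall x y, H x -> H y -> H (x - y)) ->
  (exists2 x, H x & x != 0) ->
  exists2 d : nat, (0 < d)%N & forall x, H x <-> (d %| x)%Z.
Proof.
move=> HB [x0 Hx0 nzx0].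
have H0 : H 0 by rewrite -(subrr x0); exact: HB.
have HN x : H x -> H (- x) by move=> Hx; rewrite -sub0r; exact: HB.
have HD x y : H x -> H y -> H (x + y).
  by move=> Hx Hy; rewrite -[y]opprK; apply: HB => //; exact: HN.
have HMn x (k : nat) : H x -> H (x *+ k).
  by move=> Hx; elim: k => [|k IH]; rewrite ?mulr0n // mulrS; exact: HD.
have HM x (k : int) : H x -> H (k * x).
  move=> Hx; case: k => k; first by rewrite mulrC -mulrzz -pmulrn; exact: HMn.
  by rewrite NegzE mulNr mulrC -mulrzz -pmulrn; apply: HN; exact: HMn.
have exP : exists n : nat, (0 < n)%N && `[<H n%:Z>].
  exists `|x0|%N; rewrite absz_gt0 nzx0 /=; apply/asboolP.
  by case: (lerP 0 x0) => s0; [rewrite gez0_abs | rewrite ltz0_abs //; exact: HN].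
have [d /andP[d0 /asboolP Hd] dmin] := ex_minnP exP.
exists d => // x; split=> [Hx|/dvdzP[k ->]]; last exact: HM.
apply/dvdz_mod0P; apply/eqP; apply: contraT => nz.
have r0 : 0 <= (x %% d)%Z by rewrite modz_ge0 // eqz_nat -lt0n.
have rd : (x %% d)%Z < d by rewrite ltz_pmod.
have Hr : H (x %% d)%Z by rewrite /modz; apply: HB => //; exact: HM.
have : (d <= `|(x %% d)%Z|)%N.
  by apply: dmin; rewrite absz_gt0 nz gez0_abs //; apply/asboolP.
by rewrite -lez_nat gez0_abs // leNgt rd.
Qed.

End IntegerSubgroups.

Section Ideals.
Local Open Scope classical_set_scope.
Local Open Scope ring_scope.
Variable p : nat.
Hypotheses (p_prime : prime p) (p_mod4 : (p %% 4 = 3)%N).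
Local Notation K := (quadratic_field (- p%:Z)).
Local Notation O := (ring_of_integers K).
Local Notation qint := (qint p).
Local Notation omega := (omega p).

(** The ideal g (Z n + Z (b - omega)). *)
Definition hnf_ideal (g n : nat) (b : int) : set algC :=
  [set z | exists x y : int, z = qint (g%:Z * x) (g%:Z * y) /\ (n %| x + b * y)%Z].

Lemma hnf_idealP g n b x y : (0 < g)%N ->
  hnf_ideal g n b (qint (g%:Z * x) (g%:Z * y)) <-> (n %| x + b * y)%Z.
Proof.
move=> g0; have gn0 : g%:Z != 0 by rewrite eqz_nat -lt0n.
split=> [[x' [y' [e]]]|]; last by exists x, y.
have [ex ey] := qint_inj p_prime p_mod4 e.
by rewrite (mulfI gn0 ex) (mulfI gn0 ey).
Qed.

Lemma hnf_ideal1P n b x y : hnf_ideal 1 n b (qint x y) <-> (n %| x + b * y)%Z.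
Proof. by rewrite -{1}[x]mul1r -{1}[y]mul1r; exact: hnf_idealP. Qed.

Lemma hnf_ideal_ideal g n b : (0 < g)%N -> (0 < n)%N -> (n %| fnorm p b)%Z ->
  is_nonzero_ideal K (hnf_ideal g n b).
Proof.
move=> g0 n0 nf; split.
- by move=> z [x [y [-> _]]]; exact: qint_O.
- move=> _ _ [x [y [-> nx]]] [x' [y' [-> nx']]]; exists (x + x'), (y + y').
  split; first by rewrite qintD !mulrDr.
  have -> : x + x' + b * (y + y') = x + b * y + (x' + b * y') by ring.
  exact: rpredD.
- move=> r _ /ring_of_integersP -/(_ p_prime p_mod4) [u [v ->]] [x [y [-> nx]]].
  exists (u * x - (p.+1 %/ 4)%:Z * v * y), (u * y + v * x + v * y); split.
    by rewrite qintM //; congr (qint _ _); ring.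
  have -> : u * x - (p.+1 %/ 4)%N%:Z * v * y + b * (u * y + v * x + v * y) =
     (u + v * b) * (x + b * y) - v * y * fnorm p b by rewrite /fnorm; ring.
  by rewrite rpredB // dvdz_mull.
exists (qint (g%:Z * n%:Z) 0).
  by exists n%:Z, 0; rewrite !mulr0 addr0.
by rewrite qint_eq0 // eqxx andbT mulf_neq0 // eqz_nat -lt0n.
Qed.

Lemma hnf_ideal_mod (g n : nat) (b b' : int) : (b == b' %[mod n])%Z ->
  hnf_ideal g n b = hnf_ideal g n b'.
Proof.
move=> bb; apply/seteqP.
have sub c c' : (c == c' %[mod n])%Z -> hnf_ideal g n c `<=` hnf_ideal g n c'.
  rewrite eqz_mod_dvd => cc z [x [y [-> nx]]]; exists x, y; split=> //.
  have -> : x + c' * y = x + c * y - (c - c') * y by ring.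
  by rewrite rpredB // dvdz_mulr.
by split; apply: sub; rewrite // eq_sym.
Qed.

(** Hermite normal form: the omega-coordinates of I form a subgroup g Z, the
    rational integers in I a subgroup e Z, and multiplication by omega forces g
    to divide everything. *)
Lemma nonzero_ideal_hnf I : is_nonzero_ideal K I ->
  exists g n b : nat, [/\ (0 < g)%N, (0 < n)%N, (b < n)%N, (n %| fnorm p b)%Z &
    I = hnf_ideal g n b].
Proof.
case=> IO ID IM [z0 Iz0 nz0].
have IN z : I z -> I (- z).
  move=> Iz; rewrite -mulN1r; apply: IM => //.
  by rewrite -[-1]/((-1)%:~R) (qintr p); exact: qint_O.
have IB z z' : I z -> I z' -> I (z - z') by move=> Iz Iz'; apply: ID => //; exact: IN.
have IZ (k x y : int) : I (qint x y) -> I (qint (k * x) (k * y)).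
  by move=> Iz; rewrite -qintZ; apply: IM => //; rewrite (qintr p); exact: qint_O.
have Iw x y : I (qint x y) -> I (qint (- (p.+1 %/ 4)%:Z * y) (x + y)).
  move=> Iz; have := IM (qint 0 1) _ (qint_O p_prime p_mod4 0 1) Iz.
  rewrite qintM //.
  have -> : 0 * x - (p.+1 %/ 4)%N%:Z * 1 * y = - (p.+1 %/ 4)%N%:Z * y by ring.
  by have -> : 0 * y + 1 * x + 1 * y = x + y by ring.
have [x0 [y0 z0E]] := (ring_of_integersP p_prime p_mod4 z0).1 (IO _ Iz0).
have [||g g0 gP] := @int_subgroup [set y | exists x, I (qint x y)].
- move=> y y' [x Ix] [x' Ix']; exists (x - x').
  by rewrite -qintD -qintN; exact: IB.
- have [y00|y00] := eqVneq y0 0; last by exists y0 => //; exists x0; rewrite -z0E.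
  exists x0; last by apply: contra_neq nz0 => x00; rewrite z0E x00 y00 -(qintr p).
  exists (- (p.+1 %/ 4)%:Z * y0).
  by have := Iw x0 y0; have -> : x0 + y0 = x0 by [rewrite y00 addr0]; rewrite -z0E; exact.
have [||e e0 eP] := @int_subgroup [set x | I (qint x 0)].
- by move=> x x' Ix Ix'; have := IB _ _ Ix Ix'; rewrite qintN qintD subr0.
- exists (qnorm p x0 y0); last by rewrite qnorm_eq0 // -(qint_eq0 p_prime p_mod4) -z0E.
  rewrite /= -(qintr p) -qint_norm // mulrC; apply: IM; last by rewrite -z0E.
  by rewrite conj_qint //; exact: qint_O.
have gcoord x y : I (qint x y) -> (g %| x)%Z /\ (g %| y)%Z.
  move=> Ixy; have gy : (g %| y)%Z by apply/gP; exists x.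
  split=> //; have : (g %| x + y)%Z.
    by apply/gP; exists (- (p.+1 %/ 4)%:Z * y); exact: Iw.
  by rewrite rpredDr.
have [a0 Ia0] := (gP g%:Z).2 (dvdzz _).
have [/dvdzP[b' a0E] _] := gcoord _ _ Ia0.
have Ie : I (qint e%:Z 0) by apply/(eP e%:Z).2/dvdzz.
have [/dvdzP[n' eE] _] := gcoord _ _ Ie.
have [n nE] : exists n : nat, n' = n%:Z by exists `|n'|%N; nia.
have n0 : (0 < n)%N by nia.
rewrite {}nE in eE.
pose b := - b'.
have IE x y : I (qint (g%:Z * x) (g%:Z * y)) <-> (n %| x + b * y)%Z.
  have Iy : I (qint (a0 * y) (g%:Z * y)).
    by rewrite ![_ * y]mulrC; exact: IZ.
  have step : I (qint (g%:Z * x) (g%:Z * y)) <-> I (qint (g%:Z * (x + b * y)) 0).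
    have eq1 : qint (g%:Z * (x + b * y)) 0 = qint (g%:Z * x) (g%:Z * y) - qint (a0 * y) (g%:Z * y).
      by rewrite qintN qintD a0E /b; congr (qint _ _); ring.
    rewrite eq1; split=> [h|h]; first exact: IB.
    by rewrite -[qint _ _](subrK (qint (a0 * y) (g%:Z * y))); exact: ID.
  apply: (iff_trans step); apply: (iff_trans (eP (g%:Z * (x + b * y)))).
  by rewrite eE [n%:Z * _]mulrC dvdz_mul2l // eqz_nat -lt0n.
have nf : (n %| fnorm p b)%Z.
  have : I (qint (g%:Z * - b) (g%:Z * 1)) by apply/IE; rewrite mulr1 addNr dvdz0.
  move=> /Iw; have -> : - (p.+1 %/ 4)%N%:Z * (g%:Z * 1) = g%:Z * - (p.+1 %/ 4)%N%:Z by ring.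
  have -> : g%:Z * - b + g%:Z * 1 = g%:Z * (1 - b) by ring.
  move=> /IE; have -> : - (p.+1 %/ 4)%N%:Z + b * (1 - b) = - fnorm p b by rewrite /fnorm; ring.
  by rewrite rpredN.
have r0 : 0 <= (b %% n)%Z by rewrite modz_ge0 // eqz_nat -lt0n.
have rE : `|(b %% n)%Z|%N%:Z = (b %% n)%Z by rewrite gez0_abs.
exists g, n, `|(b %% n)%Z|%N; split=> //.
- by rewrite -ltz_nat rE ltz_pmod.
- by rewrite rE (@fnorm_mod _ _ _ b) // -eqz_mod_dvd modz_mod.
rewrite rE (@hnf_ideal_mod _ _ _ b) ?modz_mod //; apply/seteqP; split=> z.
  move=> Iz; have [x [y zE]] := (ring_of_integersP p_prime p_mod4 z).1 (IO _ Iz).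
  rewrite zE in Iz; have [/dvdzP[x1 xE] /dvdzP[y1 yE]] := gcoord _ _ Iz.
  rewrite zE xE yE ![_ * g%:Z]mulrC; apply/hnf_idealP => //; apply/IE.
  by rewrite ![g%:Z * _]mulrC -xE -yE.
by move=> [x [y [-> nx]]]; apply/IE.
Qed.

(** g is the least positive omega-coordinate in the ideal, g n its least positive
    rational integer, and g (omega - b) determines b modulo n. *)
Lemma hnf_ideal_inj g n b g' n' b' : (0 < g)%N -> (0 < n)%N -> (b < n)%N ->
  (0 < g')%N -> (0 < n')%N -> (b' < n')%N ->
  hnf_ideal g n b%:Z = hnf_ideal g' n' b'%:Z -> [/\ g = g', n = n' & b = b'].
Proof.
have sub g1 n1 (b1 : int) g2 n2 b2 : (0 < g1)%N -> (0 < g2)%N ->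
    hnf_ideal g1 n1 b1 = hnf_ideal g2 n2 b2 -> (g2 %| g1)%N.
  move=> g10 g20 e; have : hnf_ideal g1 n1 b1 (qint (g1%:Z * - b1) (g1%:Z * 1)).
    by apply/hnf_idealP => //; rewrite mulr1 addNr dvdz0.
  rewrite e => -[x [y [/(qint_inj p_prime p_mod4)[_ e2] _]]].
  by rewrite mulr1 in e2; have := dvdz_mulr y (dvdzz g2%:Z); rewrite -e2 dvdzE.
move=> g0 n0 bn g0' n0' bn' e.
have gE : g = g' by apply/eqP; rewrite eqn_dvd (sub _ _ _ _ _ _ g0 g0' e) (sub _ _ _ _ _ _ g0' g0 (esym e)).
have subn n1 (b1 : int) n2 b2 : hnf_ideal g n1 b1 = hnf_ideal g n2 b2 -> (n2 %| n1)%N.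
  move=> e1; have : hnf_ideal g n1 b1 (qint (g%:Z * n1%:Z) (g%:Z * 0)).
    by apply/hnf_idealP => //; rewrite mulr0 addr0.
  by rewrite e1 => /(hnf_idealP _ _ _ _ g0); rewrite mulr0 addr0 dvdzE.
rewrite -gE in e.
have nE : n = n' by apply/eqP; rewrite eqn_dvd (subn _ _ _ _ e) (subn _ _ _ _ (esym e)).
split=> //; rewrite -nE in e bn'.
have : hnf_ideal g n b (qint (g%:Z * - b%:Z) (g%:Z * 1)).
  by apply/hnf_idealP => //; rewrite mulr1 addNr dvdz0.
rewrite e => /(hnf_idealP _ _ _ _ g0); rewrite mulr1 addrC -eqz_mod_dvd !modz_nat eqz_nat.
by rewrite !modn_small // => /eqP.
Qed.
End Ideals.

(** * Ideals in a class and values of a form *)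

(** Up to sign, the covolume of a lattice does not depend on its basis. *)
Lemma lattice_covolume (u v u' v' : algC) (a b c d a' b' c' d' : int) :
  let D (z z' : algC) := z * z'^* - z^* * z' in
  u' = a%:~R * u + b%:~R * v -> v' = c%:~R * u + d%:~R * v ->
  u = a'%:~R * u' + b'%:~R * v' -> v = c'%:~R * u' + d'%:~R * v' ->
  D u v != 0 -> D u' v' = D u v \/ D u' v' = - D u v.
Proof.
move=> D eu' ev' eu ev nz.
have lin (x y : algC) (e f g h : int) :
    D (e%:~R * x + f%:~R * y) (g%:~R * x + h%:~R * y) = (e * h - f * g)%:~R * D x y.
  by rewrite /D !(rmorph_int, rmorphD, rmorphN, rmorphM) /=; ring.
have D1 : D u' v' = (a * d - b * c)%:~R * D u v by rewrite eu' ev' lin.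
have D2 : D u v = (a' * d' - b' * c')%:~R * D u' v' by rewrite {1}eu {1}ev lin.
have : ((a' * d' - b' * c') * (a * d - b * c))%:~R = 1 :> algC.
  by apply: (mulIf nz); rewrite mul1r rmorphM /= -mulrA -D1 -D2.
move=> /(@intr_inj _ _ 1) e1.
have /orP[/eqP e2|/eqP e2] : (a * d - b * c == 1) || (a * d - b * c == -1).
- have := congr1 absz e1; rewrite abszM => /eqP; rewrite muln_eq1 => /andP[_].
  by move: (a * d - b * c) => y; lia.
- by left; rewrite D1 e2 mul1r.
- by right; rewrite D1 e2 mulN1r.
Qed.

Lemma covolume_scale (t W : algC) (n : nat) (b : int) : W^* = 1 - W ->
  t * n%:R * (t * (W - b%:~R))^* - (t * n%:R)^* * (t * (W - b%:~R)) =
  t * t^* * n%:R * (1 - 2%:R * W).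
Proof.
by move=> WE; rewrite !(rmorph_int, rmorph_nat, rmorphM, rmorphB) /= WE; ring.
Qed.

Section Correspondence.
Local Open Scope classical_set_scope.
Local Open Scope ring_scope.
Variable p : nat.
Hypotheses (p_prime : prime p) (p_mod4 : (p %% 4 = 3)%N).
Local Notation K := (quadratic_field (- p%:Z)).
Local Notation O := (ring_of_integers K).
Local Notation qint := (qint p).
Local Notation omega := (omega p).
Local Notation hnf_ideal := (hnf_ideal p).

Lemma qintE x y : qint x y = x%:~R + y%:~R * omega. Proof. by []. Qed.

(** The binary quadratic form attached to the ideal Z n + Z (b - omega): the
    norm form on its conjugate, divided by n. *)
Definition qform (n : nat) (b x y : int) : int :=
  n%:Z * x ^+ 2 + (2 * b - 1) * x * y + (fnorm p b %/ n)%Z * y ^+ 2.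

Definition conj_elt (n : nat) (b x y : int) : algC := qint (n%:Z * x + (b - 1) * y) y.

(** The ideal of type (g, k, c) is the multiple of Z n + Z (b - omega) by
    conj_elt n b x y / n. *)
Definition multiple_of (n : nat) (b x y : int) (g k : nat) (c : int) : Prop :=
  [set n%:R * z | z in hnf_ideal g k c] = [set conj_elt n b x y * w | w in hnf_ideal 1 n b].

Variables (n : nat) (b : int).
Hypotheses (n_gt0 : (0 < n)%N) (n_fb : (n %| fnorm p b)%Z).
Local Notation J := (hnf_ideal 1 n b).
Local Notation tau := (conj_elt n b).

Let n0 : (n%:R : algC) != 0. Proof. by rewrite pnatr_eq0 -lt0n. Qed.

Lemma conj_elt_norm x y :
  qnorm p (n%:Z * x + (b - 1) * y) y = n%:Z * qform n b x y.
Proof.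
have [f' fE] := dvdzP n_fb; rewrite /qform fE mulzK ?eqz_nat -?lt0n //.
have mE : (p.+1 %/ 4)%:Z = f' * n%:Z - b ^+ 2 + b by rewrite -fE /fnorm; ring.
by rewrite /qnorm mE; ring.
Qed.

Lemma conj_elt_eq0 x y : (tau x y == 0) = (x == 0) && (y == 0).
Proof.
rewrite qint_eq0 //; have [->|] := eqVneq y 0; last by rewrite !andbF.
by rewrite mulr0 addr0 mulf_eq0 eqz_nat (gtn_eqF n_gt0).
Qed.

Lemma hnf_ideal1_n : J n%:R.
Proof.
by have -> : n%:R = qint n%:Z 0 by [rewrite qintE mul0r addr0]; apply/hnf_ideal1P; rewrite // mulr0 addr0.
Qed.

Lemma hnf_ideal1_omega : J (omega - b%:~R).
Proof.
have -> : omega - b%:~R = qint (- b) 1 by rewrite qintE rmorphN mul1r addrC.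
by apply/hnf_ideal1P; rewrite // mulr1 addNr.
Qed.

Lemma hnf_ideal1_span z : J z -> exists k l : int, z = k%:~R * n%:R + l%:~R * (omega - b%:~R).
Proof.
move=> [x [y [-> /dvdzP[k xk]]]]; exists k, y; rewrite !mul1r qintE.
have -> : x = k * n%:Z - b * y by rewrite -xk; ring.
by rewrite rmorphB !rmorphM /= -pmulrn; ring.
Qed.

Lemma hnf_ideal_span g k c : (0 < g)%N -> (0 < k)%N -> forall z, hnf_ideal g k c z ->
  exists i j : int, z = i%:~R * (g%:R * k%:R) + j%:~R * (g%:R * (omega - c%:~R)).
Proof.
move=> g0 k0 z [x [y [-> /dvdzP[i xi]]]]; exists i, y; rewrite qintE.
have -> : x = i * k%:Z - c * y by rewrite -xi; ring.
by rewrite !rmorphM rmorphB !rmorphM /= -!pmulrn; ring.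
Qed.

Lemma hnf_ideal_n g k c : hnf_ideal g k c (g%:R * k%:R).
Proof.
exists k%:Z, 0; rewrite qintE !mulr0 mul0r !addr0 rmorphM /= -!pmulrn; split=> //.
Qed.

Lemma hnf_ideal_omega g k c : hnf_ideal g k c (g%:R * (omega - c%:~R)).
Proof.
exists (- c), 1; rewrite !mulr1 addNr dvdz0; split=> //.
by rewrite qintE !rmorphM rmorphN /= -pmulrn; ring.
Qed.

(** Together with the trivial case of n itself, this says that conj_elt n b x y
    maps the ideal into n O. *)
Lemma conj_elt_omega x y : tau x y * (omega - b%:~R) =
  n%:R * qint (- (b * x + (fnorm p b %/ n)%Z * y)) x.
Proof.
have -> : omega - b%:~R = qint (- b) 1 by rewrite qintE rmorphN mul1r addrC.
have -> : (n%:R : algC) = n%:Z%:~R by [].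
rewrite qintM // qintZ; have [f' fE] := dvdzP n_fb; rewrite fE mulzK ?eqz_nat -?lt0n //.
have mE : (p.+1 %/ 4)%:Z = f' * n%:Z - b ^+ 2 + b by rewrite -fE /fnorm; ring.
by congr (qint _ _); rewrite ?mE; ring.
Qed.

Lemma conj_elt_span x y (k l : int) :
  tau x y * (k%:~R * n%:R + l%:~R * (omega - b%:~R)) =
  n%:R * (k%:~R * tau x y + l%:~R * qint (- (b * x + (fnorm p b %/ n)%Z * y)) x).
Proof.
rewrite [LHS]mulrDr [tau x y * (l%:~R * _)]mulrCA conj_elt_omega; ring.
Qed.

(** Elements whose multiplication maps Z n + Z (b - omega) into n O. *)
Lemma conj_eltP s t u v : qint s t * (omega - b%:~R) = n%:R * qint u v ->
  qint s t = tau v t.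
Proof.
have -> : omega - b%:~R = qint (- b) 1 by rewrite qintE rmorphN mul1r addrC.
have -> : (n%:R : algC) = n%:Z%:~R by [].
rewrite qintM // qintZ => /(qint_inj p_prime p_mod4)[_ e].
by rewrite /tau -e; congr (qint _ _); ring.
Qed.

(** If a I = b0 J, then the ratio b0 / a times n lies in O and maps J into n O,
    hence is of the form conj_elt. *)
Lemma equiv_multiple g k c : (0 < g)%N -> (0 < k)%N ->
  ideal_equiv K (hnf_ideal g k c) J ->
  exists x y, tau x y != 0 /\ multiple_of n b x y g k c.
Proof.
move=> g0 k0 [a [b0 [_ _ nza nzb eqI]]].
have [z1 Iz1 e1] : [set a * x | x in hnf_ideal g k c] (b0 * n%:R).
  by rewrite eqI; exists n%:R => //; exact: hnf_ideal1_n.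
have [z2 Iz2 e2] : [set a * x | x in hnf_ideal g k c] (b0 * (omega - b%:~R)).
  by rewrite eqI; exists (omega - b%:~R) => //; exact: hnf_ideal1_omega.
have [s [t [z1E _]]] := Iz1; have [u [v [z2E _]]] := Iz2.
have z12 : z1 * (omega - b%:~R) = n%:R * z2.
  apply: (mulfI nza); rewrite mulrA e1 mulrCA e2; ring.
have := z12; rewrite {1}z1E {1}z2E => /conj_eltP; rewrite -z1E => z1T.
exists (g%:Z * v), (g%:Z * t); split.
  have : a * z1 != 0 by rewrite e1 mulf_neq0.
  by rewrite -z1T mulf_eq0 negb_or => /andP[].
rewrite /multiple_of -z1T; apply/seteqP; split=> _ [z Iz <-].
  have [w Jw ew] : [set b0 * y | y in J] (a * z) by rewrite -eqI; exists z.
  exists w => //; apply: (mulfI nza); rewrite mulrA e1 mulrCA -ew; ring.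
have [w Iw ew] : [set a * x | x in hnf_ideal g k c] (b0 * z) by rewrite eqI; exists z.
exists w => //; apply: (mulfI nza); rewrite mulrCA ew [in RHS]mulrA e1; ring.
Qed.

Lemma multiple_equiv x y g k c : tau x y != 0 -> multiple_of n b x y g k c ->
  ideal_equiv K (hnf_ideal g k c) J.
Proof.
move=> nz m; exists n%:R, (tau x y); split=> //; last exact: qint_O.
by have -> : n%:R = qint n%:Z 0 by [rewrite qintE mul0r addr0]; exact: qint_O.
Qed.

Lemma multiple_exists x y : tau x y != 0 ->
  exists g k c : nat, [/\ (0 < g)%N, (0 < k)%N, (c < k)%N, (k %| fnorm p c)%Z &
    multiple_of n b x y g k c].
Proof.
move=> nz; pose I := [set z | exists2 w, J w & n%:R * z = tau x y * w].
have [JO JD JM _] := hnf_ideal_ideal p_prime p_mod4 (ltn0Sn 0) n_gt0 n_fb.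
have idI : is_nonzero_ideal K I.
  split.
  - move=> z [w Jw ew]; have [k [l wE]] := hnf_ideal1_span Jw.
    have -> : z = k%:~R * tau x y + l%:~R * qint (- (b * x + (fnorm p b %/ n)%Z * y)) x.
      by apply: (mulfI n0); rewrite ew wE conj_elt_span.
    by rewrite !qintZ qintD; exact: qint_O.
  - move=> z z' [w Jw ew] [w' Jw' ew']; exists (w + w'); first exact: JD.
    by rewrite !mulrDr ew ew'.
  - move=> r z Or [w Jw ew]; exists (r * w); first exact: JM.
    by rewrite mulrCA ew mulrCA.
  by exists (tau x y) => //; exists n%:R; [exact: hnf_ideal1_n | rewrite mulrC].
have [g [k [c [g0 k0 ck kf IE]]]] := nonzero_ideal_hnf p_prime p_mod4 idI.
exists g, k, c; split=> //; rewrite /multiple_of -IE; apply/seteqP; split=> _ [z Iz <-].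
  by have [w Jw ->] := Iz; exists w.
have [k' [l wE]] := hnf_ideal1_span Iz.
exists (k'%:~R * tau x y + l%:~R * qint (- (b * x + (fnorm p b %/ n)%Z * y)) x).
  by exists z => //; rewrite wE conj_elt_span.
by rewrite wE conj_elt_span.
Qed.

(** Comparison of the covolumes of the two sides. *)
Lemma multiple_norm x y g k c : (0 < g)%N -> (0 < k)%N -> tau x y != 0 ->
  multiple_of n b x y g k c -> qform n b x y = (g ^ 2 * k)%N%:Z.
Proof.
move=> g0 k0 nz m.
have sub1 z : hnf_ideal g k c z -> exists i j : int,
    n%:R * z = i%:~R * (tau x y * n%:R) + j%:~R * (tau x y * (omega - b%:~R)).
  move=> Iz; have [w Jw <-] : [set tau x y * w | w in J] (n%:R * z) by rewrite -m; exists z.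
  by have [i [j ->]] := hnf_ideal1_span Jw; exists i, j; ring.
have sub2 w : J w -> exists i j : int, tau x y * w =
    i%:~R * (n%:R * g%:R * k%:R) + j%:~R * (n%:R * g%:R * (omega - c%:~R)).
  move=> Jw; have [z Iz <-] : [set n%:R * z | z in hnf_ideal g k c] (tau x y * w) by rewrite m; exists w.
  by have [i [j ->]] := hnf_ideal_span g0 k0 Iz; exists i, j; ring.
have [a [b1 e1]] := sub1 _ (hnf_ideal_n g k c); rewrite mulrA in e1.
have [a2 [b2 e2]] := sub1 _ (hnf_ideal_omega g k c); rewrite mulrA in e2.
have [a3 [b3 e3]] := sub2 _ hnf_ideal1_n.
have [a4 [b4 e4]] := sub2 _ hnf_ideal1_omega.
have om : omega^* = 1 - omega by exact: conj_omega.
have d0 : 1 - 2%:R * omega != 0.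
  have -> : 1 - 2%:R * omega = qint 1 (-2) by rewrite qintE rmorphN /=; ring.
  by rewrite qint_eq0.
have Nt : tau x y * (tau x y)^* = (n%:Z * qform n b x y)%:~R.
  by rewrite qint_norm // conj_elt_norm.
have D1 := covolume_scale (tau x y) n b om.
have D2 := covolume_scale (n%:R * g%:R) k c om.
have cng : (n%:R * g%:R)^* = n%:R * g%:R :> algC by rewrite -natrM rmorph_nat.
rewrite Nt in D1; rewrite [X in _ = _ * X * _ * _]cng in D2.
have nzN : qform n b x y != 0.
  apply: contraTneq nz => q0; rewrite negbK -(mul_conjC_eq0 (tau x y)) Nt q0 mulr0.
  exact: eqxx.
have := lattice_covolume e1 e2 e3 e4; rewrite D1 D2.
have -> : (n%:Z * qform n b x y)%:~R * n%:R * (1 - 2%:R * omega) != 0.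
  by rewrite !mulf_neq0 // intr_eq0 mulf_neq0 // eqz_nat -lt0n.
have qge : 0 <= qform n b x y.
  by have := qnorm_ge0 p_prime p_mod4 (n%:Z * x + (b - 1) * y) y; rewrite conj_elt_norm; nia.
move=> /(_ isT) h.
have key : n%:Z * g%:Z * (n%:Z * g%:Z) * k%:Z = n%:Z * qform n b x y * n%:Z \/
  n%:Z * g%:Z * (n%:Z * g%:Z) * k%:Z = - (n%:Z * qform n b x y * n%:Z).
  have cast : (n%:Z * g%:Z * (n%:Z * g%:Z) * k%:Z)%:~R =
      n%:R * g%:R * (n%:R * g%:R) * k%:R :> algC by rewrite !rmorphM.
  case: h => /= h; [left | right]; apply: (@intr_inj algC); apply: (mulIf d0);
    by rewrite ?rmorphN ?mulNr [in RHS]rmorphM /= -h cast.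
have nn : n%:Z != 0 by rewrite eqz_nat -lt0n.
case: key => key.
  apply: (mulfI nn); apply: (mulfI nn); rewrite PoszM -!mulnn PoszM.
  by transitivity (n%:Z * qform n b x y * n%:Z); [ring | rewrite -key; ring].
by exfalso; move: key nzN qge n_gt0 g0 k0; move: (qform n b x y) => q; nia.
Qed.
(** The ratio of two such elements maps the lattice J onto itself, so it is an
    algebraic integer of norm 1, and the only units of O are 1 and -1. *)
Lemma multiple_unique x y x' y' g k c : (3 < p)%N -> (0 < g)%N -> (0 < k)%N ->
  tau x y != 0 -> tau x' y' != 0 ->
  multiple_of n b x y g k c -> multiple_of n b x' y' g k c ->
  (x' = x /\ y' = y) \/ (x' = - x /\ y' = - y).
Proof.
move=> p3 g0 k0 nz nz' m m'.
have inJ w : J w -> exists i j : int, tau x' y' * w = tau x y * (i%:~R * n%:R + j%:~R * (omega - b%:~R)).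
  move=> Jw; have [w' Jw' ew'] : [set tau x y * w | w in J] (tau x' y' * w).
    by rewrite -m m'; exists w.
  by have [i [j w'E]] := hnf_ideal1_span Jw'; exists i, j; rewrite -w'E.
have [i [j e1]] := inJ _ hnf_ideal1_n; have [i' [j' e2]] := inJ _ hnf_ideal1_omega.
(* eps maps J to itself, so it is an eigenvalue of an integer matrix. *)
pose eps := tau x' y' / tau x y.
have epsE : tau x' y' = eps * tau x y by rewrite /eps mulfVK.
have f1 : (eps - i%:~R) * n%:R = j%:~R * (omega - b%:~R).
  by apply: (mulfI nz); move: e1; rewrite epsE => e; rewrite mulrBl mulrBr mulrA [tau x y * eps]mulrC e; ring.
have f2 : (eps - j'%:~R) * (omega - b%:~R) = i'%:~R * n%:R.
  by apply: (mulfI nz); move: e2; rewrite epsE => e; rewrite mulrBl mulrBr mulrA [tau x y * eps]mulrC e; ring.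
have ob0 : omega - b%:~R != 0.
  have -> : omega - b%:~R = qint (- b) 1 by rewrite qintE rmorphN mul1r addrC.
  by rewrite qint_eq0 // oner_eq0 andbF.
have epsA : eps \in Aint.
  apply: (@Aint_quadratic _ (i + j') (j * i' - i * j')).
  have : (eps - i%:~R) * (eps - j'%:~R) = j%:~R * i'%:~R.
    apply: (mulIf n0); apply: (mulIf ob0).
    transitivity ((eps - i%:~R) * n%:R * ((eps - j'%:~R) * (omega - b%:~R))); first by ring.
    by rewrite f1 f2; ring.
  move=> h; rewrite rmorphB rmorphD !rmorphM /= -h; ring.
have epsn : eps * n%:R = i%:~R * n%:R + j%:~R * (omega - b%:~R) by rewrite -f1; ring.
have epsK : K eps.
  exists (i%:~R + j%:~R / n%:R * (1 / 2%:R - b%:~R)), (j%:~R / n%:R / 2%:R).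
  apply: (mulIf n0); rewrite epsn -/(sqrtmp p).
  rewrite !(ratr_nat, ratr_int, rmorphD, rmorphB, rmorphM, fmorphV, rmorph1) /= -[omega]/((1 + sqrtmp p) / 2%:R).
  by field; rewrite n0.
have [e [f ef]] := (ring_of_integersP p_prime p_mod4 eps).1 (conj epsK epsA).
have Nef : qnorm p e f = 1.
  have h : (qnorm p (n%:Z * x' + (b - 1) * y') y')%:~R = (qnorm p e f)%:~R *
      (qnorm p (n%:Z * x + (b - 1) * y) y)%:~R :> algC.
    rewrite -!qint_norm // -ef -/(tau x' y') -/(tau x y) epsE rmorphM; ring.
  rewrite !conj_elt_norm (multiple_norm g0 k0 nz m) (multiple_norm g0 k0 nz' m') in h.
  have nzN : (n%:Z * (g ^ 2 * k)%N%:Z)%:~R != 0 :> algC.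
    by rewrite intr_eq0 mulf_neq0 // eqz_nat -lt0n ?muln_gt0 ?expn_gt0 ?g0.
  by apply: (@intr_inj algC); apply: (mulIf nzN); rewrite mul1r -h.
have := qnorm4 p_prime p_mod4 e f; rewrite Nef => e4.
have f0 : f = 0 by nia.
have e1' : e = 1 \/ e = -1 by move: e4; rewrite f0; nia.
have tE : tau x' y' = e%:~R * tau x y by rewrite epsE ef f0 -qintr.
have nn : n%:Z != 0 by rewrite eqz_nat -lt0n.
move: tE; rewrite /conj_elt qintZ => /(qint_inj p_prime p_mod4)[ex ey].
have ex' : x' = e * x.
  by apply: (mulfI nn); move: ex; rewrite ey => ex; apply: (addIr ((b - 1) * (e * y))); rewrite ex; ring.
by case: e1' => e1'; rewrite ex' ey e1' ?mul1r ?mulN1r; [left | right].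
Qed.

End Correspondence.

(** * Ideal classes *)

Section IdealEquiv.
Local Open Scope classical_set_scope.
Local Open Scope ring_scope.
Variables (p : nat).
Hypotheses (p_prime : prime p) (p_mod4 : (p %% 4 = 3)%N).
Local Notation K := (quadratic_field (- p%:Z)).
Local Notation O := (ring_of_integers K).
Local Notation qint := (qint p).
Local Notation omega := (omega p).
Local Notation hnf_ideal := (hnf_ideal p).

Lemma intr_O (k : int) : O k%:~R.
Proof. by rewrite (qintr p); exact: qint_O. Qed.

Lemma O_mul x y : O x -> O y -> O (x * y).
Proof.
move=> /(ring_of_integersP p_prime p_mod4)[a [b ->]].
by move=> /(ring_of_integersP p_prime p_mod4)[c [d ->]]; rewrite qintM //; exact: qint_O.
Qed.

Lemma ideal_equiv_refl I : ideal_equiv K I I.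
Proof. by exists 1, 1; split; rewrite ?oner_eq0 //; exact: (intr_O 1). Qed.

Lemma ideal_equiv_sym I J : ideal_equiv K I J -> ideal_equiv K J I.
Proof. by move=> [a [b [Oa Ob a0 b0 e]]]; exists b, a. Qed.

Lemma ideal_equiv_trans I J L :
  ideal_equiv K I J -> ideal_equiv K J L -> ideal_equiv K I L.
Proof.
move=> [a [b [Oa Ob a0 b0 e]]] [c [d [Oc Od c0 d0 e']]].
exists (c * a), (b * d); split; rewrite ?mulf_neq0 //; try exact: O_mul.
apply/seteqP; split=> _ [z Iz <-].
  have [y Jy ey] : [set b * y | y in J] (a * z) by rewrite -e; exists z.
  have [w Lw ew] : [set d * w | w in L] (c * y) by rewrite -e'; exists y.
  by exists w => //; rewrite -mulrA ew mulrCA ey mulrA.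
have [y Jy ey] : [set c * y | y in J] (d * z) by rewrite e'; exists z.
have [w Iw ew] : [set a * w | w in I] (b * y) by rewrite e; exists y.
by exists w => //; rewrite -mulrA ew mulrCA ey mulrA.
Qed.

Lemma hnf_ideal_equiv_primitive g n b : (0 < g)%N ->
  ideal_equiv K (hnf_ideal g n b) (hnf_ideal 1 n b).
Proof.
move=> g0; exists 1, g%:R; split; rewrite ?oner_eq0 ?pnatr_eq0 -?lt0n //.
- exact: (intr_O 1).
- exact: (intr_O g).
apply/seteqP; split=> _ [z [x [y [-> nx]]] <-].
  exists (qint x y); first by apply/hnf_ideal1P.
  by rewrite mul1r pmulrn qintZ.
by exists (qint (g%:Z * x) (g%:Z * y)); [exists x, y | rewrite mul1r pmulrn qintZ !mul1r].
Qed.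

(** Multiplication by the conjugate of omega - b maps Z n + Z (omega - b) onto
    n times the lattice attached to the cofactor of n in the norm of omega - b. *)
Lemma hnf_ideal_equiv_cofactor n c (b : int) : (0 < n)%N -> (0 < c)%N ->
  fnorm p b = n%:Z * c%:Z -> ideal_equiv K (hnf_ideal 1 n b) (hnf_ideal 1 c (1 - b)).
Proof.
move=> n0 c0 nc; have om : omega ^+ 2 = omega - (p.+1 %/ 4)%:Z%:~R.
  by rewrite omega_sq // pmulrn.
have mE : (p.+1 %/ 4)%:Z = n%:Z * c%:Z - b ^+ 2 + b by rewrite -nc /fnorm; ring.
have elt (k l : int) : qint (1 - b) (-1) * (k%:~R * n%:R + l%:~R * (omega - b%:~R)) =
    n%:R * ((-k)%:~R * (omega - (1 - b)%:~R) + l%:~R * c%:R).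
  have -> : qint (1 - b) (-1) = 1 - b%:~R - omega.
    by rewrite qintE !rmorphD !rmorphN /=; ring.
  transitivity (n%:R * k%:~R * (1 - b%:~R - omega) +
     l%:~R * (omega - b%:~R + b%:~R ^+ 2 - omega ^+ 2)); first by ring.
  rewrite om mE !(rmorphD, rmorphB, rmorphN, rmorphM, rmorphXn, rmorph1) /= -?pmulrn; ring.
exists (qint (1 - b) (-1)), n%:R; split.
- exact: qint_O.
- exact: (intr_O n).
- by rewrite qint_eq0 // andbC.
- by rewrite pnatr_eq0 -lt0n.
apply/seteqP; split=> _ [z Iz <-].
  have [k [l ->]] := hnf_ideal1_span Iz; rewrite elt; eexists; last by [].
  have -> : (-k)%:~R * (omega - (1 - b)%:~R) + l%:~R * c%:R =
     qint (k * (1 - b) + l * c%:Z) (- k).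
    by rewrite qintE !(rmorphD, rmorphB, rmorphN, rmorphM, rmorph1) /= -?pmulrn; ring.
  by apply/hnf_ideal1P => //; apply/dvdzP; exists l; ring.
have [k [l ->]] := hnf_ideal1_span Iz.
exists ((-l)%:~R * n%:R + k%:~R * (omega - b%:~R)).
  have -> : (-l)%:~R * n%:R + k%:~R * (omega - b%:~R) =
     qint (- l * n%:Z - k * b) k.
    by rewrite qintE !(rmorphD, rmorphB, rmorphN, rmorphM, rmorph1) /= -?pmulrn; ring.
  by apply/hnf_ideal1P => //; apply/dvdzP; exists (- l); ring.
by rewrite elt opprK addrC.
Qed.

Lemma fnorm_gt0 (b : int) : 0 < fnorm p b.
Proof. by have := fnorm4 p_prime p_mod4 b; have := prime_gt0 p_prime; nia. Qed.

Lemma fnorm_sym (b : int) : fnorm p (1 - b) = fnorm p b.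
Proof. by rewrite /fnorm; ring. Qed.

Definition primitive_pair (n b : nat) := [&& (0 < n)%N, (b < n)%N & (n %| fnorm p b)%Z].

Lemma primitive_pair_residue (n : nat) (b : int) : (0 < n)%N -> (n %| fnorm p b)%Z ->
  exists b' : nat, primitive_pair n b' /\ hnf_ideal 1 n b = hnf_ideal 1 n b'.
Proof.
move=> n0 nf; have r0 : 0 <= (b %% n)%Z by rewrite modz_ge0 // eqz_nat -lt0n.
have rE : `|(b %% n)%Z|%N%:Z = (b %% n)%Z by rewrite gez0_abs.
exists `|(b %% n)%Z|%N; split; last by rewrite rE; apply: hnf_ideal_mod; rewrite eq_sym modz_mod.
apply/and3P; split=> //; first by rewrite -ltz_nat rE ltz_pmod.
by rewrite rE (@fnorm_mod _ _ _ b) // -eqz_mod_dvd modz_mod.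
Qed.

(** If n > p, then the cofactor of n in the norm of omega - b is smaller than n, so
    the norm can be decreased inside the class. *)
Lemma small_representative n b : primitive_pair n b -> exists n' b' : nat,
  [/\ (n' <= p)%N, primitive_pair n' b' & ideal_equiv K (hnf_ideal 1 n b) (hnf_ideal 1 n' b')].
Proof.
have [m] := ubnP n; elim: m n b => // m IH n b nm /and3P[n0 bn nf].
have [np|pn] := leqP n p.
  by exists n, b; split=> //; [exact/and3P | exact: ideal_equiv_refl].
have [c' cE] := dvdzP nf; have fpos := fnorm_gt0 b%:Z.
have [c c'E] : exists c : nat, c' = c%:Z by exists `|c'|%N; nia.
rewrite {}c'E in cE.
have c0 : (0 < c)%N by nia.
have cn : (c < n)%N.
  have mp : ((p.+1 %/ 4)%N <= p)%N by move: p_mod4; lia.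
  have : (c%:Z * n%:Z < n%:Z * n%:Z).
    rewrite -cE /fnorm; have : (b%:Z ^+ 2 - b%:Z <= (n%:Z - 1) * (n%:Z - 2)) by nia.
    by nia.
  by nia.
have eq1 : ideal_equiv K (hnf_ideal 1 n b) (hnf_ideal 1 c (1 - b%:Z)).
  by apply: hnf_ideal_equiv_cofactor => //; rewrite cE mulrC.
have [||b' [cb' eb']] := @primitive_pair_residue c (1 - b%:Z) => //.
  by rewrite fnorm_sym cE dvdz_mulr.
have [|n2 [b2 [n2p v2 eq2]]] := IH c b' _ cb'; first by apply: leq_trans cn _; rewrite -ltnS.
exists n2, b2; split=> //; apply: ideal_equiv_trans eq1 _.
by rewrite eb'.
Qed.

Definition pairT := ('I_p.+1 * 'I_p.+1)%type.
Definition pair_ideal (t : pairT) := hnf_ideal 1 t.1 (t.2 : nat).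
Definition is_primitive (t : pairT) := primitive_pair t.1 t.2.
Definition equivb (t u : pairT) := `[< ideal_equiv K (pair_ideal t) (pair_ideal u) >].
(** The choice depends only on the class of t, because the predicate does. *)
Definition class_rep (t : pairT) := odflt t [pick u | is_primitive u && equivb u t].

(** One primitive ideal of norm at most p in each ideal class. *)
Definition class_reps : {set pairT} := class_rep @: [pred t | is_primitive t].

Lemma class_repP t : is_primitive t ->
  is_primitive (class_rep t) /\ ideal_equiv K (pair_ideal (class_rep t)) (pair_ideal t).
Proof.
move=> vt; rewrite /class_rep; case: pickP => [u /andP[vu /asboolP eu]//|/(_ t)].
by rewrite vt /= => /asboolP[]; exact: ideal_equiv_refl.
Qed.

Lemma class_reps_primitive r : r \in class_reps -> is_primitive r.
Proof. by move=> /imsetP[t vt ->]; have [] := class_repP vt. Qed.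

Lemma class_rep_eq t u : is_primitive t -> is_primitive u ->
  ideal_equiv K (pair_ideal t) (pair_ideal u) -> class_rep t = class_rep u.
Proof.
move=> vt vu e; rewrite /class_rep.
have -> : [pick v | is_primitive v && equivb v t] = [pick v | is_primitive v && equivb v u].
  apply: eq_pick => v; congr (_ && _); apply/asboolP/asboolP => h.
    exact: ideal_equiv_trans h e.
  by apply: ideal_equiv_trans h _; exact: ideal_equiv_sym.
case: pickP => //= /(_ u); rewrite vu /= => /asboolP[]; exact: ideal_equiv_refl.
Qed.

Lemma class_reps_inj r r' : r \in class_reps -> r' \in class_reps ->
  ideal_equiv K (pair_ideal r) (pair_ideal r') -> r = r'.
Proof.
move=> /imsetP[t vt ->] /imsetP[t' vt' ->] e; apply: class_rep_eq => //.
have [_ e1] := class_repP vt; have [_ e2] := class_repP vt'.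
apply: ideal_equiv_trans (ideal_equiv_sym e1) _; exact: ideal_equiv_trans e e2.
Qed.

Lemma hnf_ideal_class_rep g n b : (0 < g)%N -> primitive_pair n b ->
  exists2 r, r \in class_reps & ideal_equiv K (hnf_ideal g n b) (pair_ideal r).
Proof.
move=> g0 v; have [n' [b' [n'p v' e']]] := small_representative v.
have /and3P[n0' bn' _] := v'.
have n'lt : (n' < p.+1)%N by rewrite ltnS.
have b'lt : (b' < p.+1)%N by rewrite ltnS (leq_trans (ltnW bn')).
pose t : pairT := (Ordinal n'lt, Ordinal b'lt).
have [vr er] := @class_repP t v'.
exists (class_rep t); first by apply/imsetP; exists t.
apply: ideal_equiv_trans (hnf_ideal_equiv_primitive _ _ g0) _.
by apply: ideal_equiv_trans e' _; exact: ideal_equiv_sym.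
Qed.

Lemma pair_ideal_ideal t : is_primitive t -> is_nonzero_ideal K (pair_ideal t).
Proof. by move=> /and3P[n0 _ nf]; exact: hnf_ideal_ideal. Qed.

Lemma ideal_class_eq I J : is_nonzero_ideal K I -> is_nonzero_ideal K J ->
  ideal_class K I = ideal_class K J <-> ideal_equiv K I J.
Proof.
move=> hI hJ; split=> [e|e].
  by have [] : ideal_class K I J by rewrite e; split=> //; exact: ideal_equiv_refl.
apply/seteqP; split=> L [hL eL]; split=> //.
  by apply: ideal_equiv_trans eL; exact: ideal_equiv_sym.
exact: ideal_equiv_trans eL.
Qed.

(** In particular the set of classes is finite, so the class number really counts
    it. *)
Lemma hneg_class_reps : hneg p = #|class_reps|.
Proof.
rewrite /hneg /class_number.
have -> : ideal_classes K = [set ideal_class K (pair_ideal r) | r in [set` class_reps]].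
  apply/seteqP; split=> _ [I hI <-].
    have [g [n [b [g0 n0 bn nf IE]]]] := nonzero_ideal_hnf p_prime p_mod4 hI.
    have [r rr er] : exists2 r, r \in class_reps & ideal_equiv K (hnf_ideal g n b) (pair_ideal r).
      by apply: hnf_ideal_class_rep => //; exact/and3P.
    exists r => //; apply/ideal_class_eq => //.
      exact/pair_ideal_ideal/class_reps_primitive.
    by rewrite IE; exact: ideal_equiv_sym.
  exists (pair_ideal I) => //.
  exact/pair_ideal_ideal/class_reps_primitive.
rewrite fset_set_image; last exact: finite_finset.
rewrite card_in_imfset /=; last first.
  move=> r r'; rewrite !in_fset_set; try exact: finite_finset.
  rewrite !inE => rr rr' /ideal_class_eq h; apply: class_reps_inj => //.
  by apply: h; exact/pair_ideal_ideal/class_reps_primitive.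
have -> : [set` class_reps] = [set` [fset x in class_reps]%fset].
  by apply/seteqP; split=> x /=; rewrite !inE.
by rewrite set_fsetK card_imfset //= -cardE.
Qed.
End IdealEquiv.

(** * Representations of an integer by the forms *)

Section Counting.
Local Open Scope classical_set_scope.
Local Open Scope ring_scope.
Variables (p : nat).
Hypotheses (p_prime : prime p) (p_mod4 : (p %% 4 = 3)%N) (p_gt3 : (3 < p)%N).
Local Notation K := (quadratic_field (- p%:Z)).
Local Notation hnf_ideal := (hnf_ideal p).

Lemma multiple_neg n b x y g k c :
  multiple_of p n b x y g k c -> multiple_of p n b (- x) (- y) g k c.
Proof.
rewrite /multiple_of => ->.
have neg z : hnf_ideal 1 n b z -> hnf_ideal 1 n b (- z).
  move=> [u [v [-> h]]]; exists (- u), (- v); rewrite qintN !mulrN; split=> //.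
  by rewrite -opprD rpredN.
have tN : conj_elt p n b (- x) (- y) = - conj_elt p n b x y.
  by rewrite /conj_elt qintN; congr (qint p _ _); ring.
rewrite tN; apply/seteqP; split=> _ [w Jw <-]; exists (- w); try exact: neg.
  by rewrite mulrNN.
by rewrite mulrN mulNr.
Qed.

Lemma multiple_inj n b x y g k c g' k' c' : (0 < n)%N ->
  multiple_of p n b x y g k c -> multiple_of p n b x y g' k' c' ->
  hnf_ideal g k c = hnf_ideal g' k' c'.
Proof.
move=> n0; rewrite /multiple_of => <- e; have nz : (n%:R : algC) != 0 by rewrite pnatr_eq0 -lt0n.
apply/seteqP; split=> z Iz.
  have [z' Iz' /(mulfI nz) <-] // : [set n%:R * z | z in hnf_ideal g' k' c'] (n%:R * z).
  by rewrite e; exists z.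
have [z' Iz' /(mulfI nz) <-] // : [set n%:R * z | z in hnf_ideal g k c] (n%:R * z).
by rewrite -e; exists z.
Qed.

Local Notation box R := ('I_(2 * R).+1 * 'I_(2 * R).+1)%type.

Definition rform (r : pairT p) (x y : int) := qform p r.1 (r.2 : nat) x y.

Section FixedNorm.
Variables (N R : nat).
Hypothesis N_gt0 : (0 < N)%N.
Hypothesis box_large : forall r x y, r \in class_reps p -> rform r x y = N%:Z ->
  `|x| <= R%:Z /\ `|y| <= R%:Z.

(** The double counting of the next lemmas is carried out between the vectors of
    value N, tagged with their form, and the types (g, k, c) of the ideals of norm
    N = g^2 k. *)
Definition reprs : {set pairT p * box R} :=
  [set a : pairT p * box R | (a.1 \in class_reps p) &&
    (rform a.1 (centered a.2.1) (centered a.2.2) == N%:Z)].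

Definition ideals_of_norm : {set 'I_N.+1 * ('I_N.+1 * 'I_N.+1)} :=
  [set t : 'I_N.+1 * ('I_N.+1 * 'I_N.+1) | (t.1 ^ 2 * t.2.1 == N)%N && primitive_pair p t.2.1 t.2.2].

Definition generates (a : pairT p * box R) (t : 'I_N.+1 * ('I_N.+1 * 'I_N.+1)) : bool :=
  `[< multiple_of p a.1.1 (a.1.2 : nat) (centered a.2.1) (centered a.2.2) t.1 t.2.1 (t.2.2 : nat) >].

Lemma norm_gt0 (t : 'I_N.+1 * ('I_N.+1 * 'I_N.+1)) :
  t \in ideals_of_norm -> (0 < t.1)%N /\ (0 < t.2.1)%N.
Proof.
rewrite inE => /andP[/eqP e _].
by move: N_gt0; rewrite -{1}e muln_gt0 expn_gt0 orbF => /andP[-> ->].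
Qed.

Lemma conj_elt_neq0 r x y M : r \in class_reps p -> rform r x y = M%:Z -> (0 < M)%N ->
  conj_elt p r.1 (r.2 : nat) x y != 0.
Proof.
move=> /(class_reps_primitive p_prime p_mod4) /and3P[n0 _ nf] e M0.
rewrite conj_elt_eq0 //; apply/negP=> /andP[/eqP x0 /eqP y0].
by move: e; rewrite /rform /qform x0 y0 => e; move: M0 e; lia.
Qed.

Lemma reprs_unique_ideal a : a \in reprs ->
  #|[set t in ideals_of_norm | generates a t]| = 1%N.
Proof.
case: a => r [i j]; rewrite inE /= => /andP[rr /eqP e].
have /and3P[n0 _ nf] := class_reps_primitive p_prime p_mod4 rr.
have nz := conj_elt_neq0 rr e N_gt0.
have [g [k [c [g0 k0 ck kf m]]]] := multiple_exists p_prime p_mod4 n0 nf nz.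
have := multiple_norm p_prime p_mod4 n0 nf g0 k0 nz m; rewrite -/(rform _ _ _) e => -[NE].
have gN : (g < N.+1)%N by rewrite ltnS NE -mulnn; nia.
have kN : (k < N.+1)%N by rewrite ltnS NE -mulnn; nia.
have cN : (c < N.+1)%N by apply: ltn_trans kN.
apply/eqP/cards1P; exists (Ordinal gN, (Ordinal kN, Ordinal cN)).
apply/setP=> -[g' [k' c']]; rewrite !inE /=; apply/andP/eqP => [|[-> -> ->] /=].
  move=> [/andP[/eqP e' /and3P[k0' ck' kf']] /asboolP m'].
  have g0' : (0 < g')%N by move: N_gt0; rewrite -{1}e' muln_gt0 expn_gt0 orbF => /andP[].
  have [eg ek ec] := hnf_ideal_inj p_prime p_mod4 g0 k0 ck g0' k0' ck' (multiple_inj n0 m m').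
  by congr (_, (_, _)); apply: val_inj.
by rewrite -NE eqxx /primitive_pair k0 ck kf; split=> //; apply/asboolP.
Qed.

Lemma ideal_two_reprs t : t \in ideals_of_norm ->
  #|[set a in reprs | generates a t]| = 2%N.
Proof.
move=> tI; have [g0 k0] := norm_gt0 tI; move: tI.
case: t g0 k0 => g [k c] /= g0 k0; rewrite inE /= => /andP[/eqP NE v].
have [r rr er] := hnf_ideal_class_rep p_prime p_mod4 g0 v.
have /and3P[n0 _ nf] := class_reps_primitive p_prime p_mod4 rr.
have [x [y [nz m]]] := equiv_multiple p_prime p_mod4 n0 g0 k0 er.
have Qxy : rform r x y = N%:Z.
  by rewrite /rform (multiple_norm p_prime p_mod4 n0 nf g0 k0 nz m) NE.
have [xR yR] := box_large rr Qxy.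
have [i ix] := centeredP xR; have [j jy] := centeredP yR.
have xRN : `|- x| <= R%:Z by rewrite normrN.
have yRN : `|- y| <= R%:Z by rewrite normrN.
have [i' ix'] := centeredP xRN; have [j' jy'] := centeredP yRN.
have -> : [set a in reprs | generates a (g, (k, c))] = [set (r, (i, j)); (r, (i', j'))]%SET.
  apply/setP=> -[r' [u v']]; rewrite !inE /=; apply/andP/orP.
    move=> [/andP[rr' /eqP e'] /asboolP /= m'].
    have nz' := conj_elt_neq0 rr' e' N_gt0.
    have /and3P[n0' _ nf'] := class_reps_primitive p_prime p_mod4 rr'.
    have rE : r = r'.
      apply: (class_reps_inj p_prime p_mod4) => //.
      apply: ideal_equiv_trans (ideal_equiv_sym er) _ => //.
      exact: (multiple_equiv p_prime p_mod4 n0' nz' m').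
    move: nz' m' e'; rewrite -rE => nz' m' e'.
    have [[ex ey]|[ex ey]] := multiple_unique p_prime p_mod4 n0 nf p_gt3 g0 k0 nz nz' m m'.
      by left; apply/eqP; congr (_, (_, _)); apply: centered_inj; rewrite ?ix ?jy.
    by right; apply/eqP; congr (_, (_, _)); apply: centered_inj; rewrite ?ix' ?jy'.
  move=> [/eqP[-> -> ->]|/eqP[-> -> ->]].
    by rewrite rr ix jy Qxy eqxx; split=> //; apply/asboolP; rewrite /= ix jy.
  rewrite rr ix' jy'; split; last by apply/asboolP; rewrite /= ix' jy'; exact: multiple_neg.
  by apply/eqP; rewrite -Qxy /rform /qform; ring.
rewrite cards2; case: eqP => // -[ii jj].
move: nz; rewrite conj_elt_eq0 //.
have -> : x = 0 by move: ix'; rewrite -ii ix; lia.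
have -> : y = 0 by move: jy'; rewrite -jj jy; lia.
by rewrite eqxx.
Qed.

Lemma card_reprs : #|reprs| = (#|ideals_of_norm| * 2)%N.
Proof.
have fib (T : finType) (A : {set T}) (P : pred T) :
    #|[set a in A | P a]| = (\sum_(a in A) (P a : nat))%N.
  rewrite -sum1_card [RHS]big_mkcond [LHS]big_mkcond; apply: eq_bigr => a _.
  by rewrite inE; case: (a \in A) => //=; case: (P a).
have -> : #|reprs| = (\sum_(a in reprs) \sum_(t in ideals_of_norm) (generates a t : nat))%N.
  rewrite -sum1_card; apply: eq_bigr => a /reprs_unique_ideal; rewrite fib; exact: esym.
rewrite exchange_big /= -sum_nat_const; apply: eq_bigr => t /ideal_two_reprs.
by rewrite fib.
Qed.

Lemma card_ideals_of_norm : #|ideals_of_norm| = ideal_count p N.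
Proof.
have dv : perm_eq (divisors N) [seq g <- iota 0 N.+1 | (g %| N)%N].
  apply: uniq_perm; rewrite ?divisors_uniq ?filter_uniq ?iota_uniq // => d.
  rewrite -dvdn_divisors // mem_filter mem_iota /= add0n ltnS.
  by case: (boolP (d %| N)%N) => // /dvdn_leq ->.
rewrite /ideal_count (perm_big _ dv) big_filter_cond.
rewrite -[iota 0 N.+1]/(index_iota 0 N.+1) big_mkord.
rewrite -sum1_card big_mkcond /=.
transitivity (\sum_(g < N.+1) \sum_(kc : 'I_N.+1 * 'I_N.+1)
    (if (g, kc) \in ideals_of_norm then 1 else 0))%N.
  by rewrite pair_bigA; apply: eq_bigr => -[].
rewrite [RHS]big_mkcond; apply: eq_bigr => g _.
have [g2N|g2N] := boolP (g ^ 2 %| N)%N; last first.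
  rewrite andbF big1 // => -[k c] _; rewrite inE /=; case: eqP => //= e.
  by case/negP: g2N; rewrite -[X in (_ %| X)%N]e dvdn_mulr.
have -> : (g %| N)%N by apply: dvdn_trans g2N; rewrite -mulnn dvdn_mulr.
have [n nE] := dvdnP g2N; have g0 : (0 < g)%N by move: N_gt0 nE; case: (g : nat) => //=; lia.
have gg0 : (0 < g ^ 2)%N by rewrite expn_gt0 g0.
have n0 : (0 < n)%N by move: N_gt0; rewrite nE muln_gt0 => /andP[].
have nN : (n < N.+1)%N by rewrite ltnS nE leq_pmulr.
have -> : (N %/ g ^ 2 = n)%N by rewrite [X in (X %/ _)%N]nE mulnK.
transitivity (\sum_(k < N.+1) \sum_(c < N.+1)
    (if (g, (k, c)) \in ideals_of_norm then 1 else 0))%N.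
  by rewrite pair_bigA; apply: eq_bigr => -[].
rewrite (bigD1 (Ordinal nN)) //= [X in (_ + X)%N]big1 ?addn0; last first.
  move=> k kn; rewrite big1 // => c _; rewrite inE /=; case: eqP => //= e.
  case/negP: kn; apply/eqP/val_inj => /=; apply/eqP.
  by rewrite -(eqn_pmul2l gg0) e mulnC -nE.
rewrite (root_count_sum p (ltnW nN)); apply: eq_bigr => c _.
rewrite inE /= mulnC -nE eqxx /primitive_pair n0 /=.
by case: (c < n)%N => //=; case: (n %| _)%Z.
Qed.

Lemma sum_representations :
  (\sum_(r in class_reps p)
     \sum_(v : box R | rform r (centered v.1) (centered v.2) == N%:Z) 1 =
   2 * ideal_count p N)%N.
Proof.
rewrite [RHS]mulnC -card_ideals_of_norm -card_reprs -sum1_card pair_big_dep /=.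
by apply: eq_bigl => a; rewrite inE.
Qed.

End FixedNorm.
End Counting.

(** * The class number formula *)

Section ClassNumberFormula.
Variable p : nat.
Hypotheses (p_prime : prime p) (p_mod4 : (p %% 4 = 3)%N) (p_gt3 : (3 < p)%N).
Variable R : archiRealFieldType.

Let p_odd := odd_mod4 p_prime p_mod4.
Definition chi (d : nat) : R := (legendre d p)%:~R.
Local Notation reps := (class_reps p).
Local Notation h := #|reps|.

Lemma chi0 : chi 0 = 0.
Proof. by rewrite /chi legendre0. Qed.

Lemma chi_le1 d : `|chi d| <= 1.
Proof. by rewrite /chi -intr_norm -[1]/(1%:~R) ler_int legendre_le1. Qed.

Lemma sum_legendre : \sum_(d < p) legendre (d : nat) p = 0.
Proof.
have p0 := prime_gt0 p_prime.
have e : \sum_(d < p) legendre (d : nat) p = \sum_(1 <= d < p) legendre d p.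
  by rewrite -(big_mkord xpredT (fun d : nat => legendre d p)) big_ltn // legendre0 // add0r.
have : \sum_(1 <= d < p) legendre d p = - \sum_(1 <= d < p) legendre d p.
  rewrite {1}big_nat_rev /= -sumrN big_nat [RHS]big_nat; apply: eq_bigr => d /andP[d0 dp].
  by rewrite add1n subSS legendre_opp // ltnW.
by rewrite e => /eqP; rewrite -addr_eq0 -mulr2n mulrn_eq0 => /eqP.
Qed.

Lemma chi_balanced : balanced p chi.
Proof.
split=> [i|]; last by rewrite -rmorph_sum /= sum_legendre.
rewrite /chi; congr _%:~R; apply: (legendre_mod p_prime p_odd).
by rewrite eqz_mod_dvd PoszD addrAC subrr add0r dvdzz.
Qed.

Lemma sum_partial_sums (c : nat -> R) n :
  \sum_(j < n) \sum_(i < j) c i = \sum_(i < n) (n%:R - 1 - i%:R) * c i.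
Proof.
elim: n => [|n IH]; first by rewrite !big_ord0.
rewrite big_ord_recr /= IH big_ord_recr /= -natr1 addrK subrr mul0r addr0 -big_split /=.
by apply: eq_bigr => i _; ring.
Qed.

Lemma chi_mean : p%:R * mean_partial p chi = - (\sum_(d < p) d%:Z * legendre (d : nat) p)%:~R.
Proof.
have p0 : (p%:R : R) != 0 by rewrite pnatr_eq0 -lt0n prime_gt0.
rewrite /mean_partial mulrC divfK // sum_partial_sums.
under eq_bigr => i _ do rewrite mulrBl.
have [_ c0] := chi_balanced.
rewrite sumrB -mulr_sumr c0 mulr0 sub0r; congr (- _).
by rewrite rmorph_sum /=; apply: eq_bigr => i _; rewrite rmorphM.
Qed.

Lemma rformE (r : pairT p) x y : rform r x y =
  quad (r.1 : nat)%:Z (2 * (r.2 : nat)%:Z - 1) (fnorm p (r.2 : nat) %/ (r.1 : nat))%Z x y.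
Proof. by []. Qed.

Lemma rform_disc (r : pairT p) : r \in reps ->
  [/\ 0 < (r.1 : nat)%:Z, 0 < (fnorm p (r.2 : nat) %/ (r.1 : nat))%Z,
   (fnorm p (r.2 : nat) %/ (r.1 : nat))%Z <= 2 * (p ^ 2)%N%:Z &
   4 * (r.1 : nat)%:Z * (fnorm p (r.2 : nat) %/ (r.1 : nat))%Z -
     (2 * (r.2 : nat)%:Z - 1) ^+ 2 = p].
Proof.
move=> rr; have /and3P[n0 bn nf] := class_reps_primitive p_prime p_mod4 rr.
have f0 := fnorm_gt0 p_prime p_mod4 (r.2 : nat)%:Z.
have [c fE] := dvdzP nf; have fE4 := fnorm4 p_prime p_mod4 (r.2 : nat)%:Z.
rewrite fE mulzK ?eqz_nat -?lt0n //.
have bp : (r.2 <= p)%N by rewrite -ltnS ltn_ord.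
have c0 : 0 < c by rewrite fE in f0; nia.
split=> //.
  have : c * (r.1 : nat)%:Z <= 2 * (p ^ 2)%N%:Z.
    rewrite -fE; have -> : (p ^ 2)%N%:Z = p%:Z ^+ 2 by rewrite expnS expn1 PoszM.
    by move: fE4; move: (fnorm p _) => F; nia.
  by apply: le_trans; rewrite ler_peMr ?(ltW c0).
by move: fE4; rewrite fE => e; rewrite -mulrA [_ * c]mulrC e; ring.
Qed.

(** From 4 A Q = (2 A x + B y)^2 + p y^2 and the symmetric identity, with
    coefficients at most 2 p^2. *)
Lemma rform_bounds (r : pairT p) (M : nat) x y : r \in reps -> (0 < M)%N ->
  rform r x y <= (M ^ 2)%N%:Z ->
  `|x| <= (4 * p ^ 2 * M)%N%:Z /\ `|y| <= (4 * p ^ 2 * M)%N%:Z.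
Proof.
move=> rr M0; have [A0 C0 Cle disc] := rform_disc rr; rewrite rformE.
have Ap : (r.1 : nat)%:Z <= p%:Z by rewrite lez_nat -ltnS ltn_ord.
move: ((r.1 : nat)%:Z) (2 * (r.2 : nat)%:Z - 1) (fnorm p _ %/ _)%Z A0 C0 Cle disc Ap => A B C A0 C0 Cle disc Ap.
have p0 : (0 < p)%N := prime_gt0 p_prime.
rewrite /quad => Qle.
have bnd (D z : int) : 0 < D -> D <= 2 * (p ^ 2)%N%:Z -> p%:Z * z ^+ 2 <= 4 * D * (M ^ 2)%N%:Z ->
    `|z| <= (4 * p ^ 2 * M)%N%:Z.
  move=> D0 Dp zD.
  have h1 : z ^+ 2 <= (2 * D * M%:Z) ^+ 2.
    have -> : (2 * D * M%:Z) ^+ 2 = D * (4 * D * (M ^ 2)%N%:Z).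
      by rewrite -[(M ^ 2)%N]mulnn PoszM; ring.
    apply: (@le_trans _ _ (p%:Z * z ^+ 2)); first by rewrite ler_peMl ?sqr_ge0.
    by apply: le_trans zD _; rewrite ler_peMl // !mulr_ge0 // ltW.
  have h2 : `|z| <= 2 * D * M%:Z.
    by rewrite -(@ler_pXn2r _ 2) ?nnegrE ?normr_ge0 ?mulr_ge0 ?(ltW D0) // -normrX ger0_norm ?sqr_ge0.
  apply: le_trans h2 _; rewrite !PoszM ler_wpM2r //; lia.
have pp : p%:Z <= 2 * (p ^ 2)%N%:Z by rewrite -PoszM lez_nat -mulnn (leq_trans (leq_pmulr p p0)) // leq_pmull.
split; [apply: (bnd C) => // | apply: (bnd A) => //; last 1 first].
- have -> : p%:Z * x ^+ 2 = 4 * C * (A * x ^+ 2 + B * x * y + C * y ^+ 2) - (2 * C * y + B * x) ^+ 2.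
    by rewrite -disc; ring.
  apply: (@le_trans _ _ (4 * C * (A * x ^+ 2 + B * x * y + C * y ^+ 2))).
    by rewrite gerBl sqr_ge0.
  by rewrite ler_wpM2l // mulr_ge0 // ltW.
- have -> : p%:Z * y ^+ 2 = 4 * A * (A * x ^+ 2 + B * x * y + C * y ^+ 2) - (2 * A * x + B * y) ^+ 2.
    by rewrite -disc; ring.
  apply: (@le_trans _ _ (4 * A * (A * x ^+ 2 + B * x * y + C * y ^+ 2))).
    by rewrite gerBl sqr_ge0.
  by rewrite ler_wpM2l // mulr_ge0 // ltW.
- exact: le_trans Ap pp.
Qed.

Lemma rform_ge0 (r : pairT p) x y : r \in reps -> 0 <= rform r x y.
Proof.
move=> rr; have [A0 C0 _ disc] := rform_disc rr; rewrite rformE.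
move: ((r.1 : nat)%:Z) (2 * (r.2 : nat)%:Z - 1) (fnorm p _ %/ _)%Z A0 C0 disc => A B C A0 C0 disc.
have e : 4 * A * quad A B C x y = (2 * A * x + B * y) ^+ 2 + p%:Z * y ^+ 2.
  by rewrite -disc /quad; ring.
have : 0 <= 4 * A * quad A B C x y.
  by rewrite e; apply: addr_ge0; [exact: sqr_ge0 | apply: mulr_ge0 => //; exact: sqr_ge0].
by rewrite pmulr_rge0 // mulr_gt0.
Qed.

Lemma rform_eq0 (r : pairT p) x y : r \in reps -> (rform r x y == 0) = (x == 0) && (y == 0).
Proof.
move=> rr; have /and3P[n0 bn nf] := class_reps_primitive p_prime p_mod4 rr.
have := conj_elt_eq0 p_prime p_mod4 (r.2 : nat)%:Z n0 x y => <-.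
rewrite /conj_elt qint_eq0 // -(qnorm_eq0 p_prime p_mod4) conj_elt_norm // mulf_eq0.
by rewrite eqz_nat (gtn_eqF n0).
Qed.
(** The lattice points are sorted by the value of the form. The origin is the only
    point of value 0, and it is the source of the class number. *)
Lemma sum_forms (psi : nat -> R) (X S : nat) :
  (forall n, (X < n)%N -> psi n = 0) ->
  (forall r x y, r \in reps -> rform r x y <= X%:Z -> `|x| <= S%:Z /\ `|y| <= S%:Z) ->
  \sum_(r in reps) \sum_(i < (2 * S).+1) \sum_(j < (2 * S).+1)
     psi `|rform r (centered i) (centered j)|%N =
  h%:R * psi 0%N + 2%:R * \sum_(1 <= n < X.+1) psi n * (ideal_count p n)%:R.
Proof.
move=> psi0 large.
have split1 r : r \in reps ->
   \sum_(i < (2 * S).+1) \sum_(j < (2 * S).+1) psi `|rform r (centered i) (centered j)|%N =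
   \sum_(0 <= n < X.+1) psi n *
     (\sum_(v : 'I_(2 * S).+1 * 'I_(2 * S).+1 | rform r (centered v.1) (centered v.2) == n%:Z) 1)%N%:R.
  move=> rr; rewrite pair_bigA /=.
  under [RHS]eq_bigr => n _ do rewrite natr_sum mulr_sumr big_mkcond /=.
  rewrite exchange_big /=; apply: eq_bigr => v _.
  have q0 := rform_ge0 (centered v.1) (centered v.2) rr.
  rewrite -big_mkcond /= (eq_bigl (fun n => n == `|rform r (centered v.1) (centered v.2)|%N)); last first.
    by move=> n /=; rewrite -eqz_nat gez0_abs // eq_sym.
  rewrite big_nat1_eq /=; case: ltnP => hX; rewrite ?mulr1 //.
  by rewrite psi0.
rewrite (eq_bigr _ split1) exchange_big /= big_ltn //; congr (_ + _).
  rewrite -mulr_sumr -natr_sum mulrC; congr (_%:R * _).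
  rewrite -[RHS]muln1 -sum_nat_const; apply: eq_bigr => r rr.
  have S0 : (S < (2 * S).+1)%N by lia.
  rewrite (eq_bigl (fun v => v == (Ordinal S0, Ordinal S0))) ?big_pred1_eq //.
  move=> [i j] /=; rewrite rform_eq0 // xpair_eqE -!val_eqE /= /centered.
  by rewrite !subr_eq0 !eqz_nat.
rewrite mulr_sumr big_nat [RHS]big_nat; apply: eq_bigr => n /andP[n0 nX].
rewrite -mulr_sumr -natr_sum (sum_representations p_prime p_mod4 p_gt3 n0); last first.
  by move=> r x y rr e; apply: (large r) => //; rewrite e lez_nat -ltnS.
by rewrite natrM; ring.
Qed.

Lemma sum_ideal_count (psi : nat -> R) (X : nat) :
  (forall n, (X < n)%N -> psi n = 0) ->
  \sum_(1 <= n < X.+1) psi n * (ideal_count p n)%:R =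
  \sum_(1 <= d < X.+1) chi d * \sum_(1 <= k < X.+1) psi (d * k)%N.
Proof.
move=> psi0.
transitivity (\sum_(1 <= n < X.+1) \sum_(1 <= d < X.+1 | (d %| n)%N) chi d * psi n).
  rewrite big_nat [RHS]big_nat; apply: eq_bigr => n /andP[n0 nX].
  rewrite -mulr_suml mulrC; congr (_ * _).
  have dv : perm_eq (divisors n) [seq d <- index_iota 1 X.+1 | (d %| n)%N].
    apply: uniq_perm; rewrite ?divisors_uniq ?filter_uniq ?iota_uniq // => d.
    rewrite -dvdn_divisors // mem_filter mem_index_iota.
    have [dn|//] := boolP (d %| n)%N.
    by rewrite (dvdn_gt0 n0 dn) ltnS (leq_trans (dvdn_leq n0 dn)).
  by rewrite pmulrn ideal_countE // (perm_big _ dv) /= big_filter rmorph_sum.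
under eq_bigr => n _ do rewrite big_mkcond.
rewrite exchange_big /= big_nat [RHS]big_nat; apply: eq_bigr => d /andP[d0 dX].
by rewrite -big_mkcond -mulr_sumr sum_multiples.
Qed.

Lemma lattice_bound_reps : exists2 c : R, 0 <= c & forall M : nat, (0 < M)%N ->
  `|\sum_(r in reps) \sum_(i < (2 * (2 * (4 * p ^ 2 * M))).+1)
      \sum_(j < (2 * (2 * (4 * p ^ 2 * M))).+1)
        (4%:R * (~~ odd i && ~~ odd j)%:R - 1) *
        norm_weight R (M ^ 2) (rform r (centered i) (centered j))| <= c * M%:R ^+ 5.
Proof.
have k3 : (2 < 4 * p ^ 2)%N by rewrite -mulnn; nia.
have /fin_all_exists[f fP] : forall r : pairT p, exists c : R, 0 <= c /\
    (r \in reps -> forall M : nat, (0 < M)%N ->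
    `|\sum_(i < (2 * (2 * (4 * p ^ 2 * M))).+1) \sum_(j < (2 * (2 * (4 * p ^ 2 * M))).+1)
        (4%:R * (~~ odd i && ~~ odd j)%:R - 1) *
        norm_weight R (M ^ 2) (rform r (centered i) (centered j))| <= c * M%:R ^+ 5).
  move=> r; have [rr|_] := boolP (r \in reps); last by exists 0.
  have [A0 C0 _ _] := rform_disc rr.
  have Q0 x y : 0 <= quad (r.1 : nat)%:Z (2 * (r.2 : nat)%:Z - 1)
      (fnorm p (r.2 : nat) %/ (r.1 : nat))%Z x y by rewrite -rformE rform_ge0.
  have [c c0 cP] := lattice_bound R A0 C0 Q0 k3.
  exists c; split=> // _ M M0; apply: cP => // x y; rewrite -rformE => h1.
  by apply: (rform_bounds rr M0); exact: ltW.
exists (\sum_(r in reps) f r); first by apply: sumr_ge0 => r _; case: (fP r).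
move=> M M0; apply: le_trans (ler_norm_sum _ _ _) _; rewrite mulr_suml.
by apply: ler_sum => r rr; case: (fP r) => _; exact.
Qed.

(** The part of the sum over even points is the sum of 4 phi(4 Q v) over all
    points, by homogeneity. *)
Lemma lattice_sum_eq (M : nat) : (0 < M)%N ->
  \sum_(r in reps) \sum_(i < (2 * (2 * (4 * p ^ 2 * M))).+1)
      \sum_(j < (2 * (2 * (4 * p ^ 2 * M))).+1)
        (4%:R * (~~ odd i && ~~ odd j)%:R - 1) *
        norm_weight R (M ^ 2) (rform r (centered i) (centered j)) =
  3%:R * h%:R * (M ^ 2)%:R ^+ 3 + 2%:R * \sum_(1 <= k < (M ^ 2).+1) mod4_weight R k *
    (\sum_(d < (M ^ 2).+1) chi d * pos_cube ((M ^ 2)%:R - d%:R * k%:R)).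
Proof.
move=> M0; set X := (M ^ 2)%N; set S := (4 * p ^ 2 * M)%N.
pose psi (n : nat) : R := pos_cube (X%:R - n%:R).
pose psi4 (n : nat) : R := pos_cube (X%:R - (4 * n)%:R).
have psi0 n : (X < n)%N -> psi n = 0.
  by move=> Xn; apply: pos_cube_le0; rewrite subr_le0 ler_nat ltnW.
have psi40 n : (X < n)%N -> psi4 n = 0.
  by move=> Xn; apply: pos_cube_le0; rewrite subr_le0 ler_nat; lia.
have large r x y : r \in reps -> rform r x y <= X%:Z -> `|x| <= S%:Z /\ `|y| <= S%:Z.
  by move=> rr; exact: rform_bounds.
have large2 r x y : r \in reps -> rform r x y <= X%:Z ->
    `|x| <= (2 * S)%N%:Z /\ `|y| <= (2 * S)%N%:Z.
  by move=> rr /(large _ _ _ rr)[h1 h2]; split; lia.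
transitivity (4%:R * (\sum_(r in reps) \sum_(i < (2 * S).+1) \sum_(j < (2 * S).+1)
     psi4 `|rform r (centered i) (centered j)|%N) -
   \sum_(r in reps) \sum_(i < (2 * (2 * S)).+1) \sum_(j < (2 * (2 * S)).+1)
     psi `|rform r (centered i) (centered j)|%N).
  rewrite mulr_sumr -sumrB; apply: eq_bigr => r rr.
  transitivity (4%:R * (\sum_(i < (2 * S).+1) \sum_(j < (2 * S).+1)
      norm_weight R X (rform r (2 * centered i) (2 * centered j))) -
    \sum_(i < (2 * (2 * S)).+1) \sum_(j < (2 * (2 * S)).+1)
      norm_weight R X (rform r (centered i) (centered j))).
    rewrite -(sum_even_box (fun x y => norm_weight R X (rform r x y))) mulr_sumr -sumrB.
    apply: eq_bigr => i _; rewrite mulr_sumr -sumrB; apply: eq_bigr => j _.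
    by rewrite mulrBl mul1r mulrA.
  congr (_ * _ - _); apply: eq_bigr => i _; apply: eq_bigr => j _.
    have -> : rform r (2 * centered i) (2 * centered j) = 4 * rform r (centered i) (centered j).
      by rewrite !rformE /quad; ring.
    rewrite /norm_weight /psi4 natrM; congr (pos_cube (_ - _)).
    by rewrite rmorphM /=; congr (_ * _); rewrite [RHS]pmulrn gez0_abs // rform_ge0.
  rewrite /norm_weight /psi; congr (pos_cube (_ - _)).
  by rewrite [RHS]pmulrn gez0_abs // rform_ge0.
rewrite (sum_forms psi40 large) (sum_forms psi0 large2).
rewrite (sum_ideal_count psi40) (sum_ideal_count psi0).
have e0 : psi 0%N = X%:R ^+ 3 by rewrite /psi subr0 pos_cube_ge0.
have e4 : psi4 0%N = X%:R ^+ 3 by rewrite /psi4 muln0 subr0 pos_cube_ge0.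
rewrite e0 e4.
have -> : \sum_(1 <= k < X.+1) mod4_weight R k * (\sum_(d < X.+1) chi d * pos_cube (X%:R - d%:R * k%:R)) =
   4%:R * (\sum_(1 <= d < X.+1) chi d * \sum_(1 <= k < X.+1) psi4 (d * k)%N) -
   \sum_(1 <= d < X.+1) chi d * \sum_(1 <= k < X.+1) psi (d * k)%N.
  transitivity (\sum_(1 <= d < X.+1) chi d * \sum_(1 <= k < X.+1) mod4_weight R k * psi (d * k)%N).
    under eq_bigr => k _ do rewrite mulr_sumr.
    rewrite exchange_big /= -(big_mkord xpredT (fun d : nat =>
      \sum_(1 <= k < X.+1) mod4_weight R k * (chi d * pos_cube (X%:R - d%:R * k%:R)))) big_ltn //.
    rewrite big1 ?add0r; last by move=> k _; rewrite chi0 mul0r mulr0.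
    apply: eq_bigr => d _; rewrite mulr_sumr; apply: eq_bigr => k _.
    by rewrite /psi natrM mulrCA.
  rewrite mulr_sumr -sumrB big_nat [RHS]big_nat; apply: eq_bigr => d /andP[d0 _].
  rewrite mulrCA -mulrBr; congr (_ * _).
  have -> : \sum_(1 <= k < X.+1) psi4 (d * k)%N = \sum_(1 <= k < X.+1 | (4 %| k)%N) psi (d * k)%N.
    rewrite (@sum_multiples _ X 4 (fun k => psi (d * k)%N)) //; last first.
      by move=> n Xn; apply: psi0; rewrite (leq_trans Xn) // leq_pmull.
    by apply: eq_bigr => k _; rewrite /psi /psi4 mulnCA.
  rewrite [in RHS]big_mkcond mulr_sumr -sumrB; apply: eq_bigr => k _.
  by rewrite /mod4_weight; case: ifP => _; ring.
ring.
Qed.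

(** The regularized value at 0 of the zeta function of the field: on one side each
    ideal class contributes the omitted lattice point 0, on the other side the
    hyperbola method produces the mean of the partial sums of the character. *)
Lemma class_number_mean : h%:R = mean_partial p chi.
Proof.
have [c c0 lat] := lattice_bound_reps.
have [C C0 hyp] := hyperbola_sum (prime_gt0 p_prime) chi_balanced chi0 chi_le1.
set H := mean_partial p chi in hyp *.
pose D := `|h%:R - H|.
(* X = t^10 and q = t^6 balance the two errors q^3 X and X^4 / q^2 at t^28. *)
have key (t : nat) : (1 < t)%N -> 3%:R * D * t%:R ^+ 2 <= c + 4%:R * C.
  move=> t1; have t0 : (0 < t)%N by exact: ltnW.
  have M0 : (0 < t ^ 5)%N by rewrite expn_gt0 t0.
  have q0 : (0 < t ^ 6)%N by rewrite expn_gt0 t0.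
  have qX : (4 * t ^ 6 <= (t ^ 5) ^ 2)%N.
    rewrite -expnM -[(5 * 2)%N]/(4 + 6)%N expnD leq_mul2r.
    by rewrite (@leq_trans (2 ^ 4)%N) ?orbT // leq_exp2r.
  have h1 := lat _ M0; rewrite lattice_sum_eq // in h1.
  have := hyp _ _ q0 qX; move: h1; set X := ((t ^ 5) ^ 2)%N; set S := \sum_(1 <= k < X.+1) _.
  move=> h1 h2.
  have t0R : 0 < t%:R :> R by rewrite ltr0n.
  have XE : X%:R = t%:R ^+ 10 :> R by rewrite /X -expnM natrX.
  have ME : (t ^ 5)%:R ^+ 5 = t%:R ^+ 25 :> R by rewrite natrX -exprM.
  have e1 : (t ^ 6)%:R ^+ 3 * X%:R = t%:R ^+ 28 :> R by rewrite XE natrX -exprM -exprD.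
  have e2 : X%:R ^+ 4 / (t ^ 6)%:R ^+ 2 = t%:R ^+ 28 :> R.
    rewrite XE natrX -!exprM -[(10 * 4)%N]/(28 + 6 * 2)%N exprD mulfK //.
    by rewrite expf_neq0 // gt_eqF.
  rewrite ME in h1; rewrite e1 e2 in h2.
  have t28 : t%:R ^+ 25 <= t%:R ^+ 28 :> R by rewrite ler_eXn2l // ltr1n.
  have : `|3%:R * (h%:R - H) * X%:R ^+ 3| <= (c + 4%:R * C) * t%:R ^+ 28.
    have -> : 3%:R * (h%:R - H) * X%:R ^+ 3 =
      (3%:R * h%:R * X%:R ^+ 3 + 2%:R * S) - 2%:R * (S + 3%:R / 2%:R * H * X%:R ^+ 3) by field.
    apply: le_trans (ler_normB _ _) _.
    have h3 : `|2%:R * (S + 3%:R / 2%:R * H * X%:R ^+ 3)| <= 4%:R * C * t%:R ^+ 28.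
      by rewrite normrM normr_nat; lra.
    have h4 := le_trans h1 (ler_wpM2l c0 t28).
    by rewrite [X in _ <= X]mulrDl; exact: lerD h4 h3.
  have X3 : X%:R ^+ 3 = t%:R ^+ 2 * t%:R ^+ 28 :> R by rewrite XE -exprM -exprD.
  have p28 : 0 <= t%:R ^+ 2 * t%:R ^+ 28 :> R by rewrite mulr_ge0 ?exprn_ge0.
  rewrite X3 normrM (ger0_norm p28) normrM normr_nat -/D mulrA.
  by rewrite ler_pM2r // exprn_gt0.
have D0 : 0 <= D by exact: normr_ge0.
apply/eqP; rewrite -subr_eq0 -normr_eq0 -/D; apply/eqP; apply/le_anti.
rewrite D0 andbT leNgt; apply/negP => Dpos.
pose B := (c + 4%:R * C) / D.
have B0 : 0 <= B by rewrite divr_ge0 // addr_ge0 // mulr_ge0.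
pose t := (Num.bound B + 2)%N.
have tP : c + 4%:R * C < t%:R * D.
  rewrite -ltr_pdivrMr // natrD -/B; have := archi_boundP B0; lra.
have t2 : t%:R <= t%:R ^+ 2 :> R by rewrite -natrX ler_nat -mulnn leq_pmulr // addn2.
have := key t (leq_addl _ _); have := ler_wpM2l D0 t2; have := ler0n R t.
have := mulr_ge0 D0 (ler0n R t); move: tP; rewrite -/t [t%:R * D]mulrC.
move: (t%:R) => T; move: (D * T) => DT; rewrite -mulrA.
by move: (D * T ^+ 2) => DT2; lra.
Qed.

(** Dirichlet's class number formula for the discriminant -p, with p > 3 so that
    the only units are 1 and -1. *)
Theorem class_number_formula :
  p%:Z * (hneg p)%:Z = - \sum_(d < p) d%:Z * legendre (d : nat) p.
Proof.
apply: (@intr_inj R); rewrite rmorphN /= -chi_mean -class_number_mean.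
by rewrite hneg_class_reps // rmorphM.
Qed.
End ClassNumberFormula.

(** * The parity of the number of pairs *)

Lemma sign_mod3 (k N : nat) (y : int) :
  3 * N%:Z = 3 * (4 * k%:Z + 1) * k%:Z - 2 * k%:Z * y -> (-1) ^+ N = (-1) ^+ k :> int.
Proof.
move=> e; rewrite -signr_odd -[in RHS]signr_odd; congr (_ ^+ nat_of_bool _).
have {}e : 3 * N%:Z = 12 * (k%:Z * k%:Z) + 3 * k%:Z - 2 * (k%:Z * y) by rewrite e; ring.
by move: e; move: (k%:Z * k%:Z) (k%:Z * y) => x z; lia.
Qed.

Lemma sign_mod7 (k h N : nat) (e : int) : e = 1 \/ e = -1 ->
  2 * N%:Z = (4 * k%:Z + 3) * (2 * k%:Z + 1 - e * h%:Z) ->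
  (-1) ^+ N = (-1) ^+ (k + 1 + (h + 1) %/ 2) * e :> int.
Proof.
move=> e1 e2.
have [u hu] : exists u : nat, h = (2 * u + 1)%N.
  exists (h./2); move: e2; case: e1 => ->; move=> e2.
    have : 2 * N%:Z = 8 * (k%:Z * k%:Z) + 10 * k%:Z + 3 - 4 * (k%:Z * h%:Z) - 3 * h%:Z.
      by rewrite e2; ring.
    by move: (k%:Z * k%:Z) (k%:Z * h%:Z) => x y; lia.
  have : 2 * N%:Z = 8 * (k%:Z * k%:Z) + 10 * k%:Z + 3 + 4 * (k%:Z * h%:Z) + 3 * h%:Z.
    by rewrite e2; ring.
  by move: (k%:Z * k%:Z) (k%:Z * h%:Z) => x y; lia.
have -> : ((h + 1) %/ 2 = u + 1)%N by rewrite hu; lia.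
have hz : h%:Z = 2 * u%:Z + 1 by rewrite hu; lia.
rewrite hz in e2; move: e2.
case: e1 => -> e2.
  rewrite mulr1 -signr_odd -[in RHS]signr_odd; congr (_ ^+ nat_of_bool _).
  have : N%:Z = 4 * (k%:Z * (k%:Z - u%:Z)) + 3 * (k%:Z - u%:Z).
    by apply: (@mulfI _ (2 : int)) => //; rewrite e2; ring.
  by move: (k%:Z * _) => x; lia.
rewrite -exprSr -signr_odd -[in RHS]signr_odd; congr (_ ^+ nat_of_bool _).
have : N%:Z = 4 * (k%:Z * (k%:Z + u%:Z + 1)) + 3 * (k%:Z + u%:Z + 1).
  by apply: (@mulfI _ (2 : int)) => //; rewrite e2; ring.
by move: (k%:Z * _) => x; lia.
Qed.

Theorem corollary1p3 (p : nat) (a : int) (p_prime : prime p) (p_odd : odd p)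
    (pNa : ~~ (p %| a)%Z) :
  let N := #|pair_set p a| in
  [/\ p = 1 %[mod 4] -> (-1) ^+ N = 1 :> int,
      p = 3 %[mod 8] -> (-1) ^+ N = (-1) ^+ ((p - 3) %/ 8) :> int
    & p = 7 %[mod 8] ->
      (-1) ^+ N = (-1) ^+ ((p + 1) %/ 8 + (hneg p + 1) %/ 2) * legendre a p].
Proof.
move=> N; have pE := prime_odd_half p_prime p_odd.
split=> [p1|p3|p7].
- have om : ~~ odd p.-1./2 by lia.
  have := pair_count_mod1 p_prime p_odd pNa om; rewrite -/N -signr_odd.
  have [k mk] : exists k : nat, p.-1./2 = (2 * k)%N by exists (p.-1./2./2); lia.
  rewrite mk => e; have {}e : N%:Z = k%:Z * (k%:Z - 1) by lia.
  have -> : odd N = false.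
    have [k2|k2] : (exists j : nat, k = 2 * j)%N \/ (exists j : nat, k = 2 * j + 1)%N.
      by have := odd_double_half k; case: (odd k) => /= h; [right | left]; exists k./2; lia.
      by case: k2 e => j ->; nia.
    by case: k2 e => j ->; nia.
  by [].
- have om : odd p.-1./2 by lia.
  have p4 : (p %% 4 = 3)%N by lia.
  have := pair_count_mod3 p_prime p_odd pNa om; rewrite -/N.
  have := sum_legendre_half p_prime p4; rewrite legendre_two //.
  have -> : (p %% 8 == 7)%N = false by lia.
  have [k pk] : exists k : nat, p = (8 * k + 3)%N by exists (p %/ 8)%N; lia.
  have -> : ((p - 3) %/ 8 = k)%N by lia.
  have mk : p.-1./2 = (4 * k + 1)%N by lia.
  have pz : p%:Z = 8 * k%:Z + 3 by lia.
  have mz : (4 * k + 1)%N%:Z = 4 * k%:Z + 1 by lia.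
  rewrite mk pz.
  set A := \sum_(d < p) _; set T := \sum_(1 <= i < _) _ => eA eN.
  have e3 : 3 * N%:Z = 3 * (4 * k%:Z + 1) * k%:Z - 2 * k%:Z * (legendre a p * T).
    have eta3 : 3 * (legendre a p * A) = - ((8 * k%:Z + 3) * (legendre a p * T)).
      transitivity (- (legendre a p * ((-1 - 2) * A))); [ring | rewrite eA; ring].
    apply: (@mulfI _ (4 : int)) => //; transitivity (3 * (4 * N%:Z)); first by ring.
    rewrite eN mz; move: eta3; move: (legendre a p * A) (legendre a p * T) => x y xy.
    transitivity (3 * ((4 * k%:Z + 1) * (8 * k%:Z + 3)) + 3 * x -
      3 * ((4 * k%:Z + 1) * (4 * k%:Z + 1 + 2)) + 3 * y); [ring | rewrite xy; ring].
  exact: sign_mod3 e3.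
have om : odd p.-1./2 by lia.
have p4 : (p %% 4 = 3)%N by lia.
have p_gt3 : (3 < p)%N by lia.
have := pair_count_mod3 p_prime p_odd pNa om; rewrite -/N.
have := sum_legendre_half p_prime p4; rewrite legendre_two //.
have -> : (p %% 8 == 7)%N = true by lia.
have := class_number_formula p_prime p4 p_gt3 rat.
have [k pk] : exists k : nat, p = (8 * k + 7)%N by exists (p %/ 8)%N; lia.
have -> : ((p + 1) %/ 8 = k + 1)%N by lia.
have mk : p.-1./2 = (4 * k + 3)%N by lia.
have pz : p%:Z = 8 * k%:Z + 7 by lia.
rewrite mk; move: (hneg p) => h.
set A := \sum_(d < p) _; set T := \sum_(1 <= i < _) _ => eh eA eN.
have AE : A = - (p%:Z * T) by rewrite -eA; ring.
have hT : h%:Z = T.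
  have p0 : p%:Z != 0 by lia.
  by apply: (mulfI p0); rewrite eh AE opprK.
have e2 : 2 * N%:Z = (4 * k%:Z + 3) * (2 * k%:Z + 1 - legendre a p * h%:Z).
  have mz : (4 * k + 3)%N%:Z = 4 * k%:Z + 3 by lia.
  apply: (@mulfI _ (2 : int)) => //; transitivity (4 * N%:Z); first by ring.
  by rewrite eN AE -hT mz pz; ring.
exact: sign_mod7 (legendre_pm1 pNa) e2.
Qed.
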